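(* Let $(M,g)$ be a pseudo-Riemannian manifold and let $(x_1,\dots,x_n)$ be KEM coordinates on $M$. Then $(x_1,\dots,x_n)$ are orthogonal separable coordinates with diagonal curvature.
   Context: All considerations are local. $\nabla$ is the Levi-Civita connection, $G$ the contravariant metric. Coordinates are orthogonal if $g=\sum_ie_iH_i^2dx_i^2$ with $e_i=\pm1$, $H_i>0$. They are separable if the geodesic Hamilton-Jacobi equation $\tfrac12g^{ij}\partial_iW\partial_jW=E$ admits a complete integral $W=\sum_iW_i(x_i;c_1,\dots,c_n)$ with $\det(\partial^2W/\partial x_i\partial c_j)\neq0$; for orthogonal coordinates this is equivalent to the Levi-Civita equations: for all distinct $i,j,k$, $\partial_i\partial_j\log H_i^2+\partial_j\log H_i^2\,\partial_i\log H_j^2=0$ and $\partial_j\partial_k\log H_i^2-\partial_j\log H_i^2\,\partial_k\log H_i^2+\partial_j\log H_i^2\,\partial_k\log H_j^2+\partial_k\log H_i^2\,\partial_j\log H_k^2=0$. Coordinates have diagonal curvature if the Riemann tensor satisfies $R_{ijik}=0$ for all $j\neq k$ in the coordinate basis. Concircular tensor: a symmetric 2-tensor $L$ with $\nabla_kL_{ij}=\alpha_{(i}g_{j)k}$ for some covector field $\alpha$. It is non-trivial if it is not a multiple of the metric when $n>1$. An orthogonal concircular tensor (OCT) is a concircular tensor whose endomorphism $L^i{}_j$ is pointwise diagonalizable. For any OCT $L$ there is (locally) a product structure $M=\prod_{i=0}^kM_i$ with $\dim M_i>1$ for $i>0$, such that, with $F_i$ the canonical foliation induced by $M_i$: $L|_{F_0}$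 has simple eigenfunctions, so that $L|_{M_0}$ induces separable coordinates $(x_0)$ on $(M_0,g|_{M_0})$ (coordinates adapted to its eigenspaces); and for $i>0$, $L|_{F_i}$ is a constant multiple of $G|_{F_i}$. (That is, $M_0$ corresponds to the sum of the one-dimensional eigenspaces of $L$ and $M_1,\dots,M_k$ to the multidimensional ones; $M_0$ may be a point.) KEM (Kalnins-Eisenhart-Miller) coordinates are defined recursively on the dimension: let $L$ be a non-trivial OCT, let $M=\prod_{i=0}^kM_i$ be its associated local product structure (with $\dim M_i>1$ for $i>0$, $L|_{F_0}$ having simple eigenfunctions, and $L|_{F_i}$ a constant multiple of $G|_{F_i}$ for $i>0$), and let $(x_0)$ be the separable coordinates on $(M_0,g|_{M_0})$ induced by $L|_{M_0}$, i.e. coordinates adapted to its eigenspaces; for each $i=1,\dots,k$ let $(x_i)$ be KEM coordinates on $(M_i,g|_{M_i})$. Then the product coordinates $(x_0,x_1,\dots,x_k)$ are KEM coordinates on $M$. When $L$ has simple eigenfunctions the definition is non-recursive ($k=0$). *)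

(* Defs.v *)
From HB Require Import structures.
From mathcomp Require Import all_boot all_order all_algebra.
From mathcomp Require Import all_classical all_reals all_analysis.
Set Implicit Arguments.
Unset Strict Implicit.
Unset Printing Implicit Defensive.
Import Order.TTheory GRing.Theory Num.Theory.
Import numFieldNormedType.Exports.
Local Open Scope classical_set_scope.
Local Open Scope ring_scope.

(* Everything is local, so a coordinate system (x_1, ..., x_n) on a manifold
   is identified with its open range U in R^n: points are row vectors, and a
   2-tensor field T is given by its components T x i j in these coordinates.
   The norm on 'rV[R]_n is the sup norm, so that [ball p r] is a coordinate
   box, i.e. a product of intervals. *)

Definition partial (R : realType) (n : nat) (i : 'I_n)
    (f : 'rV[R]_n -> R) (x : 'rV[R]_n) : R :=
  'D_(delta_mx 0 i) f x.

Definition partials (R : realType) (n : nat) (s : seq 'I_n)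
    (f : 'rV[R]_n -> R) : 'rV[R]_n -> R :=
  foldr (@partial R n) f s.

(* C^oo on the open set U: the iterated partial derivatives of all orders
   exist and are continuous at the points of U. *)
Definition smooth_on (R : realType) (n : nat) (U : set 'rV[R]_n)
    (f : 'rV[R]_n -> R) : Prop :=
  forall (s : seq 'I_n) (x : 'rV[R]_n), U x ->
    {for x, continuous (partials s f)} /\
    (forall i : 'I_n, derivable (partials s f) x (delta_mx 0 i)).

Definition symmetric_tensor (R : realType) (n : nat) (U : set 'rV[R]_n)
    (T : 'rV[R]_n -> 'M[R]_n) : Prop :=
  (forall i j : 'I_n, smooth_on U (fun x => T x i j)) /\
  (forall x : 'rV[R]_n, U x -> (T x)^T = T x).

Definition pseudo_riemannian (R : realType) (n : nat) (U : set 'rV[R]_n)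
    (g : 'rV[R]_n -> 'M[R]_n) : Prop :=
  symmetric_tensor U g /\ (forall x : 'rV[R]_n, U x -> g x \in unitmx).

(* [christoffel g l i j] is Gamma^l_{ij}; [invmx (g x)] is the contravariant
   metric. *)
Definition christoffel (R : realType) (n : nat) (g : 'rV[R]_n -> 'M[R]_n)
    (l i j : 'I_n) (x : 'rV[R]_n) : R :=
  2^-1 * \sum_(m < n) invmx (g x) l m *
    (partial i (fun y => g y j m) x + partial j (fun y => g y i m) x
     - partial m (fun y => g y i j) x).

(* nabla_k T_{ij} for the Levi-Civita connection of g *)
Definition nabla (R : realType) (n : nat) (g T : 'rV[R]_n -> 'M[R]_n)
    (k i j : 'I_n) (x : 'rV[R]_n) : R :=
  partial k (fun y => T y i j) x
  - \sum_(m < n) christoffel g m k i x * T x m j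
  - \sum_(m < n) christoffel g m k j x * T x i m.

(* R_{lkij} = g_{lm} R^m_{kij}, where
   R(d_i, d_j) d_k = nabla_i nabla_j d_k - nabla_j nabla_i d_k
                   = R^m_{kij} d_m. *)
Definition riemann (R : realType) (n : nat) (g : 'rV[R]_n -> 'M[R]_n)
    (l k i j : 'I_n) (x : 'rV[R]_n) : R :=
  \sum_(m < n) g x l m *
    (partial i (christoffel g m j k) x - partial j (christoffel g m i k) x
     + \sum_(q < n) (christoffel g m i q x * christoffel g q j k x
                     - christoffel g m j q x * christoffel g q i k x)).

Definition diagonal_curvature (R : realType) (n : nat) (U : set 'rV[R]_n)
    (g : 'rV[R]_n -> 'M[R]_n) : Prop :=
  forall x : 'rV[R]_n, U x ->
    forall i j k : 'I_n, j != k -> riemann g i j i k x = 0.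

Definition orthogonal_coordinates (R : realType) (n : nat) (U : set 'rV[R]_n)
    (g : 'rV[R]_n -> 'M[R]_n) : Prop :=
  forall p : 'rV[R]_n, U p ->
    exists (e : 'I_n -> R) (H : 'I_n -> 'rV[R]_n -> R),
      (forall i : 'I_n, e i = 1 \/ e i = -1) /\
      \forall x \near p,
        (forall i : 'I_n, 0 < H i x) /\
        g x = diag_mx (\row_i (e i * H i x ^+ 2)).

(* Near each point there is a complete integral of the geodesic
   Hamilton-Jacobi equation that is a sum of functions of one coordinate each.
   It is a function on 'rV_(n + n), where [lsubmx z] is the point x and
   [rsubmx z] the vector c of parameters. The energy E depends on c. *)
Definition separated_sum (R : realType) (n : nat)
    (w : 'I_n -> R -> 'rV[R]_n -> R) (z : 'rV[R]_(n + n)) : R :=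
  \sum_(i < n) w i (lsubmx z 0 i) (rsubmx z).

Definition complete_integral (R : realType) (n : nat) (V C : set 'rV[R]_n)
    (g : 'rV[R]_n -> 'M[R]_n) (E : 'rV[R]_n -> R)
    (W : 'rV[R]_(n + n) -> R) : Prop :=
  let D := [set z : 'rV[R]_(n + n) | V (lsubmx z) /\ C (rsubmx z)] in
  smooth_on D W /\
  forall z : 'rV[R]_(n + n), D z ->
    2^-1 * (\sum_(i < n) \sum_(j < n) invmx (g (lsubmx z)) i j *
              partial (lshift n i) W z * partial (lshift n j) W z)
      = E (rsubmx z) /\
    \det (\matrix_(i < n, j < n)
            partial (lshift n i) (partial (rshift n j) W) z) != 0.

Definition separable_coordinates (R : realType) (n : nat) (U : set 'rV[R]_n)
    (g : 'rV[R]_n -> 'M[R]_n) : Prop :=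
  forall p : 'rV[R]_n, U p ->
    exists (r : R) (C : set 'rV[R]_n) (E : 'rV[R]_n -> R)
           (w : 'I_n -> R -> 'rV[R]_n -> R),
      0 < r /\ open C /\ C !=set0 /\
      complete_integral (ball p r) C g E (separated_sum w).

Definition concircular (R : realType) (n : nat) (U : set 'rV[R]_n)
    (g L : 'rV[R]_n -> 'M[R]_n) : Prop :=
  symmetric_tensor U L /\
  exists alpha : 'rV[R]_n -> 'rV[R]_n,
    (forall i : 'I_n, smooth_on U (fun x => alpha x 0 i)) /\
    forall x : 'rV[R]_n, U x -> forall i j k : 'I_n,
      nabla g L k i j x =
        2^-1 * (alpha x 0 i * g x j k + alpha x 0 j * g x i k).

(* The endomorphism v^j |-> L^i_j v^j of a covariant symmetric tensor, acting
   on the right of the row vector of the components v^j. *)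
Definition endo (R : realType) (n : nat) (g L : 'M[R]_n) : 'M[R]_n :=
  L *m invmx g.

Definition orthogonal_concircular (R : realType) (n : nat)
    (U : set 'rV[R]_n) (g L : 'rV[R]_n -> 'M[R]_n) : Prop :=
  concircular U g L /\
  forall x : 'rV[R]_n, U x -> diagonalizable (endo (g x) (L x)).

Definition nontrivial (R : realType) (n : nat) (U : set 'rV[R]_n)
    (g L : 'rV[R]_n -> 'M[R]_n) : Prop :=
  (1 < n)%N ->
  ~ exists f : 'rV[R]_n -> R, forall x : 'rV[R]_n, U x -> L x = f x *: g x.

(* A partition of the coordinates into k + 1 blocks, given by
   [blk : 'I_n -> 'I_k.+1], presents a coordinate box as a product
   M_0 x M_1 x ... x M_k, the coordinates of M_a being the x_i with
   [blk i = a]. *)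
Definition block (n k : nat) (blk : 'I_n -> 'I_k.+1) (a : 'I_k.+1) :
    {set 'I_n} :=
  [set i | blk i == a].

Definition block_index (n k : nat) (blk : 'I_n -> 'I_k.+1) (a : 'I_k.+1) :
    'I_#|block blk a| -> 'I_n :=
  @enum_val _ (mem (block blk a)).

(* The tangent space of the foliation F_a, as a row space. *)
Definition block_space (R : realType) (n k : nat) (blk : 'I_n -> 'I_k.+1)
    (a : 'I_k.+1) : 'M[R]_n :=
  (\sum_(i in block blk a) <<delta_mx 0 i : 'rV[R]_n>>)%MS.

(* The leaf of F_a through p, parametrized by the coordinates of M_a; this is
   how M_a is realized as a submanifold. *)
Definition leaf (R : realType) (n k : nat) (blk : 'I_n -> 'I_k.+1)
    (a : 'I_k.+1) (p : 'rV[R]_n) (y : 'rV[R]_#|block blk a|) : 'rV[R]_n :=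
  \row_j (if [pick i | block_index i == j] is Some i then y 0 i else p 0 j).

Definition leaf_point (R : realType) (n k : nat) (blk : 'I_n -> 'I_k.+1)
    (a : 'I_k.+1) (p : 'rV[R]_n) : 'rV[R]_#|block blk a| :=
  colsub (@block_index n k blk a) p.

Definition leaf_restr (R : realType) (n k : nat) (blk : 'I_n -> 'I_k.+1)
    (a : 'I_k.+1) (p : 'rV[R]_n) (T : 'rV[R]_n -> 'M[R]_n)
    (y : 'rV[R]_#|block blk a|) : 'M[R]_#|block blk a| :=
  mxsub (@block_index n k blk a) (@block_index n k blk a) (T (leaf p y)).

(* The product given by [blk] is the product structure associated with the OCT
   L: the tangent space of F_0 is the sum (i.e. the least upper bound) of the
   one-dimensional eigenspaces of L, while for a > 0 the tangent space of F_a
   is a multidimensional eigenspace on which L is a constant multiple of the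
   metric. *)
Definition associated_product (R : realType) (n k : nat) (U : set 'rV[R]_n)
    (g L : 'rV[R]_n -> 'M[R]_n) (blk : 'I_n -> 'I_k.+1) : Prop :=
  (forall x : 'rV[R]_n, U x -> forall S : 'M[R]_n,
     (block_space R blk ord0 <= S)%MS <->
     (forall a : R, \rank (eigenspace (endo (g x) (L x)) a) = 1%N ->
        (eigenspace (endo (g x) (L x)) a <= S)%MS)) /\
  (forall a : 'I_k.+1, a != ord0 ->
     (1 < #|block blk a|)%N /\
     exists c : R, forall x : 'rV[R]_n, U x ->
       (eigenspace (endo (g x) (L x)) c == block_space R blk a)%MS /\
       (forall i j : 'I_n, blk i = a -> blk j = a ->
          L x i j = c * g x i j)).

(* The coordinates x_i with [blk i = 0] on the leaf M_0 through p are adapted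
   to the eigenspaces of the restriction of L to M_0, which are lines. *)
Definition adapted_coordinates (R : realType) (n k : nat)
    (U : set 'rV[R]_n) (g L : 'rV[R]_n -> 'M[R]_n) (blk : 'I_n -> 'I_k.+1)
    (p : 'rV[R]_n) : Prop :=
  forall y : 'rV[R]_#|block blk ord0|, U (leaf p y) ->
    forall i : 'I_#|block blk ord0|, exists a : R,
      (eigenspace (endo (leaf_restr p g y) (leaf_restr p L y)) a
         == (delta_mx 0 i : 'rV[R]_#|block blk ord0|))%MS.

(* KEM coordinates around the point p. The factors M_a are the leaves through
   p of the local product structure. *)
Inductive KEM_at (R : realType) : forall n : nat,
    ('rV[R]_n -> 'M[R]_n) -> 'rV[R]_n -> Prop :=
| KEM_product (n : nat) (g : 'rV[R]_n -> 'M[R]_n) (p : 'rV[R]_n)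
    (r : R) (L : 'rV[R]_n -> 'M[R]_n) (k : nat) (blk : 'I_n -> 'I_k.+1) :
    0 < r ->
    orthogonal_concircular (ball p r) g L ->
    nontrivial (ball p r) g L ->
    associated_product (ball p r) g L blk ->
    adapted_coordinates (ball p r) g L blk p ->
    (forall a : 'I_k.+1, a != ord0 ->
       KEM_at (@leaf_restr R n k blk a p g) (leaf_point blk a p)) ->
    KEM_at g p.

Definition KEM_coordinates (R : realType) (n : nat) (U : set 'rV[R]_n)
    (g : 'rV[R]_n -> 'M[R]_n) : Prop :=
  forall p : 'rV[R]_n, U p -> KEM_at g p.

(* Main.v *)
(* Let L be the concircular tensor of a KEM product and Lam_i its eigenfunction
   along x_i. The concircular equation says that Lam_i depends on x_i alone, is
   constant on the multidimensional blocks, and that g_ii / sigma_i, with sigma_i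
   the product over the coordinates l != i of M_0 of Lam_i - Lam_l, depends only on
   the coordinates with the same eigenvalue as x_i. So the metric is diagonal, and
   Lagrange interpolation at the Lam_l combines Staeckel matrices of the factors
   M_a into one for M: functions S_ij(x_i) with sum_i S_ij(x_i) / g_ii = eps_j
   constant and S nonsingular. By induction every KEM metric has such a matrix,
   and then sum_i int sqrt (sum_j S_ij(x_i) c_j) dx_i is a complete integral, for c
   near a solution c0 of sum_j S_ij(p_i) c0_j = 1.
   Where x_i and x_l have distinct eigenvalues, d_l log |g_ii| is
   d_l Lam_l / (Lam_l - Lam_i); the equations expressing diagonal curvature of a
   diagonal metric then follow by computation, except for three coordinates of a
   common block, where they are those of the factor M_a. *)
Require Import Defs.
From mathcomp Require Import all_boot all_order all_algebra all_fingroup.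
From mathcomp Require Import all_classical all_reals all_analysis.
From mathcomp Require Import ring lra.
Set Implicit Arguments.
Unset Strict Implicit.
Unset Printing Implicit Defensive.
Import Order.TTheory GRing.Theory Num.Theory.
Import numFieldNormedType.Exports.
Local Open Scope classical_set_scope.
Local Open Scope ring_scope.

(** * Partial derivatives and smooth functions *)

(** Until the induction hypothesis is applied, nothing says that the metric is diagonal inside a
    multidimensional block, nor that its diagonal entries there are nonzero. The consequences of the
    concircular equation are therefore derived for all entries [g_ij] with [i] and [j] in a common
    block. The hypothesis itself speaks only of the leaves through [p]; elsewhere a block is
    recovered as [sigma_i(x) / sigma_i(p)] times the leaf metric, so that M is locally a warped
    product over M_0. The induction carries the Staeckel condition rather than the Levi-Civita
    equations because the former gives the complete integral by quadratures. The radicands equal 1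
    at the centre, so the square roots are real in every signature. For a diagonal metric and
    distinct i, j, k, the component R_ijik combines a second logarithmic derivative with a quadratic
    expression in first ones. The induction shows that the two vanish separately: a stronger
    statement, but one that passes from the leaves to M. *)

Lemma MVT_is_derive (R : realType) (u du : R -> R) (a b : R) : a <= b ->
  (forall s, a <= s <= b -> is_derive s 1 u (du s)) ->
  exists2 s, a <= s <= b & u b - u a = du s * (b - a).
Proof.
move=> ab dU.
have dd s : s \in `]a, b[ -> is_derive s 1 u (du s).
  by move=> /subset_itv_oo_cc; rewrite in_itv => /dU.
have cc : {within `[a, b], continuous u}.
  by apply: derivable_within_continuous => s; rewrite in_itv => /dU[].
have [s st e] := MVT_segment ab dd cc.
by exists s => //; move: st; rewrite in_itv.
Qed.

Section Coordinates.
Variables (R : realType) (n : nat).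
Implicit Types (x y p : 'rV[R]_n) (i j : 'I_n) (t r : R).

Definition upd x i t : 'rV[R]_n := \row_j (if j == i then t else x 0 j).

Lemma updE x i t j : upd x i t 0 j = if j == i then t else x 0 j.
Proof. by rewrite mxE. Qed.

Lemma upd_id x i : upd x i (x 0 i) = x.
Proof. by apply/rowP => j; rewrite updE; case: eqP => // ->. Qed.

Lemma upd_upd x i s t : upd (upd x i s) i t = upd x i t.
Proof. by apply/rowP => j; rewrite !updE; case: eqP. Qed.

Lemma updC x i j s t : i != j -> upd (upd x i s) j t = upd (upd x j t) i s.
Proof.
move=> ij; apply/rowP => l; rewrite !updE.
by case: (l =P j) => // ->; rewrite eq_sym (negbTE ij).
Qed.

Lemma ball_rowP p r x : ball p r x <-> 0 < r /\ forall i, `|p 0 i - x 0 i| < r.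
Proof.
split; first by move=> [r0 h]; split=> // i; exact: h.
by move=> [r0 h]; split=> // a j; rewrite [a]ord1; exact: h.
Qed.

Lemma ball_upd p r x i t : ball p r x -> `|p 0 i - t| < r -> ball p r (upd x i t).
Proof.
move=> /ball_rowP[r0 xr] tr; apply/ball_rowP; split => // j.
by rewrite updE; case: eqP => // ->.
Qed.

Lemma shift_delta x i t : t *: delta_mx 0 i + x = upd x i (x 0 i + t).
Proof.
apply/rowP => j; rewrite !mxE eqxx /=.
case: eqP => [->|_]; first by rewrite mulr1 addrC.
by rewrite mulr0 add0r.
Qed.

(** The two difference quotients are equal as functions, so derivability and the value of the
    derivative both pass to one variable by rewriting. *)
Lemma growth_line (f : 'rV[R]_n -> R) x i :
  (fun h : R => h^-1 *: ((f \o shift x) (h *: delta_mx 0 i) - f x)) =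
  (fun h : R => h^-1 *: (((fun t => f (upd x i t)) \o shift (x 0 i)) (h *: (1 : R))
                - f (upd x i (x 0 i)))).
Proof.
apply/funext => h /=; rewrite shift_delta upd_id.
by rewrite [h *: 1]mulr1 [h + _]addrC.
Qed.

Lemma derivable_line (f : 'rV[R]_n -> R) x i :
  derivable f x (delta_mx 0 i) <-> derivable (fun t => f (upd x i t)) (x 0 i) 1.
Proof. by rewrite /derivable growth_line. Qed.

Lemma partial_line (f : 'rV[R]_n -> R) x i :
  partial i f x = 'D_1 (fun t => f (upd x i t)) (x 0 i).
Proof. by rewrite /partial /derive growth_line. Qed.

Lemma is_derive_line (f : 'rV[R]_n -> R) x i t :
  derivable f (upd x i t) (delta_mx 0 i) ->
  is_derive t 1 (fun s => f (upd x i s)) (partial i f (upd x i t)).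
Proof.
move=> df; move/derivable_line: (df); rewrite partial_line updE eqxx.
have -> : (fun s => f (upd (upd x i t) i s)) = (fun s => f (upd x i s)).
  by apply/funext => s; rewrite upd_upd.
exact: derivableP.
Qed.

Lemma partial_MVT (f : 'rV[R]_n -> R) x i s t : s <= t ->
  (forall u, s <= u <= t -> derivable f (upd x i u) (delta_mx 0 i)) ->
  exists2 u, s <= u <= t &
    f (upd x i t) - f (upd x i s) = partial i f (upd x i u) * (t - s).
Proof.
move=> st df.
exact: (@MVT_is_derive R (fun u => f (upd x i u)) (fun u => partial i f (upd x i u)) s t st
  (fun u su => is_derive_line (df u su))).
Qed.

Lemma partial0_upd (f : 'rV[R]_n -> R) p r x i t :
  (forall y, ball p r y -> derivable f y (delta_mx 0 i)) ->
  (forall y, ball p r y -> partial i f y = 0) ->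
  ball p r x -> `|p 0 i - t| < r -> f (upd x i t) = f x.
Proof.
move=> df f0 px pt; rewrite -{2}(upd_id x i).
have key s u : s <= u -> `|p 0 i - s| < r -> `|p 0 i - u| < r ->
    f (upd x i u) = f (upd x i s).
  move=> su ps pu; have bu w : s <= w <= u -> ball p r (upd x i w).
    move=> /andP[sw wu]; apply: ball_upd => //.
    by move: ps pu; rewrite !ltr_norml => /andP[? ?] /andP[? ?]; apply/andP; split; lra.
  have [w /bu/f0 ->] := partial_MVT su (fun w sw => df _ (bu w sw)).
  by rewrite mul0r => /eqP; rewrite subr_eq0 => /eqP.
have pxi : `|p 0 i - x 0 i| < r by move/ball_rowP: px => [].
by have [le|/ltW le] := lerP t (x 0 i); [apply/esym|]; exact: key.
Qed.

(** [x] is turned into [y] one coordinate at a time. Balls of the sup norm are boxes, so every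
    intermediate point stays in the ball. *)
Lemma upd_invariant_eq (S : {pred 'I_n}) (f : 'rV[R]_n -> R) p r x y :
  (forall i, i \in S -> forall z t, ball p r z -> `|p 0 i - t| < r -> f (upd z i t) = f z) ->
  ball p r x -> ball p r y -> (forall i, i \notin S -> x 0 i = y 0 i) ->
  f x = f y.
Proof.
move=> fS px py xy.
pose w s : 'rV[R]_n := \row_i if i \in (s : seq 'I_n) then y 0 i else x 0 i.
have pw s : ball p r (w s).
  move/ball_rowP: px => [r0 px]; move/ball_rowP: py => [_ py].
  by apply/ball_rowP; split=> // i; rewrite mxE; case: ifP.
have -> : y = w (enum 'I_n) by apply/rowP => i; rewrite mxE mem_enum.
have -> : x = w [::] by apply/rowP => i; rewrite mxE.
elim: (enum 'I_n) => // i s ->.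
have -> : w (i :: s) = upd (w s) i (y 0 i).
  apply/rowP => j; rewrite !mxE inE; case: eqP => [->|] //=.
case: (boolP (i \in S)) => [iS|iS].
  by apply/esym/fS => //; move/ball_rowP: py => [].
by congr f; apply/rowP => j; rewrite !mxE; case: eqP => // ->; rewrite (xy i iS); case: ifP.
Qed.

Lemma partial0_eq (S : {pred 'I_n}) (f : 'rV[R]_n -> R) p r x y :
  (forall i, i \in S -> forall z, ball p r z -> derivable f z (delta_mx 0 i)) ->
  (forall i, i \in S -> forall z, ball p r z -> partial i f z = 0) ->
  ball p r x -> ball p r y -> (forall i, i \notin S -> x 0 i = y 0 i) ->
  f x = f y.
Proof.
move=> df f0; apply: upd_invariant_eq => i iS z t pz pt.
exact: (@partial0_upd f p r z i t (df i iS) (f0 i iS) pz pt).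
Qed.

End Coordinates.

(** * Smooth functions and their closure properties *)

Section Smooth.
Variables (R : realType) (n : nat).
Implicit Types (U : set 'rV[R]_n) (f g : 'rV[R]_n -> R).

Lemma partials_rcons s i f : @partials R n (rcons s i) f = partials s (partial i f).
Proof. by rewrite /partials foldr_rcons. Qed.

(** Constrains the partial derivatives of order below [k], so order 0 asks nothing. The recursion
    differentiates [f] first, whereas [partials] adds derivatives outside; this form lets an
    induction on [k] run over all functions at once. *)
Fixpoint Ck U k f : Prop :=
  if k is k'.+1 then
    (forall x, U x -> {for x, continuous f} /\ forall i, derivable f x (delta_mx 0 i)) /\
    (forall i, Ck U k' (partial i f))
  else True.

Lemma smooth_onP U f : smooth_on U f <-> forall k, Ck U k f.
Proof.
split=> [sf k|h s].
  elim: k f sf => // k IH f sf; split=> [x Ux|i].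
    exact: (sf [::]).
  by apply: IH => s x Ux; have := sf (rcons s i) x Ux; rewrite partials_rcons.
have : Ck U (size s).+1 f by [].
elim/last_ind: s {h} f => [|s i IH] f; first by move=> [].
by rewrite size_rcons partials_rcons => -[_ /(_ i)]; exact: IH.
Qed.

Lemma smooth_continuous U f x : smooth_on U f -> U x -> {for x, continuous f}.
Proof. by move=> /(_ [::] x) + Ux => /(_ Ux)[]. Qed.

Lemma smooth_derivable U f x i : smooth_on U f -> U x -> derivable f x (delta_mx 0 i).
Proof. by move=> /(_ [::] x) + Ux => /(_ Ux)[]. Qed.

Lemma smooth_partial U f i : smooth_on U f -> smooth_on U (partial i f).
Proof. by move=> sf s x Ux; have := sf (rcons s i) x Ux; rewrite partials_rcons. Qed.

Lemma smooth_subset U V f : U `<=` V -> smooth_on V f -> smooth_on U f.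
Proof. by move=> UV sf s x /UV; exact: sf. Qed.

Lemma CkW U k f : Ck U k.+1 f -> Ck U k f.
Proof.
elim: k f => // k IH f [h1 h2]; split => // i.
exact: IH.
Qed.

Lemma eq_near_on U f g x : open U -> U x -> {in U, f =1 g} -> \forall y \near x, f y = g y.
Proof.
move=> oU Ux fg; near=> y; apply: fg; rewrite inE; near: y.
exact: open_nbhs_nbhs.
Unshelve. all: by end_near. Qed.

Lemma eq_partial_on U f g i : open U -> {in U, f =1 g} -> {in U, partial i f =1 partial i g}.
Proof.
by move=> oU fg x; rewrite inE => Ux; apply: near_eq_derive; apply: (eq_near_on oU).
Qed.

Lemma eq_Ck U k f g : open U -> {in U, f =1 g} -> Ck U k f -> Ck U k g.
Proof.
move=> oU; elim: k f g => // k IH f g fg [h1 h2]; split=> [x Ux|i].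
  have [cf df] := h1 x Ux; have nfg := eq_near_on oU Ux fg; split.
    have e : f x = g x by apply: fg; rewrite inE.
    have cg : g y @[y --> x] --> g x.
      by rewrite -e; apply: cvg_trans cf; exact: near_eq_cvg nfg.
    exact: cg.
  by move=> i; apply: (near_eq_derivable nfg (df i)).
by apply: IH (h2 i); exact: eq_partial_on.
Qed.

Lemma eq_smooth U f g : open U -> {in U, f =1 g} -> smooth_on U f -> smooth_on U g.
Proof.
move=> oU fg /smooth_onP sf; apply/smooth_onP => k; exact: (eq_Ck oU fg).
Qed.

Lemma Ck_cst U k c : open U -> Ck U k (fun=> c).
Proof.
move=> oU; elim: k c => // k IH c; split=> [x Ux|i].
  split; first exact: cst_continuous.
  by move=> i; exact: derivable_cst.
apply: (@eq_Ck U k (fun=> 0)) => // x _.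
by rewrite /partial derive_cst.
Qed.

Lemma CkD U k f g : open U -> Ck U k f -> Ck U k g -> Ck U k (fun x => f x + g x).
Proof.
move=> oU; elim: k f g => // k IH f g [f1 f2] [g1 g2]; split=> [x Ux|i].
  have [cf df] := f1 x Ux; have [cg dg] := g1 x Ux; split.
    exact: continuousD.
  by move=> i; apply: derivableD.
apply: (@eq_Ck U k (fun x => partial i f x + partial i g x)) => //; last by apply: IH; [exact: f2|exact: g2].
move=> x; rewrite inE => Ux; rewrite /partial deriveD //.
  by have [_] := f1 x Ux.
by have [_] := g1 x Ux.
Qed.

Lemma CkM U k f g : open U -> Ck U k f -> Ck U k g -> Ck U k (fun x => f x * g x).
Proof.
move=> oU; elim: k f g => // k IH f g kf kg.
have [f1 f2] := kf; have [g1 g2] := kg; split=> [x Ux|i].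
  have [cf df] := f1 x Ux; have [cg dg] := g1 x Ux; split.
    exact: continuousM.
  by move=> i; apply: derivableM.
apply: (@eq_Ck U k (fun x => f x * partial i g x + g x * partial i f x)) => //.
  move=> x; rewrite inE => Ux; rewrite /partial deriveM //.
    by have [_] := f1 x Ux.
  by have [_] := g1 x Ux.
apply: CkD => //; first by apply: IH; [exact: CkW kf|exact: g2].
by apply: IH; [exact: CkW kg|exact: f2].
Qed.

Lemma CkV U k f : open U -> (forall x, U x -> f x != 0) -> Ck U k f ->
  Ck U k (fun x => (f x)^-1).
Proof.
move=> oU f0; elim: k => // k IH kf; have [f1 f2] := kf; split=> [x Ux|i].
  have [cf df] := f1 x Ux; split.
    by apply: continuousV => //; exact: f0.
  by move=> i; apply: derivableV => //; exact: f0.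
(* The derivative of [1 / f] contains [1 / f] again, one order lower; this is why [f] stays fixed in
   the induction. *)
have kV := IH (CkW kf).
apply: (@eq_Ck U k (fun x => -1 * ((f x)^-1 * (f x)^-1) * partial i f x)) => //.
  move=> x; rewrite inE => Ux; rewrite /partial deriveV //; last 2 first.
  - exact: f0.
  - by have [_] := f1 x Ux.
  by rewrite expr2 invfM mulN1r.
apply: CkM => //; last exact: f2.
by apply: CkM => //; [exact: Ck_cst|exact: CkM].
Qed.

Lemma Ck_sqrt U k f : open U -> (forall x, U x -> 0 < f x) -> Ck U k f ->
  Ck U k (fun x => Num.sqrt (f x)).
Proof.
move=> oU f0; elim: k => // k IH kf; have [f1 f2] := kf.
have d x i : U x -> is_derive x (delta_mx 0 i) (fun x => Num.sqrt (f x))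
    ((2 * Num.sqrt (f x))^-1 * partial i f x).
  move=> Ux; have [_ /(_ i) df] := f1 x Ux.
  have /(@derivable_line _ _ f) dl := df.
  have ds : is_derive (x 0 i) 1 (Num.sqrt \o (fun t => f (upd x i t)))
    ((2 * Num.sqrt (f x))^-1 * partial i f x).
    have d2 : is_derive (f (upd x i (x 0 i))) 1 Num.sqrt (2 * Num.sqrt (f (upd x i (x 0 i))))^-1.
      by apply: is_derive1_sqrt; rewrite upd_id; exact: f0.
    have d1 : is_derive (x 0 i) 1 (fun t => f (upd x i t)) (partial i f x).
      by rewrite partial_line; exact: derivableP.
    by have := is_derive1_comp d2 d1; rewrite upd_id.
  split; first by apply/derivable_line; case: ds.
  by have := @partial_line _ _ (fun x => Num.sqrt (f x)) x i; rewrite /partial => ->; case: ds.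
split=> [x Ux|i].
  split; last by move=> i; case: (d x i Ux).
  have [cf _] := f1 x Ux.
  by apply: continuous_comp => //; exact: sqrt_continuous.
apply: (@eq_Ck U k (fun x => (2 * Num.sqrt (f x))^-1 * partial i f x)) => //.
  by move=> x; rewrite inE => Ux; rewrite /partial; case: (d x i Ux).
apply: CkM => //; last exact: f2.
apply: CkV => //.
  by move=> x Ux; rewrite mulf_neq0 // gt_eqF // sqrtr_gt0 f0.
apply: CkM => //; first exact: Ck_cst.
apply: IH; exact: CkW.
Qed.

Lemma smooth_cst U c : open U -> smooth_on U (fun=> c).
Proof. by move=> oU; apply/smooth_onP => k; exact: Ck_cst. Qed.

Lemma smoothD U f g : open U -> smooth_on U f -> smooth_on U g ->
  smooth_on U (fun x => f x + g x).
Proof. by move=> oU /smooth_onP kf /smooth_onP kg; apply/smooth_onP => k; exact: CkD. Qed.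

Lemma smoothM U f g : open U -> smooth_on U f -> smooth_on U g ->
  smooth_on U (fun x => f x * g x).
Proof. by move=> oU /smooth_onP kf /smooth_onP kg; apply/smooth_onP => k; exact: CkM. Qed.

Lemma smoothB U f g : open U -> smooth_on U f -> smooth_on U g ->
  smooth_on U (fun x => f x - g x).
Proof.
move=> oU sf sg; apply: (@eq_smooth _ (fun x => f x + (-1) * g x) _ oU).
  by move=> x _; rewrite mulN1r.
exact: (smoothD oU sf (smoothM oU (smooth_cst _ oU) sg)).
Qed.

Lemma smoothV U f : open U -> (forall x, U x -> f x != 0) -> smooth_on U f ->
  smooth_on U (fun x => (f x)^-1).
Proof. by move=> oU f0 /smooth_onP kf; apply/smooth_onP => k; exact: CkV. Qed.

Lemma smooth_sqrt U f : open U -> (forall x, U x -> 0 < f x) -> smooth_on U f ->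
  smooth_on U (fun x => Num.sqrt (f x)).
Proof. by move=> oU f0 /smooth_onP kf; apply/smooth_onP => k; exact: Ck_sqrt. Qed.

Lemma smooth_sum (I : Type) (s : seq I) (P : pred I) U (F : I -> 'rV[R]_n -> R) :
  open U -> (forall i, P i -> smooth_on U (F i)) ->
  smooth_on U (fun x => \sum_(i <- s | P i) F i x).
Proof.
move=> oU sF; elim: s => [|i s IH].
  by apply: (eq_smooth oU _ (smooth_cst 0 oU)) => x _; rewrite big_nil.
case: (boolP (P i)) => Pi.
  apply: (@eq_smooth _ (fun x => F i x + \sum_(i <- s | P i) F i x) _ oU).
    by move=> x _; rewrite big_cons Pi.
  exact: (smoothD oU (sF _ Pi) IH).
by apply: (eq_smooth oU _ IH) => x _; rewrite big_cons (negbTE Pi).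
Qed.

Lemma smooth_prod (I : Type) (s : seq I) (P : pred I) U (F : I -> 'rV[R]_n -> R) :
  open U -> (forall i, P i -> smooth_on U (F i)) ->
  smooth_on U (fun x => \prod_(i <- s | P i) F i x).
Proof.
move=> oU sF; elim: s => [|i s IH].
  by apply: (eq_smooth oU _ (smooth_cst 1 oU)) => x _; rewrite big_nil.
case: (boolP (P i)) => Pi.
  apply: (@eq_smooth _ (fun x => F i x * \prod_(i <- s | P i) F i x) _ oU).
    by move=> x _; rewrite big_cons Pi.
  exact: (smoothM oU (sF _ Pi) IH).
by apply: (eq_smooth oU _ IH) => x _; rewrite big_cons (negbTE Pi).
Qed.

End Smooth.

Arguments smooth_continuous {R n U f x} _ _.
Arguments smooth_derivable {R n U f x} i _ _.
Arguments smooth_partial {R n U f} i _.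
Arguments smooth_cst {R n U} c _.
Arguments smoothD {R n U f g} _ _ _.
Arguments smoothM {R n U f g} _ _ _.
Arguments smoothB {R n U f g} _ _ _.
Arguments smoothV {R n U f} _ _ _.
Arguments smooth_sqrt {R n U f} _ _ _.
Arguments eq_smooth {R n U} f {g} _ _ _.
Arguments smooth_subset {R n U} V {f} _ _.
Arguments partial0_eq {R n} S f p r x y _ _ _ _ _.
Arguments partial0_upd {R n f p r x i t} _ _ _ _.
Arguments upd_invariant_eq {R n} S f p r x y _ _ _ _.

(** * Substitution of coordinates *)

Section Substitution.
Variables (R : realType) (m n : nat) (s : 'I_n -> option 'I_m) (p : 'rV[R]_n).

(** Every coordinate is either copied from [z] or frozen at [p]. This single operation covers
    projections, inclusions of leaves and coordinate lines. With [s] injective where defined, each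
    coordinate of [z] moves at most one coordinate of the image, so the chain rule has one term. *)
Definition subst (z : 'rV[R]_m) : 'rV[R]_n :=
  \row_i (if s i is Some j then z 0 j else p 0 i).

Lemma substE z i : subst z 0 i = if s i is Some j then z 0 j else p 0 i.
Proof. by rewrite mxE. Qed.

Lemma ball_subst z z' r : ball z r z' -> ball (subst z) r (subst z').
Proof.
move=> /ball_rowP[r0 h]; apply/ball_rowP; split=> // i; rewrite !substE.
by case: (s i) => [j|]; rewrite ?subrr ?normr0.
Qed.

Lemma subst_continuous : continuous subst.
Proof.
move=> z A /nbhs_ballP[e e0 sA]; apply/nbhs_ballP; exists e => // z' zz'.
by apply: sA; exact: ball_subst.
Qed.

Hypothesis s_inj : forall i i' j, s i = Some j -> s i' = Some j -> i = i'.

Lemma subst_upd z i j t : s i = Some j -> subst (upd z j t) = upd (subst z) i t.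
Proof.
move=> sij; apply/rowP => l; rewrite !substE !updE substE.
case: (l =P i) => [->|li]; first by rewrite sij updE eqxx.
case E: (s l) => [j'|//]; rewrite updE; case: eqP => // j'j.
by case: li; apply: (s_inj E); rewrite j'j.
Qed.

Lemma subst_upd_cst z j t : (forall i, s i != Some j) -> subst (upd z j t) = subst z.
Proof.
move=> sj; apply/rowP => l; rewrite !substE.
case E: (s l) => [j'|//]; rewrite updE; case: eqP => // j'j.
by have := sj l; rewrite E j'j eqxx.
Qed.

Lemma derivable_subst (f : 'rV[R]_n -> R) z i j : s i = Some j ->
  derivable (f \o subst) z (delta_mx 0 j) <-> derivable f (subst z) (delta_mx 0 i).
Proof.
move=> sij.
have e : (fun t => (f \o subst) (upd z j t)) = (fun t => f (upd (subst z) i t)).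
  by apply/funext => t /=; rewrite (subst_upd _ _ sij).
split=> /derivable_line d; apply/derivable_line; move: d;
by rewrite e substE sij.
Qed.

Lemma partial_subst (f : 'rV[R]_n -> R) z i j : s i = Some j ->
  partial j (f \o subst) z = partial i f (subst z).
Proof.
move=> sij; rewrite !partial_line substE sij.
have -> : (fun t => (f \o subst) (upd z j t)) = (fun t => f (upd (subst z) i t)).
  by apply/funext => t /=; rewrite (subst_upd _ _ sij).
by [].
Qed.

Lemma derivable_subst_cst (f : 'rV[R]_n -> R) z j : (forall i, s i != Some j) ->
  derivable (f \o subst) z (delta_mx 0 j).
Proof.
move=> sj; apply/derivable_line.
have -> : (fun t => (f \o subst) (upd z j t)) = (fun=> f (subst z)).
  by apply/funext => t /=; rewrite subst_upd_cst.
exact: derivable_cst.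
Qed.

Lemma partial_subst_cst (f : 'rV[R]_n -> R) z j : (forall i, s i != Some j) ->
  partial j (f \o subst) z = 0.
Proof.
move=> sj; rewrite partial_line.
have -> : (fun t => (f \o subst) (upd z j t)) = (fun=> f (subst z)).
  by apply/funext => t /=; rewrite subst_upd_cst.
exact: derive_cst.
Qed.

Lemma subst_cases j : (exists i, s i = Some j) \/ (forall i, s i != Some j).
Proof.
have [/existsP[i /eqP h]|/existsPn h] := boolP [exists i, s i == Some j].
  by left; exists i.
by right.
Qed.

Lemma smooth_subst (U : set 'rV[R]_n) (V : set 'rV[R]_m) f : open V ->
  (forall z, V z -> U (subst z)) -> smooth_on U f -> smooth_on V (f \o subst).
Proof.
move=> oV VU /smooth_onP sf; apply/smooth_onP => k; move: (sf k) => {sf}.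
elim: k f => // k IH f [f1 f2]; split=> [z /VU Uz|j].
  have [cf df] := f1 _ Uz; split.
    by apply: continuous_comp => //; exact: subst_continuous.
  move=> j; have [[i sij]|sj] := subst_cases j; last exact: derivable_subst_cst.
  by apply/(derivable_subst _ _ sij).
have [[i sij]|sj] := subst_cases j.
  apply: (eq_Ck oV _ (IH _ (f2 i))) => z _.
  by rewrite (partial_subst _ _ sij).
by apply: (eq_Ck oV _ (Ck_cst k 0 oV)) => z _; rewrite partial_subst_cst.
Qed.

End Substitution.

(** * Symmetry of second derivatives *)

Section Schwarz.
Variables (R : realType) (n : nat).
Implicit Types (x p : 'rV[R]_n) (f : 'rV[R]_n -> R).

(** Two mean value theorems: along [x_i] for the increment [u] of [f] in [x_j], then along [x_j] for
    [partial i f]. The radius [h + h] leaves room because the mean values may sit on the boundary of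
    the square of side [h]. *)
Lemma second_difference (U : set 'rV[R]_n) f x (i j : 'I_n) (h : R) : smooth_on U f -> i != j -> 0 < h ->
  (forall s t : R, 0 <= s <= h -> 0 <= t <= h ->
     U (upd (upd x i (x 0 i + s)) j (x 0 j + t))) ->
  exists y : 'rV[R]_n, [/\ ball x (h + h) y, U y &
    f (upd (upd x i (x 0 i + h)) j (x 0 j + h)) - f (upd x i (x 0 i + h))
    - f (upd x j (x 0 j + h)) + f x = partial j (partial i f) y * (h * h)].
Proof.
move=> sf ij h0 box.
pose P s t := upd (upd x i (x 0 i + s)) j (x 0 j + t).
have P0 s : upd x i (x 0 i + s) = P s 0.
  rewrite /P addr0; have -> : x 0 j = upd x i (x 0 i + s) 0 j.
    by rewrite updE eq_sym (negbTE ij).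
  by rewrite upd_id.
have PC s t : P s t = upd (upd x j (x 0 j + t)) i (x 0 i + s) by rewrite /P updC.
have xP : x = P 0 0 by rewrite -P0 addr0 upd_id.
pose u s := f (upd (upd x j (x 0 j + h)) i s) - f (upd (upd x j (x 0 j + 0)) i s).
pose du s := partial i f (upd (upd x j (x 0 j + h)) i s)
             - partial i f (upd (upd x j (x 0 j + 0)) i s).
have UP s t : 0 <= s <= h -> 0 <= t <= h -> U (P s t) by exact: box.
have drv s : x 0 i <= s <= x 0 i + h -> is_derive s 1 u (du s).
  move=> /andP[s1 s2].
  have e : s = x 0 i + (s - x 0 i) by rewrite addrC subrK.
  have sr : 0 <= s - x 0 i <= h by apply/andP; split; lra.
  have h00 : 0 <= (0 : R) <= h by rewrite lexx ltW.
  have hh0 : 0 <= h <= h by rewrite lexx ltW.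
  apply: is_deriveB; apply: is_derive_line.
    rewrite e -PC.
    exact: (smooth_derivable _ sf (UP _ _ sr hh0)).
  by rewrite e -PC; exact: (smooth_derivable _ sf (UP _ _ sr h00)).
have lei : x 0 i <= x 0 i + h by rewrite lerDl ltW.
have lej : x 0 j <= x 0 j + h by rewrite lerDl ltW.
have [s /andP[s1 s2] us] := MVT_is_derive lei drv.
have sr : 0 <= s - x 0 i <= h by apply/andP; split; lra.
have es : s = x 0 i + (s - x 0 i) by rewrite addrC subrK.
have [|t /andP[t1 t2] ft] := @partial_MVT R n (partial i f) (upd x i s) j _ _ lej.
  move=> t /andP[t1 t2]; have et : t = x 0 j + (t - x 0 j) by rewrite addrC subrK.
  apply: (smooth_derivable _ (smooth_partial _ sf)).
  by rewrite es et; apply: box => //; apply/andP; split; lra.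
have et : t = x 0 j + (t - x 0 j) by rewrite addrC subrK.
have tr : 0 <= t - x 0 j <= h by apply/andP; split; lra.
exists (P (s - x 0 i) (t - x 0 j)); split.
- apply/ball_rowP; split; first by rewrite addr_gt0.
  move=> l; rewrite !updE; case: eqP => [->|_]; last case: eqP => [->|_].
  + by rewrite -et ltr_norml; apply/andP; split; lra.
  + by rewrite -es ltr_norml; apply/andP; split; lra.
  + by rewrite subrr normr0 addr_gt0.
- exact: UP.
have -> : f (P h h) - f (upd x i (x 0 i + h)) - f (upd x j (x 0 j + h)) + f x
    = u (x 0 i + h) - u (x 0 i).
  have e1 : upd (upd x j (x 0 j + h)) i (x 0 i) = upd x j (x 0 j + h).
    by rewrite -[x 0 i]addr0 -PC /P addr0 upd_id.
  have e2 : upd (upd x j (x 0 j + 0)) i (x 0 i) = x.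
    by rewrite -[X in upd _ i X]addr0 -PC -xP.
  rewrite /u e1 e2 -!PC P0; ring.
have e3 : x 0 i + h - x 0 i = h by rewrite addrAC subrr add0r.
rewrite us e3 mulrA; congr (_ * _).
have e4 : x 0 j + h - x 0 j = h by rewrite addrAC subrr add0r.
rewrite /P -es -et -e4 -ft /du addr0; congr (_ - _).
  by rewrite (updC _ _ _ ij).
by rewrite (updC _ _ _ ij).
Qed.

Lemma ball_corner x (i j : 'I_n) (s t h d : R) : 0 <= s <= h -> 0 <= t <= h -> h < d ->
  ball x d (upd (upd x i (x 0 i + s)) j (x 0 j + t)).
Proof.
move=> /andP[s0 sh] /andP[t0 th] hd.
apply/ball_rowP; split; first by lra.
move=> l; rewrite !updE; case: eqP => [->|_]; last case: eqP => [->|_].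
- by rewrite ltr_norml; apply/andP; split; lra.
- by rewrite ltr_norml; apply/andP; split; lra.
- by rewrite subrr normr0; lra.
Qed.

(** The second difference is symmetric in [i] and [j], so both mixed derivatives take a common value
    at points arbitrarily close to [x]; continuity concludes. *)
Lemma partialC (U : set 'rV[R]_n) f x (i j : 'I_n) : open U -> smooth_on U f -> U x ->
  partial i (partial j f) x = partial j (partial i f) x.
Proof.
move=> oU sf Ux; have [->//|ij] := eqVneq i j.
have /nbhs_ballP[d d0 dU] : nbhs x U by exact: open_nbhs_nbhs.
set a := LHS; set b := RHS.
apply/eqP; rewrite -subr_eq0 -normr_le0 leNgt; apply/negP => e0.
have cont k l : exists2 d' : R, 0 < d' & forall y : 'rV[R]_n, ball x d' y ->
    `|partial k (partial l f) x - partial k (partial l f) y| < `|a - b| / 2.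
  have c : {for x, continuous (partial k (partial l f))}.
    exact: (smooth_continuous (smooth_partial _ (smooth_partial _ sf)) Ux).
  have e1 : 0 < `|a - b| / 2 by rewrite divr_gt0.
  have /nbhs_ballP[d' d'0 h] : \forall y \near x,
      `|partial k (partial l f) x - partial k (partial l f) y| < `|a - b| / 2.
    exact: (@cvgr_dist_lt _ _ _ _ _ _ _ c _ e1).
  by exists d'.
have [d1 d10 c1] := cont i j; have [d2 d20 c2] := cont j i.
(* A third of the smallest radius, so that [h + h] is still strictly below all three. *)
pose h : R := Num.min d (Num.min d1 d2) / 3.
have m0 : 0 < Num.min d (Num.min d1 d2) by rewrite !lt_min d0 d10 d20.
have [hd hd1 hd2] : [/\ h + h < d, h + h < d1 & h + h < d2].
  have : Num.min d (Num.min d1 d2) <= d by rewrite ge_min lexx.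
  have : Num.min d (Num.min d1 d2) <= d1 by rewrite !ge_min lexx orbT.
  have : Num.min d (Num.min d1 d2) <= d2 by rewrite !ge_min lexx !orbT.
  by rewrite /h; move: (Num.min d _) m0 => m *; split; lra.
have h0 : 0 < h by rewrite /h divr_gt0.
have [|y [yx Uy ey]] := @second_difference U f x i j h sf ij h0.
  by move=> s t s0 t0; apply: dU; apply: ball_corner s0 t0 _; lra.
have ji : j != i by rewrite eq_sym.
have [|z [zx Uz ez]] := @second_difference U f x j i h sf ji h0.
  by move=> s t s0 t0; apply: dU; apply: ball_corner s0 t0 _; lra.
have eyz : partial j (partial i f) y = partial i (partial j f) z.
  have hh : h * h != 0 by rewrite mulf_neq0 // gt_eqF.
  apply: (mulIf hh); apply: etrans (esym ey) (etrans _ ez).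
  by rewrite (updC _ _ _ ij); congr (_ + _); rewrite addrAC.
have bz := c1 z (le_ball (ltW hd1) zx); have ay := c2 y (le_ball (ltW hd2) yx).
rewrite eyz in ay.
have : `|a - b| < `|a - b|.
  rewrite [ltRHS]splitr; apply: le_lt_trans (ltrD bz ay).
  by rewrite [X in _ <= _ + X]distrC; exact: ler_distD.
by rewrite ltxx.
Qed.

End Schwarz.

(** * Antiderivatives in one coordinate *)

Section Primitive.
Variables (R : realType) (n : nat).
Notation mu := (@lebesgue_measure R).

(** The coordinate [z_i] serves only as upper limit, the others are parameters of the integrand. One
    such function per coordinate makes up the complete integral. *)
Definition primitive (i : 'I_n) (a : R) (F : 'rV[R]_n -> R) (z : 'rV[R]_n) : R :=
  \int[mu]_(t in `[a, z 0 i]) F (upd z i t).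

Lemma upd_continuous (i : 'I_n) (z : 'rV[R]_n) (t : R) (e : R) : 0 < e ->
  \forall t' \near t & z' \near z, ball (upd z i t) e (upd z' i t').
Proof.
move=> e0; exists (ball t e, ball z e) => /=.
  by split; exact: nbhsx_ballx.
move=> [t' z'] /= [tt' /ball_rowP[_ zz']]; apply/ball_rowP; split=> // j.
by rewrite !updE; case: eqP => _; [exact: tt'|exact: zz'].
Qed.

Variables (U V : set 'rV[R]_n) (i : 'I_n) (a : R).
Hypothesis oV : open V.
(** The base point [a] lies strictly below [V], so the integral never changes orientation and is
    differentiated at interior points only; [U] contains the whole segments of integration. *)
Hypothesis VU : forall z, V z -> a < z 0 i /\ forall t : R, a <= t <= z 0 i -> U (upd z i t).

Lemma primitive_dom z : V z -> U z.
Proof. by move=> /VU[az]; move/(_ (z 0 i)); rewrite upd_id lexx ltW //; exact. Qed.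

(** Compactness of the segment makes the modulus of continuity transversal to it uniform. *)
Lemma primitive_tube (F : 'rV[R]_n -> R) (z : 'rV[R]_n) (e : R) :
  (forall y, U y -> {for y, continuous F}) -> V z -> 0 < e ->
  \forall y \near z, forall t : R, a <= t <= z 0 i -> `|F (upd z i t) - F (upd y i t)| < e.
Proof.
move=> cF Vz e0.
have cK : compact `[a, z 0 i]%classic by exact: segment_compact.
have /compact_near_coveringP cov := cK.
have : \forall y \near z, `[a, z 0 i]%classic `<=` (fun t => `|F (upd z i t) - F (upd y i t)| < e).
  apply: (cov _ (nbhs z) (fun y t => `|F (upd z i t) - F (upd y i t)| < e) _) => t /=; rewrite in_itv /= => at_.
  have [_ /(_ t at_) Ut] := VU Vz.
  have e2 : 0 < e / 2 by rewrite divr_gt0.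
  have /nbhs_ballP[d d0 dF] : \forall y \near upd z i t, `|F (upd z i t) - F y| < e / 2.
    by exact: (@cvgr_dist_lt _ _ _ _ _ _ _ (cF _ Ut) _ e2).
  have [[A B] /= [At Bz] AB] := upd_continuous i z t d0.
  exists (A, B) => //= -[t' y] /= [At' By].
  have h1 := dF _ (AB (t', z) (conj At' (nbhs_singleton Bz))).
  have h2 := dF _ (AB (t', y) (conj At' By)).
  rewrite /= in h1 h2.
  rewrite [ltRHS]splitr; apply: le_lt_trans (ltrD h1 h2).
  by rewrite [X in _ <= X + _]distrC; exact: ler_distD.
apply: filterS => y h t at_; apply: h; by rewrite /= in_itv.
Qed.

Lemma primitive_integrable (F : 'rV[R]_n -> R) (z : 'rV[R]_n) (b : R) :
  (forall y, U y -> {for y, continuous F}) ->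
  (forall t : R, a <= t <= b -> U (upd z i t)) ->
  mu.-integrable `[a, b] (EFin \o (fun t => F (upd z i t))).
Proof.
move=> cF Uz; apply: continuous_compact_integrable; first exact: segment_compact.
apply: continuous_in_subspaceT => t; rewrite inE /= in_itv /= => /Uz Ut.
have cu : {for t, continuous (upd z i : R -> 'rV[R]_n)}.
  move=> A /nbhs_ballP[e e0 sA]; apply/nbhs_ballP; exists e => // t' tt'.
  apply: sA; apply/ball_rowP; split=> // j; rewrite !updE; case: eqP => // _.
  by rewrite subrr normr0.
exact: (@continuous_comp _ _ _ (upd z i : R -> 'rV[R]_n) F t cu (cF _ Ut)).
Qed.

Lemma integrable_itvB (b c : R) (f g : R -> R) :
  mu.-integrable `[b, c] (EFin \o f) -> mu.-integrable `[b, c] (EFin \o g) ->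
  mu.-integrable `[b, c] (EFin \o (fun t => f t - g t)).
Proof.
move=> fi gi.
suff : mu.-integrable `[b, c] ((EFin \o f) \- (EFin \o g))%E.
  apply: eq_integrable; first exact: measurable_itv.
  by move=> t _ /=; rewrite EFinB.
by apply: integrableB; [exact: measurable_itv|exact: fi|exact: gi].
Qed.

Lemma integrable_itvZ (b c k : R) (f : R -> R) :
  mu.-integrable `[b, c] (EFin \o f) ->
  mu.-integrable `[b, c] (EFin \o (fun t => k * f t)).
Proof.
move=> fi; apply: eq_integrable; last first.
- by apply: (integrableZl _ k); [exact: measurable_itv|exact: fi].
- by [].
- exact: measurable_itv.
Qed.

Lemma Rintegral_itvZ (b c k : R) (f : R -> R) :
  mu.-integrable `[b, c] (EFin \o f) ->
  \int[mu]_(t in `[b, c]) (k * f t) = k * \int[mu]_(t in `[b, c]) f t.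
Proof. by move=> fi; apply: RintegralZl; [exact: measurable_itv|exact: fi]. Qed.

Lemma Rintegral_itvB (b c : R) (f g : R -> R) :
  mu.-integrable `[b, c] (EFin \o f) -> mu.-integrable `[b, c] (EFin \o g) ->
  \int[mu]_(t in `[b, c]) (f t - g t) =
  \int[mu]_(t in `[b, c]) f t - \int[mu]_(t in `[b, c]) g t.
Proof.
by move=> fi gi; apply: RintegralB; [exact: measurable_itv|exact: fi|exact: gi].
Qed.

Lemma le_normr_Rintegral_itv (b c : R) (f : R -> R) :
  mu.-integrable `[b, c] (EFin \o f) ->
  `|\int[mu]_(t in `[b, c]) f t| <= \int[mu]_(t in `[b, c]) `|f t|.
Proof. by move=> fi; apply: le_normr_Rintegral; [exact: measurable_itv|exact: fi]. Qed.

Lemma Rintegral_dist_le (f g : R -> R) (b e : R) : a <= b ->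
  mu.-integrable `[a, b] (EFin \o f) -> mu.-integrable `[a, b] (EFin \o g) ->
  (forall t, a <= t <= b -> `|f t - g t| <= e) ->
  `|\int[mu]_(t in `[a, b]) f t - \int[mu]_(t in `[a, b]) g t| <= e * (b - a).
Proof.
move=> ab fi gi fg.
have mab : measurable (`[a, b]%classic : set R) by exact: measurable_itv.
rewrite -Rintegral_itvB //.
have fgi : mu.-integrable `[a, b] (EFin \o (fun t => f t - g t)).
  exact: integrable_itvB.
apply: le_trans (le_normr_Rintegral_itv fgi) _.
have -> : e * (b - a) = \int[mu]_(t in `[a, b]) e.
  rewrite Rintegral_cst // [X in fine X](_ : _ = (b - a)%:E) //.
  have := @lebesgue_measure_itv R `[a, b].
  rewrite /= lte_fin; case: ltrP => [_ -> //|ba ->].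
  by congr EFin; lra.
have cc : {within `[a, b], continuous (fun=> e : R)}.
  by apply: continuous_subspaceT => ?; exact: cst_continuous.
apply: le_Rintegral.
- exact: measurable_itv.
- exact: (integrable_abse fgi).
- exact: (continuous_compact_integrable (@segment_compact _ a b) cc).
- by move=> t; rewrite /= in_itv /=; exact: fg.
Qed.

Lemma primitive_derive (F : 'rV[R]_n -> R) (z : 'rV[R]_n) :
  (forall y, U y -> {for y, continuous F}) -> V z ->
  is_derive z (delta_mx 0 i) (primitive i a F) (F z).
Proof.
move=> cF Vz; have [az Uz] := VU Vz.
have /nbhs_ballP[d /= d0 dV] : nbhs z V by exact: open_nbhs_nbhs.
(* The fundamental theorem needs an interval reaching beyond [z_i]; openness of [V] provides it. *)
pose u : R := z 0 i + d / 2.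
have zu : z 0 i < u by rewrite /u ltrDl divr_gt0.
have Vu : V (upd z i u).
  apply: dV; apply: ball_upd; first exact: ballxx.
  by rewrite /u opprD addrA subrr add0r normrN gtr0_norm ?divr_gt0 // ltr_pdivrMr // ltr_pMr // ltr1n.
have Uu t : a <= t <= u -> U (upd z i t).
  have [_] := VU Vu; rewrite updE eqxx => /(_ t) h /h.
  by rewrite upd_upd.
have intf := primitive_integrable cF Uu.
have cf : {for z 0 i, continuous (fun t => F (upd z i t))}.
  have cu : {for z 0 i, continuous (upd z i : R -> 'rV[R]_n)}.
    move=> A /nbhs_ballP[e e0 sA]; apply/nbhs_ballP; exists e => // t' tt'.
    apply: sA; apply/ball_rowP; split=> // j; rewrite !updE; case: eqP => // _.
    by rewrite subrr normr0.
  apply: (@continuous_comp _ _ _ (upd z i : R -> 'rV[R]_n) F _ cu).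
  by rewrite upd_id; exact: cF (primitive_dom Vz).
have [dd de] := continuous_FTC1_closed zu intf az cf.
have e : (fun t => primitive i a F (upd z i t)) =
    (fun t => \int[mu]_(s in `[a, t]) F (upd z i s)).
  apply/funext => t; rewrite /primitive updE eqxx.
  by apply: eq_Rintegral => s _; rewrite upd_upd.
split; first by apply/derivable_line; rewrite e.
have := partial_line (primitive i a F) z i; rewrite /partial => ->.
by rewrite e -derive1E de upd_id.
Qed.

(** Differentiation under the integral sign: the difference quotient of the integrand is a value of
    [partial j F] at a nearby point, hence uniformly close to its value at [z] on the segment. *)
Lemma primitive_derive_param (F : 'rV[R]_n -> R) (z : 'rV[R]_n) (j : 'I_n) : j != i ->
  smooth_on U F -> V z ->
  is_derive z (delta_mx 0 j) (primitive i a F) (primitive i a (partial j F) z).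
Proof.
move=> ji sF Vz; have [az Uz] := VU Vz.
have cF y : U y -> {for y, continuous F} by move=> Uy; exact: smooth_continuous Uy.
have cdF y : U y -> {for y, continuous (partial j F)}.
  by move=> Uy; exact: (smooth_continuous (smooth_partial j sF) Uy).
set l := primitive i a (partial j F) z.
suff H : (fun h : R => h^-1 *: ((primitive i a F \o shift z) (h *: delta_mx 0 j) - primitive i a F z))
    @ 0^' --> l.
  split; first by apply/cvg_ex; exists l.
  exact: cvg_lim H.
apply/cvgrPdist_le => e e0.
have bz : 0 < z 0 i - a by rewrite subr_gt0.
have e1 : 0 < e / (z 0 i - a) by rewrite divr_gt0.
have /nbhs_ballP[d1 /= d10 dV] : nbhs z V by exact: open_nbhs_nbhs.
have /nbhs_ballP[d2 /= d20 tube] := primitive_tube cdF Vz e1.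
have dz (s d : R) : 0 < d -> `|s| < d -> ball z d (upd z j (z 0 j + s)).
  move=> d0 sd; apply: ball_upd; first exact: ballxx.
  by rewrite opprD addrA subrr add0r normrN.
near=> h.
have hd1 : `|h| < d1.
  near: h; apply: (@nbhs_dnbhs _ (0:R)); apply/nbhs_ballP; exists d1 => // h.
  by rewrite /ball /= sub0r normrN.
have hd2 : `|h| < d2.
  near: h; apply: (@nbhs_dnbhs _ (0:R)); apply/nbhs_ballP; exists d2 => // h.
  by rewrite /ball /= sub0r normrN.
have h0 : h != 0 by near: h; exact: nbhs_dnbhs_neq.
rewrite /= shift_delta.
have Vs s : `|s| <= `|h| -> V (upd z j (z 0 j + s)).
  by move=> sh; apply: dV; apply: dz => //; exact: le_lt_trans hd1.
have zji s : upd z j s 0 i = z 0 i by rewrite updE eq_sym (negbTE ji).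
have Us s t : `|s| <= `|h| -> a <= t <= z 0 i -> U (upd (upd z j (z 0 j + s)) i t).
  by move=> /Vs/VU[_]; rewrite zji => + at_; exact.
have I1 := primitive_integrable cF Uz.
have I3 := primitive_integrable cdF Uz.
have I2 : mu.-integrable `[a, z 0 i] (EFin \o (fun t => F (upd (upd z j (z 0 j + h)) i t))).
  by apply: primitive_integrable => // t at_; exact: Us.
have mab : measurable (`[a, z 0 i]%classic : set R) by exact: measurable_itv.
have I12 := integrable_itvB I2 I1.
have I4 := @integrable_itvZ _ _ h^-1 _ I12.
rewrite /l /primitive zji -(Rintegral_itvB I2 I1) /GRing.scale /= -(Rintegral_itvZ _ I12).
have -> : e = e / (z 0 i - a) * (z 0 i - a) by rewrite divfK // gt_eqF.
apply: Rintegral_dist_le => //; first exact: ltW.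
move=> t at_.
(* The point [s] depends on [t] but enters only a bound that is pointwise in [t]; the integrand
   remains the difference quotient. The mean value theorem is oriented, whence the two signs of
   [h]. *)
have [s sh es] : exists2 s : R, `|s| <= `|h| &
   F (upd (upd z j (z 0 j + h)) i t) - F (upd z i t) =
   partial j F (upd (upd z j (z 0 j + s)) i t) * h.
  have zt w : upd (upd z j w) i t = upd (upd z i t) j w by rewrite updC.
  have ztj : upd z i t = upd (upd z i t) j (z 0 j).
    by rewrite -zt upd_id.
  have dF w : `|w - z 0 j| <= `|h| -> derivable F (upd (upd z i t) j w) (delta_mx 0 j).
    move=> wh; apply: (smooth_derivable _ sF); rewrite -zt.
    by have := Us _ _ wh at_; rewrite addrC subrK.
  have [hp|hn] := ltrP 0 h.
    have [||w w1 w2] := @partial_MVT R n F (upd z i t) j (z 0 j) (z 0 j + h).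
    - by rewrite lerDl ltW.
    - move=> w /andP[w1 w2]; apply: dF; rewrite (gtr0_norm hp) ler_norml; apply/andP; split; lra.
    exists (w - z 0 j).
      by move: w1 => /andP[w1 w3]; rewrite (gtr0_norm hp) ler_norml; apply/andP; split; lra.
    rewrite !zt [X in _ - F X]ztj w2.
    have -> : z 0 j + h - z 0 j = h by rewrite addrAC subrr add0r.
    by congr (partial j F (upd _ j _) * _); rewrite [RHS]addrC subrK.
  have [||w w1 w2] := @partial_MVT R n F (upd z i t) j (z 0 j + h) (z 0 j).
  - by rewrite gerDl.
  - move=> w /andP[w1 w2]; apply: dF; rewrite (ler0_norm hn) ler_norml; apply/andP; split; lra.
  exists (w - z 0 j).
    by move: w1 => /andP[w1 w3]; rewrite (ler0_norm hn) ler_norml; apply/andP; split; lra.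
  rewrite !zt [X in _ - F X]ztj -opprB w2 -mulrN.
  have -> : - (z 0 j - (z 0 j + h)) = h by rewrite opprB addrAC subrr add0r.
  by congr (partial j F (upd _ j _) * _); rewrite addrC subrK.
rewrite es mulrC mulfK // ltW //; apply: tube => //.
by apply: dz => //; exact: le_lt_trans hd2.
Unshelve. all: by end_near. Qed.

(** The passage from [z] to [y] is split at [y'], which has the parameters of [y] and the upper
    limit of [z]: first the tube estimate, then a bound [B] on the integrand times the change of the
    limit. *)
Lemma primitive_continuous (F : 'rV[R]_n -> R) (z : 'rV[R]_n) :
  (forall y, U y -> {for y, continuous F}) -> V z ->
  {for z, continuous (primitive i a F)}.
Proof.
move=> cF Vz; have [az Uz] := VU Vz.
have bz : 0 < z 0 i - a by rewrite subr_gt0.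
have Uzz := primitive_dom Vz.
have H : primitive i a F y @[y --> z] --> primitive i a F z.
  move=> A /nbhs_ballP[e' /= e'0 eA].
  have [e e0 ee] : exists2 e, 0 < e & e < e'.
    by exists (e' / 2); rewrite ?divr_gt0 // ltr_pdivrMr // ltr_pMr // ltr1n.
  have e2 : 0 < e / 2 by rewrite divr_gt0.
  have e1 : 0 < e / 2 / (z 0 i - a) by rewrite divr_gt0.
  have /nbhs_ballP[d1 /= d10 dV] : nbhs z V by exact: open_nbhs_nbhs.
  have /nbhs_ballP[d2 /= d20 tube] := primitive_tube cF Vz e1.
  have /nbhs_ballP[d3 /= d30 bF] : \forall y \near z, `|F z - F y| < 1.
    exact: (@cvgr_dist_lt _ _ _ _ _ _ _ (cF _ Uzz) _ ltr01).
  pose B := `|F z| + 1.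
  have B0 : 0 < B by rewrite ltr_wpDl.
  pose d := Num.min d1 (Num.min d2 (Num.min d3 (e / 2 / B))).
  have d0 : 0 < d by rewrite !lt_min d10 d20 d30 /= divr_gt0.
  have dd1 : d <= d1 by rewrite ge_min lexx.
  have dd2 : d <= d2 by rewrite !ge_min lexx orbT.
  have dd3 : d <= d3 by rewrite !ge_min lexx !orbT.
  have dd4 : d <= e / 2 / B by rewrite !ge_min lexx !orbT.
  apply/nbhs_ballP; exists d => // y zy.
  have [_ zyi] := (@ball_rowP _ _ _ _ _).1 zy.
  have by_ t : `|z 0 i - t| < d -> ball z d (upd y i t) by exact: ball_upd.
  pose y' := upd y i (z 0 i).
  have zy' : ball z d y' by apply: by_; rewrite subrr normr0.
  have y'i : y' 0 i = z 0 i by rewrite updE eqxx.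
  have Vy' : V y' by apply: dV; exact: le_ball zy'.
  have [_ Uy'] := VU Vy'; rewrite y'i in Uy'.
  have h1 : `|primitive i a F z - primitive i a F y'| <= e / 2.
    have -> : e / 2 = e / 2 / (z 0 i - a) * (z 0 i - a) by rewrite divfK // gt_eqF.
    rewrite /primitive y'i; apply: Rintegral_dist_le; first exact: ltW.
    - exact: primitive_integrable.
    - exact: primitive_integrable.
    by move=> t at_; rewrite ltW //; apply: tube => //; exact: le_ball zy'.
  have dp t : `|z 0 i - t| < d -> is_derive t 1 (fun t => primitive i a F (upd y i t)) (F (upd y i t)).
    move=> zt; have Vt : V (upd y i t) by apply: dV; apply: le_ball (by_ _ zt).
    have [dt pt] := primitive_derive cF Vt.
    by have := is_derive_line dt; rewrite /partial pt.
  have FB t : `|z 0 i - t| < d -> `|F (upd y i t)| <= B.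
    move=> zt; have := bF _ (le_ball dd3 (by_ _ zt)); rewrite /B => h.
    rewrite -[F (upd y i t)](subrK (F z)) addrC; apply: le_trans (ler_normD _ _) _.
    by rewrite lerD2l distrC ltW.
  have zi : `|z 0 i - y 0 i| < d by exact: zyi.
  have z00 : `|z 0 i - z 0 i| < d by rewrite subrr normr0.
  have h2 : `|primitive i a F y' - primitive i a F y| <= e / 2.
    have key (s t : R) : s <= t -> `|z 0 i - s| < d -> `|z 0 i - t| < d -> t - s <= d ->
        `|primitive i a F (upd y i t) - primitive i a F (upd y i s)| <= e / 2.
      move=> st zs zt tsd.
      have [|w /andP[w1 w2] ->] := @MVT_is_derive R (fun t => primitive i a F (upd y i t))
          (fun t => F (upd y i t)) s t st.
        move=> w /andP[w1 w2]; apply: dp.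
        by move: zs zt; rewrite !ltr_norml => /andP[? ?] /andP[? ?]; apply/andP; split; lra.
      have zw : `|z 0 i - w| < d.
        by move: zs zt; rewrite !ltr_norml => /andP[? ?] /andP[? ?]; apply/andP; split; lra.
      rewrite normrM (@ger0_norm _ (t - s)) ?subr_ge0 //.
      have -> : e / 2 = B * (e / 2 / B) by rewrite [RHS]mulrC divfK // gt_eqF.
      apply: ler_pM => //; [by rewrite subr_ge0|exact: FB|exact: le_trans dd4].
    have := zi; rewrite ltr_norml => /andP[zi1 zi2].
    rewrite /y' -{2}(upd_id y i).
    have [le|/ltW le] := lerP (y 0 i) (z 0 i).
      by apply: key => //; lra.
    by rewrite distrC; apply: key => //; lra.
  apply: eA; rewrite /ball /=; apply: le_lt_trans ee.
  rewrite [leRHS]splitr; apply: le_trans (lerD h1 h2).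
  exact: ler_distD.
exact: H.
Qed.

(** The derivative along [x_i] gives back [F], the other ones commute with the primitive, so the
    induction on the order closes. *)
Lemma smooth_primitive (F : 'rV[R]_n -> R) : smooth_on U F -> smooth_on V (primitive i a F).
Proof.
move=> sF; apply/smooth_onP => k; elim: k F sF => // k IH F sF.
have cF y : U y -> {for y, continuous F} by move=> Uy; exact: smooth_continuous Uy.
split=> [z Vz|j].
  split; first exact: primitive_continuous.
  move=> j; have [->|ji] := eqVneq j i; first by case: (primitive_derive cF Vz).
  by case: (primitive_derive_param ji sF Vz).
have [->|ji] := eqVneq j i.
  apply: (@eq_Ck _ _ V k F) => //.
    by move=> z; rewrite inE => Vz; rewrite /partial; case: (primitive_derive cF Vz).
  have /smooth_onP : smooth_on V F by apply: smooth_subset sF => z; exact: primitive_dom.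
  exact.
apply: (@eq_Ck _ _ V k (primitive i a (partial j F))) => //.
  by move=> z; rewrite inE => Vz; rewrite /partial; case: (primitive_derive_param ji sF Vz).
by apply: IH; exact: smooth_partial.
Qed.

End Primitive.

Lemma partial_upd_cst (R : realType) (n : nat) (f : 'rV[R]_n -> R) (x : 'rV[R]_n) (i : 'I_n) :
  (forall t : R, f (upd x i t) = f x) -> partial i f x = 0.
Proof.
move=> fx; rewrite partial_line.
have -> : (fun t => f (upd x i t)) = (fun=> f x) by apply/funext.
exact: derive_cst.
Qed.

Lemma derivable_upd_cst (R : realType) (n : nat) (f : 'rV[R]_n -> R) (x : 'rV[R]_n) (i : 'I_n) :
  (forall t : R, f (upd x i t) = f x) -> derivable f x (delta_mx 0 i).
Proof.
move=> fx; apply/derivable_line.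
have -> : (fun t => f (upd x i t)) = (fun=> f x) by apply/funext.
exact: derivable_cst.
Qed.

Lemma smooth_coord (R : realType) (n : nat) (U : set 'rV[R]_n) (i : 'I_n) :
  open U -> smooth_on U (fun x => x 0 i).
Proof.
move=> oU; apply/smooth_onP => -[//|k].
have d x j : is_derive x (delta_mx 0 j) (fun x : 'rV[R]_n => x 0 i) (i == j)%:R.
  have e : (fun t : R => (upd x j t) 0 i) = if i == j then id else fun=> x 0 i.
    by apply/funext => t; rewrite updE; case: (i == j).
  have : is_derive (x 0 j) 1 (fun t : R => (upd x j t) 0 i) ((i == j)%:R : R).
    by rewrite e; case: (i == j); [exact: is_derive_id|exact: is_derive_cst].
  move=> [h1 h2]; split; first by apply/derivable_line.
  by have := partial_line (fun x : 'rV[R]_n => x 0 i) x j; rewrite /partial => ->.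
split=> [x Ux|j].
  split; first exact: coord_continuous.
  by move=> j; case: (d x j).
apply: (@eq_Ck _ _ U k (fun=> (i == j)%:R)) => //; last exact: Ck_cst.
by move=> x _; rewrite /partial; case: (d x j).
Qed.

(** * Coordinates on pairs of a point and a parameter; invertible matrices *)

Lemma ball_split (R : realType) (m n : nat) (p : 'rV[R]_m) (c : 'rV[R]_n) (z : 'rV[R]_(m + n)) (r : R) :
  ball (row_mx p c) r z <-> ball p r (lsubmx z) /\ ball c r (rsubmx z).
Proof.
split=> [/ball_rowP[r0 h]|[/ball_rowP[r0 h1] /ball_rowP[_ h2]]].
  split; apply/ball_rowP; split=> // i; rewrite mxE.
    by have := h (lshift n i); rewrite row_mxEl.
  by have := h (rshift m i); rewrite row_mxEr.
apply/ball_rowP; split=> // i; case: (split_ordP i) => j ->.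
  by rewrite row_mxEl; have := h1 j; rewrite mxE.
by rewrite row_mxEr; have := h2 j; rewrite mxE.
Qed.

Lemma lsubmx_updl (R : realType) (m n : nat) (z : 'rV[R]_(m + n)) i (t : R) :
  lsubmx (upd z (lshift n i) t) = upd (lsubmx z) i t.
Proof. by apply/rowP => j; rewrite !mxE (inj_eq (@lshift_inj _ _)). Qed.

Lemma rsubmx_updl (R : realType) (m n : nat) (z : 'rV[R]_(m + n)) i (t : R) :
  rsubmx (upd z (lshift n i) t) = rsubmx z.
Proof. by apply/rowP => j; rewrite !mxE eq_rlshift. Qed.

Lemma lsubmx_updr (R : realType) (m n : nat) (z : 'rV[R]_(m + n)) i (t : R) :
  lsubmx (upd z (rshift m i) t) = lsubmx z.
Proof. by apply/rowP => j; rewrite !mxE eq_lrshift. Qed.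

Lemma rsubmx_updr (R : realType) (m n : nat) (z : 'rV[R]_(m + n)) i (t : R) :
  rsubmx (upd z (rshift m i) t) = upd (rsubmx z) i t.
Proof. by apply/rowP => j; rewrite !mxE (inj_eq (@rshift_inj _ _)). Qed.

Lemma unitmx_kernel (F : fieldType) (n : nat) (A : 'M[F]_n) :
  (forall u : 'I_n -> F, (forall j, \sum_i u i * A i j = 0) -> forall i, u i = 0) ->
  A \in unitmx.
Proof.
move=> h; rewrite unitmxE unitfE; apply/det0P => -[v v0 vA]; move/eqP: v0; apply.
apply/rowP => i; rewrite mxE; apply: (h (fun i => v 0 i)) => j.
by move/rowP: vA => /(_ j); rewrite !mxE.
Qed.

Lemma invmx_diag (F : fieldType) (n : nat) (A : 'M[F]_n) :
  (forall i j, i != j -> A i j = 0) -> (forall i, A i i != 0) ->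
  invmx A = diag_mx (\row_i (A i i)^-1).
Proof.
move=> dA A0; set B := diag_mx _.
have AB : A *m B = 1%:M.
  apply/matrixP => i j; rewrite mul_mx_diag !mxE.
  case: (i =P j) => [<-|/eqP ij]; first by rewrite mulfV.
  by rewrite (dA _ _ ij) mul0r.
have [uA _] := mulmx1_unit AB.
by rewrite -[RHS](mulKmx uA) AB mulmx1.
Qed.

(** * Staeckel metrics *)

Section Staeckel.
Variables (R : realType) (n : nat).

(* The classical Staeckel condition: [S i j] is a function of the coordinate
   [x_i] alone, and the rows of the contravariant metric combine the columns
   of [S] into constants. *)
Record staeckel (g : 'rV[R]_n -> 'M[R]_n) (p : 'rV[R]_n) (r : R)
    (S : 'I_n -> 'I_n -> R -> R) (eps : 'I_n -> R) : Prop := Staeckel {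
  staeckel_gt0 : 0 < r;
  staeckel_diag : forall x, ball p r x -> forall i j, i != j -> g x i j = 0;
  staeckel_neq0 : forall x, ball p r x -> forall i, g x i i != 0;
  staeckel_smooth : forall i j, smooth_on (ball p r) (fun x : 'rV[R]_n => S i j (x 0 i));
  staeckel_sum : forall x, ball p r x -> forall j,
    \sum_i S i j (x 0 i) / g x i i = eps j;
  staeckel_nonsing : forall u : 'I_n -> R,
    (forall j, \sum_i u i * S i j (p 0 i) = 0) -> forall i, u i = 0 }.

Lemma staeckel_subset g (p : 'rV[R]_n) (r r' : R) S eps : 0 < r' ->
  ball p r' `<=` ball p r -> staeckel g p r S eps -> staeckel g p r' S eps.
Proof.
move=> r'0 rr [_ dg g0 sS sumS nsS]; split=> //.
- by move=> x /rr; exact: dg.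
- by move=> x /rr; exact: g0.
- by move=> i j; exact: (smooth_subset _ rr (sS i j)).
- by move=> x /rr; exact: sumS.
Qed.

Variables (g : 'rV[R]_n -> 'M[R]_n) (p : 'rV[R]_n) (r : R)
  (S : 'I_n -> 'I_n -> R -> R) (eps : 'I_n -> R).
Hypothesis SP : staeckel g p r S eps.

Let Sx (x : 'rV[R]_n) : 'M[R]_n := \matrix_(i, j) S i j (x 0 i).
Let Q (i : 'I_n) (z : 'rV[R]_(n + n)) : R :=
  \sum_j S i j (lsubmx z 0 i) * rsubmx z 0 j.
(** Chosen so that every radicand [Q i] is 1 at the centre, whatever the signs of the [g_ii]. *)
Let c0 : 'rV[R]_n := (invmx (Sx p) *m const_mx 1)^T.
Let z0 : 'rV[R]_(n + n) := row_mx p c0.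
Let U0 : set 'rV[R]_(n + n) := ball z0 r.

Lemma staeckel_Q_center i : Q i z0 = 1.
Proof.
have uS : Sx p \in unitmx.
  apply: unitmx_kernel => u h; apply: (staeckel_nonsing SP) => j.
  by rewrite -[RHS](h j); apply: eq_bigr => i' _; rewrite mxE.
have : Sx p *m c0^T = const_mx 1 :> 'cV[R]_n by rewrite trmxK mulKVmx.
move=> /colP/(_ i); rewrite !mxE => <-; apply: eq_bigr => j _.
by rewrite /z0 row_mxKl row_mxKr !mxE.
Qed.

Lemma staeckel_S_smooth i j :
  smooth_on U0 (fun z : 'rV[R]_(n + n) => S i j (lsubmx z 0 i)).
Proof.
pose s (i : 'I_n) : option 'I_(n + n) := Some (lshift n i).
have e (z : 'rV[R]_(n + n)) : subst s p z = lsubmx z by apply/rowP => l; rewrite !mxE.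
have s_inj i1 i2 l : s i1 = Some l -> s i2 = Some l -> i1 = i2.
  by move=> h1 h2; apply: (@lshift_inj n n); apply: Some_inj; rewrite -/(s i1) -/(s i2) h1 h2.
have := smooth_subst s_inj (ball_open z0 r) _ (staeckel_smooth SP i j).
move=> /(_ p) h; apply: (eq_smooth _ (ball_open z0 r) _ (h _)).
  by move=> z _; rewrite /= e.
by move=> z; rewrite e => /ball_split[].
Qed.

Lemma staeckel_Q_smooth i : smooth_on U0 (Q i).
Proof.
have oU := ball_open z0 r.
apply: (@smooth_sum _ _ _ _ _ _ (fun j (z : 'rV[R]_(n + n)) =>
  S i j (lsubmx z 0 i) * rsubmx z 0 j) oU) => j _.
apply: (smoothM oU); first exact: staeckel_S_smooth.
by apply: (eq_smooth _ oU _ (smooth_coord (rshift n j) oU)) => z _; rewrite mxE.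
Qed.

Lemma staeckel_det_smooth : smooth_on U0 (fun z => \det (Sx (lsubmx z))).
Proof.
have oU := ball_open z0 r.
apply: (@smooth_sum _ _ _ _ _ _ (fun (s : 'S_n) (z : 'rV[R]_(n + n)) =>
  (-1) ^+ s * \prod_i Sx (lsubmx z) i (s i)) oU) => s _.
apply: (smoothM oU); first exact: smooth_cst.
apply: (@smooth_prod _ _ _ _ _ _ (fun i (z : 'rV[R]_(n + n)) =>
  Sx (lsubmx z) i (s i)) oU) => i _.
by apply: (eq_smooth _ oU _ (staeckel_S_smooth i (s i))) => z _; rewrite /Sx [RHS]mxE.
Qed.

(** Positivity of the radicands and nonsingularity of [S] are known at the centre only; both are
    open conditions. *)
Lemma staeckel_radius : exists2 rho : R, 0 < rho <= r &
  forall z, ball z0 rho z -> (forall i, 0 < Q i z) /\ \det (Sx (lsubmx z)) != 0.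
Proof.
have r0 := staeckel_gt0 SP.
have Uz : U0 z0 by exact: ballxx.
have nQ i : \forall z \near z0, 0 < Q i z.
  have c : {for z0, continuous (Q i)} := smooth_continuous (staeckel_Q_smooth i) Uz.
  apply: (@cvgr_gt _ _ _ _ _ _ c) => //.
  by rewrite staeckel_Q_center.
have {}nQ : \forall z \near z0, forall i, 0 < Q i z by exact: filter_forall nQ.
have nd : \forall z \near z0, \det (Sx (lsubmx z)) != 0.
  have c := smooth_continuous staeckel_det_smooth Uz.
  apply: (@cvgr_neq0 _ _ _ _ _ _ _ c).
  rewrite row_mxKl -unitfE -unitmxE.
  apply: unitmx_kernel => u h; apply: (staeckel_nonsing SP) => j.
  by rewrite -[RHS](h j); apply: eq_bigr => i' _; rewrite mxE.
have /nbhs_ballP[rho /= rho0 h] : \forall z \near z0,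
    (forall i, 0 < Q i z) /\ \det (Sx (lsubmx z)) != 0 by exact: filterI nQ nd.
exists (Num.min rho r); first by rewrite lt_min rho0 r0 ge_min lexx orbT.
by move=> z zb; have := h z; apply; apply: le_ball zb; rewrite ge_min lexx.
Qed.

Lemma staeckel_separable : exists (r' : R) (C : set 'rV[R]_n) (E : 'rV[R]_n -> R)
    (w : 'I_n -> R -> 'rV[R]_n -> R),
  0 < r' /\ open C /\ C !=set0 /\
  complete_integral (ball p r') C g E (separated_sum w).
Proof.
have [rho /andP[rho0 rhor] HQ] := staeckel_radius.
(* Points range over the ball of radius [rho / 2], so this base point is strictly below their
   coordinates, while the segments from it remain in the ball of radius [rho]. *)
pose a (i : 'I_n) : R := p 0 i - rho / 2.
pose F (i : 'I_n) (z : 'rV[R]_(n + n)) := Num.sqrt (Q i z).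
pose G (i j : 'I_n) (z : 'rV[R]_(n + n)) := (2 * F i z)^-1 * S i j (lsubmx z 0 i).
pose C : set 'rV[R]_n := ball c0 rho.
pose U : set 'rV[R]_(n + n) := ball z0 rho.
pose V := [set z : 'rV[R]_(n + n) | ball p (rho / 2) (lsubmx z) /\ C (rsubmx z)].
pose w (i : 'I_n) (t : R) (c : 'rV[R]_n) : R :=
  \int[lebesgue_measure]_(s in `[a i, t]) Num.sqrt (\sum_j S i j s * c 0 j).
have h0 : 0 < rho / 2 by rewrite divr_gt0.
have h1 : rho / 2 < rho by rewrite ltr_pdivrMr // ltr_pMr // ltr1n.
have oU : open U by exact: ball_open.
have UU0 : U `<=` U0 by move=> z; exact: le_ball.
have oV : open V.
  rewrite openE => z [/ball_rowP[_ zl] zr].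
  have /nbhs_ballP[d1 /= d10 b1] : nbhs (rsubmx z) C by apply: open_nbhs_nbhs; split=> //; exact: ball_open.
  have zl' : ball p (rho / 2) (lsubmx z) by apply/ball_rowP.
  have /nbhs_ballP[d2 /= d20 b2] : nbhs (lsubmx z) (ball p (rho / 2)).
    by apply: open_nbhs_nbhs; split=> //; exact: ball_open.
  apply/nbhs_ballP; exists (Num.min d1 d2); first by rewrite /= lt_min d10.
  move=> y; rewrite -{1}[z]hsubmxK => /ball_split[yl yr]; split.
    by apply: b2; apply: le_ball yl; rewrite ge_min lexx orbT.
  by apply: b1; apply: le_ball yr; rewrite ge_min lexx.
have VU i z : V z -> a i < z 0 (lshift n i) /\
    forall t : R, a i <= t <= z 0 (lshift n i) -> U (upd z (lshift n i) t).
  move=> [/[dup] zl /ball_rowP[_ zlb] zr].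
  have := zlb i; rewrite mxE ltr_norml => /andP[z1 z2].
  split; first by rewrite /a; lra.
  move=> t /andP[t1 t2]; apply/ball_split; rewrite lsubmx_updl rsubmx_updl; split=> //.
  apply: ball_upd; first by apply: le_ball zl; exact: ltW.
  by move: t1; rewrite /a ltr_norml => t1; apply/andP; split; lra.
have VU' z : V z -> U z.
  by move=> [zl zr]; apply/ball_split; split=> //; apply: le_ball zl; exact: ltW.
have Q0 i z : U z -> 0 < Q i z by move=> /HQ[].
have F0 i z : U z -> 0 < F i z by move=> Uz; rewrite sqrtr_gt0 Q0.
have sF i : smooth_on U (F i).
  by apply: (smooth_sqrt oU (Q0 i)); exact: smooth_subset UU0 (staeckel_Q_smooth i).
have sS i j : smooth_on U (fun z : 'rV[R]_(n + n) => S i j (lsubmx z 0 i)).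
  exact: smooth_subset UU0 (staeckel_S_smooth i j).
have sG i j : smooth_on U (G i j).
  apply: (smoothM oU) (sS i j).
  apply: (smoothV oU); first by move=> z Uz; rewrite mulf_neq0 // gt_eqF // F0.
  by apply: (smoothM oU) (sF i); exact: smooth_cst.
have cF i y : U y -> {for y, continuous (F i)} by move=> Uy; exact: (smooth_continuous (sF i) Uy).
have cG i j y : U y -> {for y, continuous (G i j)} by move=> Uy; exact: (smooth_continuous (sG i j) Uy).
have dF i j z : U z -> partial (rshift n j) (F i) z = G i j z.
  move=> Uz; rewrite partial_line.
  have qe t : Q i (upd z (rshift n j) t) = Q i z + S i j (lsubmx z 0 i) * (t - rsubmx z 0 j).
    rewrite /Q lsubmx_updr rsubmx_updr (bigD1 j) //= [X in _ = X + _](bigD1 j) //= updE eqxx.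
    rewrite (eq_bigr (fun l => S i l (lsubmx z 0 i) * rsubmx z 0 l)); last first.
      by move=> l lj; rewrite updE (negbTE lj).
    by move: (S i j _) (rsubmx z 0 j) (\sum_(_ < _ | _) _) => A B D; ring.
  have ezj : z 0 (rshift n j) = rsubmx z 0 j by rewrite mxE.
  have dq : is_derive (z 0 (rshift n j)) 1 (fun t => Q i (upd z (rshift n j) t)) (S i j (lsubmx z 0 i)).
    have -> : (fun t => Q i (upd z (rshift n j) t)) =
       (fun t => Q i z + S i j (lsubmx z 0 i) * (t - rsubmx z 0 j)) by apply/funext.
    apply: is_derive_eq.
    by rewrite add0r mul1r subr0 [_ *: _]mulr1.
  have ds : is_derive (Q i (upd z (rshift n j) (z 0 (rshift n j)))) 1 Num.sqrt
      (2 * Num.sqrt (Q i (upd z (rshift n j) (z 0 (rshift n j)))))^-1.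
    by apply: is_derive1_sqrt; rewrite upd_id; exact: Q0.
  have [_ ] := is_derive1_comp ds dq.
  by rewrite upd_id => ->.
have WE z : separated_sum w z = \sum_i primitive (lshift n i) (a i) (F i) z.
  apply: eq_bigr => i _; rewrite /w /primitive [lsubmx z 0 i]mxE.
  apply: eq_Rintegral => s _; congr Num.sqrt; apply: eq_bigr => j _.
  by rewrite lsubmx_updl rsubmx_updl updE eqxx.
have WE' : separated_sum w = (fun z => \sum_i primitive (lshift n i) (a i) (F i) z).
  exact/funext.
have inv (P : 'I_n -> 'rV[R]_(n + n) -> R) i i' z t : i' != i ->
    (forall z t, P i' (upd z (lshift n i) t) = P i' z) ->
    primitive (lshift n i') (a i') (P i') (upd z (lshift n i) t) =
    primitive (lshift n i') (a i') (P i') z.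
  move=> ii' hP; rewrite /primitive updE (inj_eq (@lshift_inj _ _)) (negbTE ii').
  apply: eq_Rintegral => s _.
  by rewrite updC ?hP // (inj_eq (@lshift_inj _ _)) eq_sym.
have invF i i' z t : i' != i -> F i' (upd z (lshift n i) t) = F i' z.
  move=> ii'; congr Num.sqrt; apply: eq_bigr => j _.
  by rewrite lsubmx_updl rsubmx_updl updE (negbTE ii').
have invG i i' j z t : i' != i -> G i' j (upd z (lshift n i) t) = G i' j z.
  by move=> ii'; rewrite /G invF // lsubmx_updl updE (negbTE ii').
have dsum i (P : 'I_n -> 'rV[R]_(n + n) -> R) z : V z ->
    (forall i' y, U y -> {for y, continuous (P i')}) ->
    (forall i' z t, i' != i -> P i' (upd z (lshift n i) t) = P i' z) ->
    partial (lshift n i) (fun z => \sum_i' primitive (lshift n i') (a i') (P i') z) z = P i z.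
  move=> Vz cP iP.
  have dP i' : is_derive z (delta_mx 0 (lshift n i)) (primitive (lshift n i') (a i') (P i'))
      (if i' == i then P i z else 0).
    case: (i' =P i) => [->|/eqP ii'].
      exact: (primitive_derive oV (VU i) (cP i) Vz).
    have hc t : primitive (lshift n i') (a i') (P i') (upd z (lshift n i) t) =
                primitive (lshift n i') (a i') (P i') z.
      by apply: inv => // z' t'; exact: iP.
    split; first exact: derivable_upd_cst.
    exact: partial_upd_cst.
  have := is_derive_sum dP; rewrite fct_sumE => -[_].
  rewrite /partial => ->.
  by rewrite -big_mkcond big_pred1_eq.
have dW i z : V z -> partial (lshift n i) (separated_sum w) z = F i z.
  by move=> Vz; rewrite WE'; apply: (dsum i F z Vz) => [i' y|i' y t]; [exact: cF|exact: invF].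
have dWr j z : V z -> partial (rshift n j) (separated_sum w) z =
    \sum_i primitive (lshift n i) (a i) (G i j) z.
  move=> Vz; rewrite WE'.
  have dP i' : is_derive z (delta_mx 0 (rshift n j)) (primitive (lshift n i') (a i') (F i'))
      (primitive (lshift n i') (a i') (G i' j) z).
    have -> : primitive (lshift n i') (a i') (G i' j) z =
      primitive (lshift n i') (a i') (partial (rshift n j) (F i')) z.
      apply: eq_Rintegral => t; rewrite inE /= in_itv /= => ht.
      by rewrite dF //; have [_] := VU i' z Vz; exact.
    by apply: (primitive_derive_param oV (VU i') _ (sF i') Vz); rewrite eq_rlshift.
  by have := is_derive_sum dP; rewrite fct_sumE => -[_].
(* The derivative in [c_j] is taken under the integral, and the one in [x_i] then removes the
   integral. *)
have dWlr i j z : V z ->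
    partial (lshift n i) (partial (rshift n j) (separated_sum w)) z = G i j z.
  move=> Vz; rewrite -(dsum i (fun i => G i j) z Vz).
  - have e : {in V, partial (rshift n j) (separated_sum w) =1
      (fun y => \sum_i' primitive (lshift n i') (a i') (G i' j) y)}.
      by move=> y; rewrite inE; exact: dWr.
    exact: (@eq_partial_on R _ V _ _ (lshift n i) oV e z (mem_set Vz)).
  - by move=> i' y; exact: cG.
  - by move=> i' y t; exact: invG.
(* Contracting the radicands [Q i] with [1 / g_ii] leaves the sum of [eps_j c_j] by the Staeckel
   relation, which gives the energy. *)
exists (rho / 2), C, (fun c => 2^-1 * \sum_j eps j * c 0 j), w.
split=> //; split; first exact: ball_open.
split; first by exists c0; exact: ballxx.
split.
  rewrite -/V WE'.
  apply: (@smooth_sum _ _ _ _ _ _ (fun i => primitive (lshift n i) (a i) (F i)) oV) => i _.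
  exact: (smooth_primitive oV (VU i) (sF i)).
move=> z Vz; have Uz := VU' _ Vz.
have zl : ball p r (lsubmx z).
  by case: Vz => + _; apply: le_ball; exact: (le_trans (ltW h1)).
split.
  congr (_ * _).
  rewrite (invmx_diag (staeckel_diag SP zl) (staeckel_neq0 SP zl)).
  transitivity (\sum_i (g (lsubmx z) i i)^-1 * Q i z).
    apply: eq_bigr => i _; rewrite (bigD1 i) //= big1 ?addr0; last first.
      by move=> j ij; rewrite !mxE eq_sym (negbTE ij) mulr0n !mul0r.
    rewrite !mxE eqxx mulr1n !dW // -mulrA; congr (_ * _).
    by rewrite -expr2 sqr_sqrtr // ltW // Q0.
  rewrite /Q; under eq_bigr do rewrite mulr_sumr.
  rewrite exchange_big /=; apply: eq_bigr => j _.
  rewrite -(staeckel_sum SP zl j) mulr_suml; apply: eq_bigr => i _.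
  by rewrite mulrA [_^-1 * _]mulrC.
(* The mixed Hessian is the Staeckel matrix with its rows scaled by [1 / (2 F_i)]. *)
have -> : \matrix_(i, j) partial (lshift n i) (partial (rshift n j) (separated_sum w)) z
    = diag_mx (\row_i (2 * F i z)^-1) *m Sx (lsubmx z).
  apply/matrixP => i j; rewrite mul_diag_mx [LHS]mxE [RHS]mxE dWlr // /G.
  by congr (_ * _); rewrite [RHS]mxE.
rewrite det_mulmx mulf_neq0 //; last by have [_] := HQ z Uz.
rewrite det_diag prodf_seq_neq0; apply/allP => i _; rewrite mxE /=.
by rewrite invr_neq0 // mulf_neq0 // gt_eqF // F0.
Qed.

End Staeckel.

Lemma diagonal_orthogonal (R : realType) (n : nat) (g : 'rV[R]_n -> 'M[R]_n) (p : 'rV[R]_n) (r : R) :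
  0 < r -> (forall i, smooth_on (ball p r) (fun x => g x i i)) ->
  (forall x, ball p r x -> forall i j, i != j -> g x i j = 0) ->
  (forall x, ball p r x -> forall i, g x i i != 0) ->
  exists (e : 'I_n -> R) (H : 'I_n -> 'rV[R]_n -> R),
      (forall i : 'I_n, e i = 1 \/ e i = -1) /\
      \forall x \near p,
        (forall i : 'I_n, 0 < H i x) /\
        g x = diag_mx (\row_i (e i * H i x ^+ 2)).
Proof.
move=> r0 sg dg g0.
have pp : ball p r p by exact: ballxx.
(* The sign is frozen at [p]; by continuity [g_ii] keeps it nearby. *)
exists (fun i => Num.sg (g p i i)), (fun i x => Num.sqrt `|g x i i|); split.
  move=> i; case: (sgrP (g p i i)) => [h|_|_]; [|by left|by right].
  by have := g0 p pp i; rewrite h eqxx.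
have nb : \forall x \near p, ball p r x by exact: nbhsx_ballx.
have ns i : \forall x \near p, 0 < Num.sg (g p i i) * g x i i.
  have c : {for p, continuous (fun x => Num.sg (g p i i) * g x i i)}.
    exact: (smooth_continuous (smoothM (ball_open p r) (smooth_cst _ (ball_open p r)) (sg i)) pp).
  apply: (@cvgr_gt _ _ _ _ _ _ c) => //.
  by rewrite -normrEsg normr_gt0 g0.
have {}ns : \forall x \near p, forall i, 0 < Num.sg (g p i i) * g x i i by exact: filter_forall ns.
apply: filterS2 nb ns => x px sx; split=> [i|].
  by rewrite sqrtr_gt0 normr_gt0 g0.
apply/matrixP => i j; rewrite !mxE.
case: (i =P j) => [<-|/eqP ij]; last by rewrite dg // mulr0n.
rewrite mulr1n sqr_sqrtr //.
have := sx i; case: (sgrP (g p i i)) => [_|_|_]; rewrite ?mul0r ?ltxx // ?mul1r.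
  by move=> h; rewrite gtr0_norm.
by rewrite mulN1r oppr_gt0 => h; rewrite ltr0_norm // mulN1r opprK.
Qed.

(** * Concircular tensors and their associated product *)

Section Blocks.
Variables (R : realType) (n k : nat) (blk : 'I_n -> 'I_k.+1).

Lemma delta_entry (i j : 'I_n) : (delta_mx 0 i : 'rV[R]_n) 0 j = (j == i)%:R.
Proof. by rewrite mxE eqxx. Qed.

Lemma block_spaceP (a : 'I_k.+1) (v : 'rV[R]_n) :
  reflect (forall j, blk j != a -> v 0 j = 0) (v <= block_space R blk a)%MS.
Proof.
apply: (iffP idP) => [vb j ja|h].
  have bk : (block_space R blk a <= kermx (delta_mx j 0 : 'cV[R]_n))%MS.
    apply/sumsmx_subP => i; rewrite inE => /eqP bi.
    rewrite genmxE; apply/sub_kermxP; rewrite mul_delta_mx_cond.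
    by case: eqP => // ij; move: ja; rewrite -ij bi eqxx.
  have /sub_kermxP/matrixP/(_ 0 0) := submx_trans vb bk.
  rewrite !mxE (bigD1 j) //= mxE !eqxx mulr1 big1 ?addr0 // => l lj.
  by rewrite mxE (negbTE lj) mulr0.
rewrite [v]row_sum_delta; apply: summx_sub => j _.
case: (eqVneq (blk j) a) => [ja|/h ->]; last by rewrite scale0r sub0mx.
apply: scalemx_sub; rewrite /block_space; apply: (sumsmx_sup j); first by rewrite inE ja.
by rewrite genmxE.
Qed.

Lemma delta_block (a : 'I_k.+1) (i : 'I_n) :
  ((delta_mx 0 i : 'rV[R]_n) <= block_space R blk a)%MS = (blk i == a).
Proof.
apply/block_spaceP/eqP => [h|<- j ji].
  apply/eqP/negPn/negP => /h; rewrite delta_entry eqxx => /eqP.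
  by rewrite oner_eq0.
by rewrite delta_entry; case: eqP => // ij; move: ji; rewrite ij eqxx.
Qed.

(** Clears the inverse metric: eigenvectors of the endomorphism are treated as those of the pencil
    of [L] and [G]. *)
Lemma endo_eigenP (G L : 'M[R]_n) (c : R) (v : 'rV[R]_n) : G \in unitmx ->
  reflect (v *m L = c *: (v *m G)) (v <= eigenspace (endo G L) c)%MS.
Proof.
move=> uG; apply: (iffP eigenspaceP) => [h|h].
  by rewrite scalemxAl -h /endo mulmxA mulmxKV.
by rewrite /endo mulmxA h -scalemxAl mulmxK.
Qed.

Lemma delta_sub_delta (i j : 'I_n) : ((delta_mx 0 i : 'rV[R]_n) <= (delta_mx 0 j : 'rV[R]_n))%MS = (i == j).
Proof.
apply/idP/eqP => [/sub_rVP[c /rowP/(_ i)]|->]; last exact: submx_refl.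
rewrite delta_entry mxE delta_entry eqxx; case: eqP => // _.
by rewrite mulr0 => /eqP; rewrite oner_eq0.
Qed.

(* Distinct eigenspaces of the self-adjoint endomorphism are orthogonal. *)
Lemma simple_block_orthogonal (G L : 'M[R]_n) (a : 'I_k.+1) (c : R) (m j : 'I_n) :
  G \in unitmx -> G^T = G -> L^T = L ->
  (1 < #|block blk a|)%N ->
  (eigenspace (endo G L) c == block_space R blk a)%MS ->
  (forall S : 'M[R]_n, (block_space R blk ord0 <= S)%MS <->
     (forall b : R, \rank (eigenspace (endo G L) b) = 1%N ->
        (eigenspace (endo G L) b <= S)%MS)) ->
  blk m = a -> blk j = ord0 -> G m j = 0.
Proof.
move=> uG sG sL ca /eqmxP ec h0 ma j0.
have em : ((delta_mx 0 m : 'rV[R]_n) <= eigenspace (endo G L) c)%MS by rewrite ec delta_block ma.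
have /(endo_eigenP _ _ _ uG) mL := em.
have Lm l : L m l = c * G m l.
  by move/rowP: mL => /(_ l); rewrite -!rowE !mxE.
(* The vectors orthogonal to [d_m]. As the space of F_0 is a least upper bound, it suffices that [S]
   contain each one-dimensional eigenspace. *)
pose S := kermx (G *m (delta_mx m 0 : 'cV[R]_n)).
have h : (block_space R blk ord0 <= S)%MS.
  apply/h0 => b rb; apply/rV_subP => v /(endo_eigenP _ _ _ uG) vL.
  (* The eigenspace of [c] contains at least two coordinate vectors, that of [b] is a line. *)
  have bc : b != c.
    apply/negP => /eqP bc.
    have [m' m'a m'm] : exists2 m', blk m' = a & m' != m.
      have /card_gt1P[m1 [m2 [+ + m12]]] := ca; rewrite !inE => /eqP m1a /eqP m2a.
      case: (eqVneq m1 m) => [m1m|]; last by exists m1.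
      by exists m2 => //; rewrite -m1m eq_sym.
    have em' : ((delta_mx 0 m' : 'rV[R]_n) <= eigenspace (endo G L) c)%MS by rewrite ec delta_block m'a.
    have : (eigenspace (endo G L) c <= (delta_mx 0 m : 'rV[R]_n))%MS.
      have [_ e] := mxrank_leqif_eq em.
      have : (\rank (delta_mx 0 m : 'rV[R]_n) == \rank (eigenspace (endo G L) c)).
        by rewrite -bc rb mxrank_delta.
      by rewrite e => /andP[].
    by move=> /(submx_trans em'); rewrite delta_sub_delta (negbTE m'm).
  apply/sub_kermxP; rewrite mulmxA; apply/rowP => o; rewrite (ord1 o).
  have cm (A : 'rV[R]_n) : (A *m (delta_mx m 0 : 'cV[R]_n)) 0 0 = A 0 m.
    by rewrite -colE mxE.
  rewrite cm [RHS]mxE.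
  have e1 : (v *m L) 0 m = c * (v *m G) 0 m.
    rewrite !mxE mulr_sumr; apply: eq_bigr => l _.
    have -> : L l m = L m l by rewrite -{1}sL mxE.
    have -> : G l m = G m l by rewrite -{1}sG mxE.
    by rewrite Lm mulrCA.
  move: e1; rewrite vL [LHS]mxE => /eqP; rewrite -subr_eq0 -mulrBl mulf_eq0 subr_eq0.
  by rewrite (negbTE bc) => /eqP.
have ej : ((delta_mx 0 j : 'rV[R]_n) <= block_space R blk ord0)%MS by rewrite delta_block j0.
have /sub_kermxP := submx_trans ej h.
rewrite mulmxA => /rowP/(_ 0); rewrite -rowE -colE !mxE => e.
by rewrite -sG mxE.
Qed.

End Blocks.

(** * The metric and its Christoffel symbols *)

Section LeviCivita.
Variables (R : realType) (n : nat) (U : set 'rV[R]_n) (g : 'rV[R]_n -> 'M[R]_n).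
Hypotheses (oU : open U) (gP : pseudo_riemannian U g).

Lemma metric_smooth i j : smooth_on U (fun x => g x i j).
Proof. by case: gP => -[]. Qed.

Lemma metric_tr x : U x -> (g x)^T = g x.
Proof. by case: gP => -[_ h] _; exact: h. Qed.

Lemma metricC x i j : U x -> g x i j = g x j i.
Proof. by move=> /metric_tr e; rewrite -{1}e mxE. Qed.

Lemma metric_unit x : U x -> g x \in unitmx.
Proof. by case: gP => _; exact. Qed.

(** Coordinate vectors could still be null inside a block, so some nonzero entry of the row has to
    replace [g_ii] as a divisor. *)
Lemma metric_row_neq0 x i : U x -> exists j, g x i j != 0.
Proof.
move=> Ux; have [/existsP[j gj]|/existsPn h] := boolP [exists j, g x i j != 0]; first by exists j.
have e : row i (g x) = 0.
  by apply/rowP => j; rewrite !mxE; apply/eqP/negPn/h.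
have : (delta_mx 0 i : 'rV[R]_n) *m g x *m invmx (g x) = 0 by rewrite -rowE e mul0mx.
rewrite mulmxK ?metric_unit // => /rowP/(_ i); rewrite delta_entry eqxx mxE => /eqP.
by rewrite oner_eq0.
Qed.

Lemma partial_metric_sym x k i j : U x ->
  partial k (fun y => g y i j) x = partial k (fun y => g y j i) x.
Proof.
move=> Ux; have e : {in U, (fun y => g y i j) =1 (fun y => g y j i)}.
  by move=> y; rewrite inE; exact: metricC.
exact: (@eq_partial_on R _ U _ _ k oU e x (mem_set Ux)).
Qed.

Lemma christoffelC x l i j : U x -> christoffel g l i j x = christoffel g l j i x.
Proof.
move=> Ux; congr (_ * _); apply: eq_bigr => m _; congr (_ * _).
by rewrite (partial_metric_sym _ i j) // [X in X - _]addrC.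
Qed.

(* The Christoffel symbols of the first kind. *)
Definition gam (j k i : 'I_n) (x : 'rV[R]_n) : R :=
  2^-1 * (partial k (fun y => g y i j) x + partial i (fun y => g y k j) x
          - partial j (fun y => g y k i) x).

Lemma christoffel_lower x j k i : U x ->
  \sum_l g x j l * christoffel g l k i x = gam j k i x.
Proof.
move=> Ux; pose T m := partial k (fun y => g y i m) x + partial i (fun y => g y k m) x
          - partial m (fun y => g y k i) x.
have e l : g x j l * christoffel g l k i x =
    \sum_m 2^-1 * (g x j l * invmx (g x) l m * T m).
  rewrite /christoffel mulrCA mulr_sumr mulr_sumr; apply: eq_bigr => m _.
  by rewrite -!mulrA.
under eq_bigr do rewrite e.
rewrite exchange_big /= (bigD1 j) //= [X in _ + X]big1 ?addr0 => [|m mj].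
  rewrite -mulr_sumr -mulr_suml.
  have /matrixP/(_ j j) := mulmxV (metric_unit Ux).
  by rewrite !mxE eqxx => ->; rewrite mul1r.
rewrite -mulr_sumr -mulr_suml.
have /matrixP/(_ j m) := mulmxV (metric_unit Ux).
by rewrite !mxE eq_sym (negbTE mj) => ->; rewrite mul0r mulr0.
Qed.

Lemma gam_compat x k i j : U x ->
  partial k (fun y => g y i j) x = gam j k i x + gam i k j x.
Proof.
move=> Ux; rewrite /gam (partial_metric_sym k j i) //.
by field.
Qed.

Variable L : 'rV[R]_n -> 'M[R]_n.

Lemma christoffel_eigenrow x i k j (c : R) : U x -> (forall m, L x i m = c * g x i m) ->
  \sum_m christoffel g m k j x * L x i m = c * gam i k j x.
Proof.
move=> Ux h; rewrite -(christoffel_lower i k j Ux) mulr_sumr.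
by apply: eq_bigr => m _; rewrite h mulrC mulrA.
Qed.

End LeviCivita.

(** * Orthogonality of the blocks and independence of the other blocks' coordinates *)

Section AssociatedProduct.
Variables (R : realType) (n k : nat) (B : set 'rV[R]_n) (p : 'rV[R]_n).
Variables (g L : 'rV[R]_n -> 'M[R]_n) (blk : 'I_n -> 'I_k.+1).
Hypotheses (oB : open B) (Bp : B p) (gP : pseudo_riemannian B g).
Hypotheses (LP : orthogonal_concircular B g L) (AP : associated_product B g L blk).

Lemma concircular_tr x : B x -> (L x)^T = L x.
Proof. by case: LP => -[[_ h] _] _; exact: h. Qed.

Lemma concircular_sym x i j : B x -> L x i j = L x j i.
Proof. by move=> /concircular_tr e; rewrite -{1}e mxE. Qed.

Lemma concircular_smooth i j : smooth_on B (fun x => L x i j).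
Proof. by case: LP => -[[h _] _] _; exact: h. Qed.

Lemma block_constants : exists c : 'I_k.+1 -> R, forall a, a != ord0 ->
  forall x, B x -> (eigenspace (endo (g x) (L x)) (c a) == block_space R blk a)%MS.
Proof.
have h a : exists c : R, a != ord0 -> forall x, B x ->
    (eigenspace (endo (g x) (L x)) c == block_space R blk a)%MS.
  have [a0|a0] := eqVneq a ord0; first by exists 0.
  by have [_ [c hc]] := AP.2 a a0; exists c => _ x /hc[].
have [c hc] := choice h.
by exists c.
Qed.

Variable c : 'I_k.+1 -> R.
Hypothesis cP : forall a, a != ord0 ->
  forall x, B x -> (eigenspace (endo (g x) (L x)) (c a) == block_space R blk a)%MS.

Lemma eigen_block (a : 'I_k.+1) x (v : 'rV[R]_n) : a != ord0 -> B x ->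
  v *m L x = c a *: (v *m g x) -> forall j, blk j != a -> v 0 j = 0.
Proof.
move=> a0 Bx; move/(endo_eigenP _ _ _ (metric_unit gP Bx)) => ev.
have /eqmxP ec := cP a0 Bx.
by apply/block_spaceP; rewrite -ec.
Qed.

Lemma block_row x m j : blk m != ord0 -> B x -> L x m j = c (blk m) * g x m j.
Proof.
move=> m0 Bx; have /eqmxP ec := cP m0 Bx.
have : ((delta_mx 0 m : 'rV[R]_n) <= eigenspace (endo (g x) (L x)) (c (blk m)))%MS.
  by rewrite ec delta_block.
by move=> /(endo_eigenP _ _ _ (metric_unit gP Bx))/rowP/(_ j); rewrite -!rowE !mxE.
Qed.

Lemma block_constant_neq (m j : 'I_n) : blk m != ord0 -> blk j != ord0 ->
  blk m != blk j -> c (blk m) != c (blk j).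
Proof.
move=> m0 j0 mj; apply/negP => /eqP e.
have /eqmxP ea := cP m0 Bp; have /eqmxP eb := cP j0 Bp.
have : ((delta_mx 0 m : 'rV[R]_n) <= block_space R blk (blk j))%MS.
  by rewrite -eb -e ea delta_block.
by rewrite delta_block (negbTE mj).
Qed.

(** Two multidimensional blocks have distinct constants, and symmetry of [L] applies. Block 0 is
    only a span of eigenspaces, hence the separate argument [simple_block_orthogonal]. *)
Lemma block_orthogonal x i j : B x -> blk i != blk j -> g x i j = 0.
Proof.
move=> Bx; wlog i0 : i j / blk i != ord0 => [W ij|ij].
  have [i0|i0] := eqVneq (blk i) ord0; last exact: W.
  by rewrite (metricC gP) //; apply: W; [rewrite -i0 eq_sym|rewrite eq_sym].
have [j0|j0] := eqVneq (blk j) ord0.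
  have [cb _] := AP.2 _ i0.
  apply: (simple_block_orthogonal (metric_unit gP Bx) (metric_tr gP Bx) (concircular_tr Bx)
    cb (cP i0 Bx)) => //.
  exact: AP.1.
have := concircular_sym i j Bx; rewrite !block_row // (metricC gP j i Bx) => /eqP.
by rewrite -subr_eq0 -mulrBl mulf_eq0 subr_eq0 (negbTE (block_constant_neq i0 j0 ij)) => /eqP.
Qed.

Lemma block_orthogonal_L x i j : B x -> blk i != blk j -> L x i j = 0.
Proof.
move=> Bx ij; have [i0|i0] := eqVneq (blk i) ord0; last first.
  by rewrite block_row // block_orthogonal ?mulr0.
have j0 : blk j != ord0 by rewrite -i0 eq_sym.
by rewrite concircular_sym // block_row // block_orthogonal ?mulr0 // eq_sym.
Qed.

Lemma partial_block_orthogonal x l i j : B x -> blk i != blk j ->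
  partial l (fun y => g y i j) x = 0.
Proof.
move=> Bx ij; have e : {in B, (fun y => g y i j) =1 (fun=> 0)}.
  by move=> y; rewrite inE => By; rewrite block_orthogonal.
by rewrite (@eq_partial_on R _ B _ _ l oB e x (mem_set Bx)) /partial derive_cst.
Qed.

Variable alpha : 'rV[R]_n -> 'rV[R]_n.
Hypothesis alphaP : forall x, B x -> forall i j l : 'I_n,
  nabla g L l i j x = 2^-1 * (alpha x 0 i * g x j l + alpha x 0 j * g x i l).

(* On a multidimensional block L - c g vanishes, so only the Christoffel terms
   of its covariant derivative survive. *)
Lemma block_nabla x i j l : B x -> blk i != ord0 ->
  \sum_m christoffel g m l i x * (L x m j - c (blk i) * g x m j) =
  - (2^-1 * (alpha x 0 i * g x j l + alpha x 0 j * g x i l)).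
Proof.
move=> Bx i0; rewrite -alphaP // /nabla.
have eL : {in B, (fun y => L y i j) =1 (fun y => c (blk i) * g y i j)}.
  by move=> y; rewrite inE; exact: block_row.
rewrite (@eq_partial_on R _ B _ _ l oB eL x (mem_set Bx)).
rewrite /partial deriveMl; last exact: (smooth_derivable _ (metric_smooth gP i j) Bx).
have := gam_compat oB gP l i j Bx; rewrite /partial => ->.
rewrite (christoffel_eigenrow gP l j Bx (fun m => block_row m i0 Bx)).
under eq_bigr do rewrite mulrBr.
rewrite sumrB.
have -> : \sum_m christoffel g m l i x * (c (blk i) * g x m j) = c (blk i) * gam g j l i x.
  rewrite -(christoffel_lower gP j l i Bx) mulr_sumr; apply: eq_bigr => m _.
  by rewrite (metricC gP m j Bx) mulrCA; congr (_ * _); rewrite mulrC.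
by rewrite /GRing.scale /=; ring.
Qed.

(** The tensor L - c g kills [d_m], so the component [nabla_j L_mm] vanishes and the concircular
    equation leaves [alpha_m g_mj = 0] for every [j]. *)
Lemma block_alpha0 x m : B x -> blk m != ord0 -> alpha x 0 m = 0.
Proof.
move=> Bx m0; have [j gj] := metric_row_neq0 gP m Bx.
have := @block_nabla x m m j Bx m0; rewrite big1 => [/eqP|l _]; last first.
  by rewrite concircular_sym // block_row // (metricC gP l m Bx) subrr mulr0.
have -> : 2^-1 * (alpha x 0 m * g x m j + alpha x 0 m * g x m j) = alpha x 0 m * g x m j by field.
rewrite eq_sym oppr_eq0.
by rewrite mulf_eq0 (negbTE gj) orbF => /eqP.
Qed.

(** By the concircular equation [nabla_q d_m] is again an eigenvector for the constant of the block
    of [m], hence tangent to that block. *)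
Lemma block_christoffel0 x l q m : B x -> blk m != ord0 -> blk q != blk m -> blk l != blk m ->
  christoffel g l q m x = 0.
Proof.
move=> Bx m0 qm lm.
pose v : 'rV[R]_n := \row_l christoffel g l q m x.
suff ev : v *m L x = c (blk m) *: (v *m g x).
  by have := eigen_block m0 Bx ev lm; rewrite mxE.
apply/rowP => j; rewrite !mxE; apply/eqP; rewrite -subr_eq0 mulr_sumr -sumrB.
have -> : \sum_i (v 0 i * L x i j - c (blk m) * (v 0 i * g x i j)) =
    \sum_i christoffel g i q m x * (L x i j - c (blk m) * g x i j).
  by apply: eq_bigr => i _; rewrite !mxE mulrBr mulrCA.
rewrite block_nabla // block_alpha0 // mul0r add0r block_orthogonal ?mulr0 ?oppr0 //.
by rewrite eq_sym.
Qed.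

(** With the upper index lowered, orthogonality of the blocks removes two of the three terms of the
    vanishing Christoffel symbol and leaves this derivative. *)
Lemma partial_block_g x m i j : B x -> blk m != ord0 -> blk i != blk m -> blk j != blk m ->
  partial m (fun y => g y i j) x = 0.
Proof.
move=> Bx m0 im jm.
have := christoffel_lower gP j i m Bx; rewrite big1 => [|l _]; last first.
  have [lm|lm] := eqVneq (blk l) (blk m).
    by rewrite block_orthogonal ?mul0r // lm.
  by rewrite block_christoffel0 ?mulr0.
rewrite /gam (@partial_block_orthogonal x i m j) // 1?eq_sym //.
rewrite (@partial_block_orthogonal x j i m) // add0r subr0 => /eqP.
by rewrite eq_sym mulf_eq0 invr_eq0 pnatr_eq0 /= => /eqP.
Qed.

Lemma partial_block_L x m i j : B x -> blk m != ord0 -> blk i != blk m -> blk j != blk m ->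
  partial m (fun y => L y i j) x = 0.
Proof.
move=> Bx m0 im jm.
have := alphaP Bx i j m; rewrite (block_orthogonal Bx im) (block_orthogonal Bx jm) !mulr0 addr0 mulr0.
rewrite /nabla big1 => [|l _]; last first.
  have [lm|lm] := eqVneq (blk l) (blk m).
    by rewrite (@block_orthogonal_L x l j) ?mulr0 // lm eq_sym.
  by rewrite (christoffelC oB gP) // block_christoffel0 // mul0r.
rewrite big1 => [|l _]; last first.
  have [lm|lm] := eqVneq (blk l) (blk m).
    by rewrite (@block_orthogonal_L x i l) ?mulr0 // lm.
  by rewrite (christoffelC oB gP) // block_christoffel0 // mul0r.
by rewrite !subr0.
Qed.

End AssociatedProduct.

Lemma unitmx_row_neq0 (R : realType) (n : nat) (G : 'M[R]_n) (i : 'I_n) :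
  G \in unitmx -> (forall j, j != i -> G i j = 0) -> G i i != 0.
Proof.
move=> uG h; apply/negP => /eqP Gii.
have e : row i G = 0.
  by apply/rowP => j; rewrite !mxE; case: (eqVneq j i) => [->//|/h].
have : (delta_mx 0 i : 'rV[R]_n) *m G *m invmx G = 0 by rewrite -rowE e mul0mx.
rewrite mulmxK // => /rowP/(_ i); rewrite delta_entry eqxx mxE => /eqP.
by rewrite oner_eq0.
Qed.

Lemma coordinate_eigenspaces (R : realType) (n : nat) (G L : 'M[R]_n) :
  G \in unitmx -> G^T = G -> L^T = L ->
  (forall i, exists a, (eigenspace (endo G L) a == (delta_mx 0 i : 'rV[R]_n))%MS) ->
  (forall i j, i != j -> G i j = 0 /\ L i j = 0) /\
  (forall i j, i != j -> L i i / G i i != L j j / G j j).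
Proof.
move=> uG sG sL /choice[a ha].
have La i l : L i l = a i * G i l.
  have /eqmxP e := ha i.
  have : ((delta_mx 0 i : 'rV[R]_n) <= eigenspace (endo G L) (a i))%MS by rewrite e.
  by move=> /(endo_eigenP _ _ _ uG)/rowP/(_ l); rewrite -!rowE !mxE.
have aneq i j : i != j -> a i != a j.
  move=> ij; apply/negP => /eqP e.
  have /eqmxP ei := ha i; have /eqmxP ej := ha j.
  have : ((delta_mx 0 i : 'rV[R]_n) <= (delta_mx 0 j : 'rV[R]_n))%MS.
    by rewrite -ej -e ei.
  by rewrite delta_sub_delta (negbTE ij).
have G0 i j : i != j -> G i j = 0.
  move=> ij; have /eqP : L i j = L j i by rewrite -{1}sL mxE.
  rewrite !La; have -> : G j i = G i j by rewrite -{1}sG mxE.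
  by rewrite -subr_eq0 -mulrBl mulf_eq0 subr_eq0 (negbTE (aneq _ _ ij)) => /eqP.
split=> i j ij; first by rewrite La G0 ?mulr0.
have Gii l : G l l != 0 by apply: unitmx_row_neq0 => // q ql; apply: G0; rewrite eq_sym.
by rewrite !La !mulfK // aneq.
Qed.

(** * Leaves *)

Section Leaves.
Variables (R : realType) (n k : nat) (blk : 'I_n -> 'I_k.+1) (a : 'I_k.+1).
Local Notation idx := (@block_index n k blk a).

Lemma block_index_blk i : blk (idx i) = a.
Proof. by have := enum_valP i; rewrite inE => /eqP. Qed.

Lemma block_index_inj : injective idx.
Proof. exact: enum_val_inj. Qed.

Lemma block_index_surj j : blk j = a -> exists i, idx i = j.
Proof.
move=> ja; have jb : j \in block blk a by rewrite inE ja.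
by exists (enum_rank_in jb j); rewrite /block_index enum_rankK_in.
Qed.

Lemma sum_block (F : 'I_n -> R) : \sum_(i | blk i == a) F i = \sum_i F (idx i).
Proof.
transitivity (\sum_(i in block blk a) F i); first by apply: eq_bigl => i; rewrite inE.
exact: (big_enum_val (fun i => F i)).
Qed.

Definition leaf_pick (j : 'I_n) : option 'I_#|block blk a| := [pick i | idx i == j].

Lemma leaf_pick_index i : leaf_pick (idx i) = Some i.
Proof.
rewrite /leaf_pick; case: pickP => [i' /eqP/block_index_inj ->//|/(_ i)].
by rewrite eqxx.
Qed.

Lemma leaf_pick_Some j i : leaf_pick j = Some i -> idx i = j.
Proof. by rewrite /leaf_pick; case: pickP => // i' /eqP e [<-]. Qed.

Lemma leaf_pick_inj i i' j : leaf_pick i = Some j -> leaf_pick i' = Some j -> i = i'.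
Proof. by move=> /leaf_pick_Some <- /leaf_pick_Some <-. Qed.

Lemma leaf_pick_out j : blk j != a -> leaf_pick j = None.
Proof.
move=> ja; rewrite /leaf_pick; case: pickP => // i /eqP e.
by move: ja; rewrite -e block_index_blk eqxx.
Qed.

Lemma leafE p (y : 'rV[R]_#|block blk a|) : leaf p y = subst leaf_pick p y.
Proof. by []. Qed.

Lemma leaf_leaf_point (p x : 'rV[R]_n) (j : 'I_n) :
  leaf p (leaf_point blk a x) 0 j = if blk j == a then x 0 j else p 0 j.
Proof.
rewrite leafE substE; case: eqP => [/block_index_surj[i <-]|/eqP/leaf_pick_out -> //].
by rewrite leaf_pick_index mxE.
Qed.

Lemma leaf_center (p : 'rV[R]_n) : leaf p (leaf_point blk a p) = p.
Proof. by apply/rowP => j; rewrite leaf_leaf_point; case: eqP. Qed.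

Lemma ball_leaf_point (p x : 'rV[R]_n) (r : R) :
  ball p r x -> ball (leaf_point blk a p) r (leaf_point blk a x).
Proof. by move=> /ball_rowP[r0 h]; apply/ball_rowP; split=> // i; rewrite !mxE. Qed.

Lemma ball_leaf (p : 'rV[R]_n) (y : 'rV[R]_#|block blk a|) (r : R) :
  ball (leaf_point blk a p) r y -> ball p r (leaf p y).
Proof.
move=> py; rewrite -{1}(leaf_center p) !leafE; exact: ball_subst.
Qed.

Lemma leaf_partial (p : 'rV[R]_n) (f : 'rV[R]_n -> R) (i : 'I_#|block blk a|) :
  partial i (fun y => f (leaf p y)) = fun y => partial (idx i) f (leaf p y).
Proof.
apply/funext => y.
exact: (@partial_subst R _ n _ p leaf_pick_inj f y _ _ (leaf_pick_index i)).
Qed.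

Lemma leaf_restr_unit (p : 'rV[R]_n) (g : 'rV[R]_n -> 'M[R]_n) y :
  g (leaf p y) \in unitmx ->
  (forall i j, blk i != blk j -> g (leaf p y) i j = 0) ->
  @leaf_restr R n k blk a p g y \in unitmx.
Proof.
move=> uG cr; apply: unitmx_kernel => u h.
(* Extended by zero, a kernel vector of the restriction is one of the full metric, which is block
   diagonal. *)
pose v : 'rV[R]_n := \row_j (if leaf_pick j is Some i then u i else 0).
suff v0 : v = 0.
  by move=> i; move/rowP: v0 => /(_ (idx i)); rewrite !mxE leaf_pick_index.
rewrite -[v](mulmxK uG); suff -> : v *m g (leaf p y) = 0 by rewrite mul0mx.
apply/rowP => j; rewrite !mxE.
rewrite (bigID (fun i => blk i == a)) /= [X in _ + X]big1 ?addr0 => [|i ia]; last first.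
  by rewrite !mxE leaf_pick_out // mul0r.
rewrite sum_block.
have [/block_index_surj[j' <-]|ja] := eqVneq (blk j) a.
  rewrite -[RHS](h j'); apply: eq_bigr => i _.
  by rewrite !mxE leaf_pick_index.
by rewrite big1 // => i _; rewrite cr ?mulr0 // block_index_blk eq_sym.
Qed.

Lemma leaf_restr_pseudo (p : 'rV[R]_n) (r : R) (g : 'rV[R]_n -> 'M[R]_n) :
  pseudo_riemannian (ball p r) g ->
  (forall x, ball p r x -> forall i j, blk i != blk j -> g x i j = 0) ->
  pseudo_riemannian (ball (leaf_point blk a p) r) (@leaf_restr R n k blk a p g).
Proof.
move=> gP cr; split; first split.
- move=> i j; apply: (@eq_smooth _ _ _ ((fun x => g x (idx i) (idx j)) \o subst leaf_pick p)).
  + exact: ball_open.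
  + by move=> y _; rewrite /= mxE.
  apply: (smooth_subst leaf_pick_inj (ball_open _ _)); last exact: (metric_smooth gP).
  by move=> y /ball_leaf.
- move=> y /ball_leaf yb; apply/matrixP => i j; rewrite !mxE.
  exact: (metricC gP _ _ yb).
- move=> y /ball_leaf yb; apply: leaf_restr_unit; first exact: (metric_unit gP).
  exact: cr.
Qed.

End Leaves.

(** * The block of simple eigenvalues, off the leaf through the centre *)

Section AdaptedBlock.
Variables (R : realType) (n k : nat) (p : 'rV[R]_n) (r : R).
Variables (g L : 'rV[R]_n -> 'M[R]_n) (blk : 'I_n -> 'I_k.+1).
Hypotheses (r0 : 0 < r) (gP : pseudo_riemannian (ball p r) g).
Hypotheses (LP : orthogonal_concircular (ball p r) g L).
Hypotheses (AP : associated_product (ball p r) g L blk).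
Hypotheses (AD : adapted_coordinates (ball p r) g L blk p).

Let oB : open (ball p r : set 'rV[R]_n) := ball_open p r.
Let Bp : (ball p r : set 'rV[R]_n) p := ballxx p r0.

(* The adapted coordinates are only prescribed on the leaf through [p]; the
   components of [g] and [L] along F_0 do not vary transversally to it. *)
Lemma block0_transport x i j : ball p r x -> blk i = ord0 -> blk j = ord0 ->
  g x i j = g (leaf p (leaf_point blk ord0 x)) i j /\
  L x i j = L (leaf p (leaf_point blk ord0 x)) i j.
Proof.
move=> Bx i0 j0.
have [c cP] := block_constants AP.
have [[_ [alpha [_ alphaP]]] _] := LP.
have Bl : ball p r (leaf p (leaf_point blk ord0 x)) by exact/ball_leaf/ball_leaf_point.
split.
  apply: (partial0_eq [pred m | blk m != ord0] (fun z => g z i j) p r) => //.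
- by move=> m _ z Bz; exact: (smooth_derivable _ (metric_smooth gP i j) Bz).
- move=> m /= m0 z Bz.
  by apply: (partial_block_g oB Bp gP LP AP cP alphaP Bz m0); rewrite ?i0 ?j0 eq_sym.
- by move=> m; rewrite inE negbK => m0; rewrite leaf_leaf_point m0.
apply: (partial0_eq [pred m | blk m != ord0] (fun z => L z i j) p r) => //.
- by move=> m _ z Bz; exact: (smooth_derivable _ (concircular_smooth LP i j) Bz).
- move=> m /= m0 z Bz.
  by apply: (partial_block_L oB Bp gP LP AP cP alphaP Bz m0); rewrite ?i0 ?j0 eq_sym.
- by move=> m; rewrite inE negbK => m0; rewrite leaf_leaf_point m0.
Qed.

Lemma block0_diagonal x i j : ball p r x -> blk i = ord0 -> blk j = ord0 -> i != j ->
  [/\ g x i j = 0, L x i j = 0 & L x i i / g x i i != L x j j / g x j j].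
Proof.
move=> Bx i0 j0 ij.
have [c cP] := block_constants AP.
have [-> ->] := block0_transport Bx i0 j0.
have [-> ->] := block0_transport Bx i0 i0.
have [-> ->] := block0_transport Bx j0 j0.
set y := leaf_point blk ord0 x.
have Bl : ball p r (leaf p y) by exact/ball_leaf/ball_leaf_point.
have uG : leaf_restr p g y \in unitmx.
  apply: leaf_restr_unit; first exact: (metric_unit gP).
  by move=> i' j' ij'; apply: (block_orthogonal Bp gP LP AP cP).
have sG : (leaf_restr p g y)^T = leaf_restr p g y.
  by apply/matrixP => i' j'; rewrite !mxE (metricC gP _ _ Bl).
have sL : (leaf_restr p L y)^T = leaf_restr p L y.
  by apply/matrixP => i' j'; rewrite !mxE (concircular_sym LP _ _ Bl).
have [h1 h2] := coordinate_eigenspaces uG sG sL (AD Bl).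
have [i' ei] := block_index_surj i0; have [j' ej] := block_index_surj j0.
have ij' : i' != j' by apply: contra_neq ij => e; rewrite -ei -ej e.
have [] := h1 _ _ ij'; have := h2 _ _ ij'.
by rewrite !mxE ei ej => *; split.
Qed.

Lemma block0_neq0 x i : ball p r x -> blk i = ord0 -> g x i i != 0.
Proof.
move=> Bx i0; have [c cP] := block_constants AP.
apply: unitmx_row_neq0; first exact: (metric_unit gP).
move=> j ji; have [j0|j0] := eqVneq (blk j) ord0.
  by have [] := block0_diagonal Bx i0 j0; rewrite 1?eq_sym.
by apply: (block_orthogonal Bp gP LP AP cP) => //; rewrite i0 eq_sym.
Qed.

End AdaptedBlock.

(** * Lagrange interpolation *)

Section Lagrange.
Variables (F : fieldType) (I : finType) (A : pred I).

Definition nodal (lam : I -> F) (i : I) : {poly F} :=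
  \prod_(l | A l && (l != i)) ('X - (lam l)%:P).

Lemma card_nodal i : A i -> #|[pred l | A l && (l != i)]| = #|A|.-1.
Proof.
move=> Ai; rewrite [in RHS](cardD1 i) unfold_in /= Ai /=.
by apply: eq_card => l; rewrite !inE andbC.
Qed.

Lemma size_nodal lam i : A i -> size (nodal lam i) = #|A|.
Proof.
move=> Ai; rewrite /nodal.
transitivity (size (\prod_(l <- enum [pred l | A l && (l != i)]) ('X - (lam l)%:P))).
  by rewrite big_enum_cond /=; congr (size (polyseq _)); apply: eq_bigl => l; rewrite andbT.
rewrite size_prod_XsubC -cardE.
by rewrite card_nodal // prednK //; apply/card_gt0P; exists i.
Qed.

Lemma monic_nodal lam i : nodal lam i \is monic.
Proof. by apply: monic_prod => l _; exact: monicXsubC. Qed.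

Lemma horner_nodal lam i x : (nodal lam i).[x] = \prod_(l | A l && (l != i)) (x - lam l).
Proof. by rewrite horner_prod; apply: eq_bigr => l _; rewrite !hornerE. Qed.

Lemma coef_nodal lam i : A i -> (nodal lam i)`_(#|A|.-1) = 1.
Proof.
by move=> Ai; have /monicP := monic_nodal lam i; rewrite /lead_coef size_nodal.
Qed.

Variable lam : I -> F.
Hypothesis lam_inj : forall i j, A i -> A j -> i != j -> lam i != lam j.

Lemma nodal_neq0 i : A i -> \prod_(l | A l && (l != i)) (lam i - lam l) != 0.
Proof.
move=> Ai; apply/prodf_neq0 => l /andP[Al li].
by rewrite subr_eq0 lam_inj // eq_sym.
Qed.

(** The difference of the two sides has degree below the number of nodes, yet vanishes at all of
    them. *)
Lemma lagrange_interpolation (P : {poly F}) : (size P <= #|A|)%N ->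
  P = \sum_(i | A i) (P.[lam i] / \prod_(l | A l && (l != i)) (lam i - lam l)) *: nodal lam i.
Proof.
move=> sP; apply/eqP; rewrite -subr_eq0; set Q := _ - _.
apply/negPn/negP => Q0.
have rQ : all (root Q) [seq lam i | i <- enum A].
  apply/allP => _ /mapP[i + ->]; rewrite mem_enum unfold_in => Ai.
  rewrite rootE /Q hornerD hornerN horner_sum.
  rewrite [\sum_(l | A l) _](bigD1 i Ai) /= [X in _ - (_ + X)]big1 => [|l /andP[Al li]].
    by rewrite addr0 hornerZ horner_nodal divfK ?nodal_neq0 // subrr.
  have Pi : A i && (i != l) by rewrite Ai eq_sym.
  by rewrite hornerZ horner_nodal [X in _ * X](bigD1 i Pi) /= subrr mul0r mulr0.
have uQ : uniq [seq lam i | i <- enum A].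
  rewrite map_inj_in_uniq ?enum_uniq // => i j.
  rewrite !mem_enum !unfold_in => Ai Aj e; apply/eqP/negPn/negP => ij.
  by have := lam_inj Ai Aj ij; rewrite e eqxx.
have := max_poly_roots Q0 rQ uQ; rewrite size_map -cardE ltnNge => /negP; apply.
apply: leq_trans (size_polyD _ _) _; rewrite geq_max sP size_polyN.
apply: leq_trans (size_sum _ _ _) _; apply/bigmax_leqP => i Ai.
by apply: leq_trans (size_scale_leq _ _) _; rewrite size_nodal.
Qed.

(** Compares the coefficients of top degree in the interpolation formula, whose nodal polynomials
    are monic of the same degree. *)
Lemma lagrange_monic (P : {poly F}) : P \is monic -> size P = #|A| ->
  \sum_(i | A i) P.[lam i] / \prod_(l | A l && (l != i)) (lam i - lam l) = 1.
Proof.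
move=> /monicP + sP; rewrite /lead_coef sP => mP.
have sP' : (size P <= #|A|)%N by rewrite sP.
have := congr1 (fun Q : {poly F} => Q`_(#|A|.-1)) (lagrange_interpolation sP').
rewrite coef_sum mP => e; rewrite [RHS]e.
by apply: eq_bigr => i Ai; rewrite coefZ coef_nodal // mulr1.
Qed.

(** Interpolates the constant 1 and evaluates at [x]. This is what makes the contribution of M_0 to
    a column cancel that of another factor. *)
Lemma lagrange_inverse (x : F) : (0 < #|A|)%N -> (forall i, A i -> x != lam i) ->
  \sum_(i | A i) ((lam i - x) * \prod_(l | A l && (l != i)) (lam i - lam l))^-1 =
  - (\prod_(i | A i) (x - lam i))^-1.
Proof.
move=> A0 xlam.
have N0 : \prod_(i | A i) (x - lam i) != 0.
  by apply/prodf_neq0 => i Ai; rewrite subr_eq0 xlam.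
apply: (mulfI N0); rewrite mulrN mulfV // mulr_sumr.
have s1 : (size (1%:P : {poly F}) <= #|A|)%N by rewrite size_polyC oner_eq0.
have := congr1 (fun P => P.[x]) (lagrange_interpolation s1).
rewrite hornerC horner_sum => e.
rewrite [X in _ = - X]e -sumrN; apply: eq_bigr => i Ai.
have xi : x - lam i != 0 by rewrite subr_eq0 xlam.
rewrite hornerZ horner_nodal hornerC mul1r [X in X * _](bigD1 i Ai) /=.
have Q0 := nodal_neq0 Ai; have xi' : lam i - x != 0 by rewrite -opprB oppr_eq0.
move: (\prod_(_ | _) _) Q0 (\prod_(_ | _) _) => Q Q0 M.
by field; rewrite xi' Q0.
Qed.

End Lagrange.

(** * Staeckel matrices of the leaves *)

Section BlockStaeckel.
Variables (R : realType) (n k : nat) (g : 'rV[R]_n -> 'M[R]_n) (p : 'rV[R]_n).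
Variables (blk : 'I_n -> 'I_k.+1) (a : 'I_k.+1).
Local Notation idx := (@block_index n k blk a).

(* [staeckel] for the metric of a leaf, written with the indices of the
   ambient coordinates. *)
Record block_staeckel (r : R) (S : 'I_n -> 'I_n -> R -> R) (eps : 'I_n -> R) : Prop :=
  BlockStaeckel {
  block_staeckel_gt0 : 0 < r;
  block_staeckel_diag : forall x, ball p r x -> forall i j, blk i = a -> blk j = a ->
    i != j -> g (leaf p (leaf_point blk a x)) i j = 0;
  block_staeckel_smooth : forall i j, blk i = a -> blk j = a ->
    smooth_on (ball p r) (fun x : 'rV[R]_n => S i j (x 0 i));
  block_staeckel_sum : forall x, ball p r x -> forall j, blk j = a ->
    \sum_(i | blk i == a) S i j (x 0 i) / g (leaf p (leaf_point blk a x)) i i = eps j;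
  block_staeckel_nonsing : forall u : 'I_n -> R,
    (forall j, blk j = a -> \sum_(i | blk i == a) u i * S i j (p 0 i) = 0) ->
    forall i, blk i = a -> u i = 0 }.

Lemma staeckel_block (r : R) S eps :
  staeckel (@leaf_restr R n k blk a p g) (leaf_point blk a p) r S eps ->
  exists S' eps', block_staeckel r S' eps'.
Proof.
case=> r0 dg _ sS sumS nsS.
(* The default 0 is arbitrary: [block_staeckel] reads only indices of the block. *)
pose S' i j : R -> R := match @leaf_pick n k blk a i, @leaf_pick n k blk a j with
  | Some i', Some j' => S i' j' | _, _ => fun=> 0 end.
pose eps' j : R := if @leaf_pick n k blk a j is Some j' then eps j' else 0.
have S'E i j : S' (idx i) (idx j) = S i j by rewrite /S' !leaf_pick_index.
have gE x i j : g (leaf p (leaf_point blk a x)) (idx i) (idx j) =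
    leaf_restr p g (leaf_point blk a x) i j by rewrite mxE.
exists S', eps'; split=> //.
- move=> x px _ _ /block_index_surj[i <-] /block_index_surj[j <-] ij.
  rewrite gE dg //; first exact: ball_leaf_point.
  by apply: contra_neq ij => ->.
- move=> _ _ /block_index_surj[i <-] /block_index_surj[j <-]; rewrite S'E.
  pose s (l : 'I_#|block blk a|) := Some (idx l).
  have s_inj i1 i2 l : s i1 = Some l -> s i2 = Some l -> i1 = i2.
    by move=> h1 h2; apply: (@block_index_inj n k blk a); apply: Some_inj; rewrite -/(s i1) -/(s i2) h1 h2.
  have e (x : 'rV[R]_n) : subst s (leaf_point blk a p) x = leaf_point blk a x.
    by apply/rowP => l; rewrite !mxE.
  apply: (eq_smooth ((fun y : 'rV[R]__ => S i j (y 0 i)) \o subst s (leaf_point blk a p))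
    (ball_open p r)).
    by move=> x _; rewrite /= e mxE.
  apply: (smooth_subst s_inj (ball_open p r)); last exact: (sS i j).
  by move=> x px; rewrite e; exact: ball_leaf_point.
- move=> x px _ /block_index_surj[j <-]; rewrite sum_block /eps' leaf_pick_index.
  rewrite -(sumS (leaf_point blk a x) _ j); last exact: ball_leaf_point.
  by apply: eq_bigr => i _; rewrite S'E gE [leaf_point blk a x 0 i]mxE.
- move=> u h _ /block_index_surj[i <-].
  apply: (nsS (fun i => u (idx i))) => j.
  rewrite -[RHS](h (idx j) (block_index_blk j)) sum_block.
  by apply: eq_bigr => i' _; rewrite S'E [leaf_point blk a p 0 i']mxE.
Qed.

End BlockStaeckel.

(** * Separation by the eigenfunctions *)

Section LogDerivative.
Variables (R : realType) (n : nat).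
Implicit Types (g : 'rV[R]_n -> 'M[R]_n) (p : 'rV[R]_n).

Definition dlog g p (i j : 'I_n) : R := partial j (fun y => g y i i) p / g p i i.

(* With f_i = log |g_ii|, the first equation says d_j d_k f_i = 0 and the second
   d_j f_i d_k f_i = d_j f_i d_k f_j + d_k f_i d_j f_k; together these are
   diagonal curvature and the Levi-Civita equation for distinct i, j, k. *)
Definition diagonal_curvature_at g p : Prop :=
  forall i j k : 'I_n, i != j -> i != k -> j != k ->
    g p i i * partial k (partial j (fun y => g y i i)) p =
      partial k (fun y => g y i i) p * partial j (fun y => g y i i) p /\
    dlog g p i j * dlog g p i k =
      dlog g p i j * dlog g p j k + dlog g p i k * dlog g p k j.

End LogDerivative.

Section LeafCurvature.
Variables (R : realType) (n k : nat) (g : 'rV[R]_n -> 'M[R]_n) (p : 'rV[R]_n).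
Variables (blk : 'I_n -> 'I_k.+1) (a : 'I_k.+1).
Local Notation idx := (@block_index n k blk a).

Lemma leaf_curvature (i j l : 'I_#|block blk a|) :
  diagonal_curvature_at (@leaf_restr R n k blk a p g) (leaf_point blk a p) ->
  i != j -> i != l -> j != l ->
  let i' := idx i in let j' := idx j in let l' := idx l in
  g p i' i' * partial l' (partial j' (fun y => g y i' i')) p =
      partial l' (fun y => g y i' i') p * partial j' (fun y => g y i' i') p /\
  dlog g p i' j' * dlog g p i' l' =
      dlog g p i' j' * dlog g p j' l' + dlog g p i' l' * dlog g p l' j'.
Proof.
move=> h ij il jl i' j' l'.
have e (m : 'I_#|block blk a|) : (fun y => @leaf_restr R n k blk a p g y m m) =
    (fun y => g (leaf p y) (idx m) (idx m)).
  by apply/funext => y; rewrite mxE.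
have gE (m : 'I_#|block blk a|) : @leaf_restr R n k blk a p g (leaf_point blk a p) m m =
    g p (idx m) (idx m) by rewrite mxE leaf_center.
have dE (m m' : 'I_#|block blk a|) : dlog (@leaf_restr R n k blk a p g) (leaf_point blk a p) m m' =
    dlog g p (idx m) (idx m').
  by rewrite /dlog gE e (leaf_partial p (fun y => g y _ _)) leaf_center.
have [] := h i j l ij il jl; rewrite !dE gE e !(leaf_partial p (fun y => g y _ _)).
by rewrite (leaf_partial p (partial j' (fun y => g y i' i'))) leaf_center.
Qed.

End LeafCurvature.

(** * The concircular equation in the product coordinates *)

Section KEMStep.
Variables (R : realType) (n k : nat) (p : 'rV[R]_n) (r : R).
Variables (g L : 'rV[R]_n -> 'M[R]_n) (blk : 'I_n -> 'I_k.+1).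
Hypotheses (r0 : 0 < r) (gP : pseudo_riemannian (ball p r) g).
Hypotheses (LP : orthogonal_concircular (ball p r) g L).
Hypotheses (AP : associated_product (ball p r) g L blk).
Hypotheses (AD : adapted_coordinates (ball p r) g L blk p).
Variable c : 'I_k.+1 -> R.
Hypothesis cP : forall a, a != ord0 -> forall x : 'rV[R]_n, ball p r x ->
  (eigenspace (endo (g x) (L x)) (c a) == block_space R blk a)%MS.
Variable alpha : 'rV[R]_n -> 'rV[R]_n.
Hypothesis alphaP : forall x : 'rV[R]_n, ball p r x -> forall i j l : 'I_n,
  nabla g L l i j x = 2^-1 * (alpha x 0 i * g x j l + alpha x 0 j * g x i l).

Let B : set 'rV[R]_n := ball p r.
Let oB : open B := ball_open p r.
Let Bp : B p := ballxx p r0.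

(* [sep i j]: x_i and x_j belong to different eigenspaces of L. *)
Definition sep (i j : 'I_n) : bool :=
  (i != j) && ((blk i != blk j) || (blk i == ord0)).

Lemma sepC i j : sep i j = sep j i.
Proof.
rewrite /sep eq_sym; case: eqVneq => //= _.
by rewrite [blk j == blk i]eq_sym; case: (eqVneq (blk i) (blk j)) => [->|].
Qed.

Lemma sep_neq i j : sep i j -> i != j.
Proof. by case/andP. Qed.

Lemma sep_block0 l i : blk l = ord0 -> l != i -> sep l i.
Proof. by move=> l0 li; rewrite /sep li l0 eqxx orbT. Qed.

Lemma sep_block l i : blk l != blk i -> sep l i.
Proof. by move=> li; rewrite /sep li /= andbT; apply: contra_neq li => ->. Qed.

(** Distinct coordinates that are not separated share a multidimensional eigenspace, and separation
    depends on the eigenspaces alone. *)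
Lemma sep_congr i j l : ~~ sep i j -> i != j -> sep l i -> sep l j.
Proof.
rewrite /sep => + ij; rewrite ij /= negb_or negbK => /andP[/eqP e i0] /andP[li h].
have bl : blk l != blk i.
  by case/orP: h => // /eqP ->; rewrite eq_sym.
by rewrite -e bl /= andbT; apply: contra_neq bl => ->.
Qed.

Definition Lam (i : 'I_n) (x : 'rV[R]_n) : R :=
  if blk i == ord0 then L x i i / g x i i else c (blk i).

Lemma g_smooth i j : smooth_on B (fun x => g x i j).
Proof. exact: (metric_smooth gP). Qed.

Lemma Lam_smooth i : smooth_on B (Lam i).
Proof.
rewrite /Lam; case: (eqVneq (blk i) ord0) => i0; last exact: smooth_cst.
apply: (smoothM oB); first exact: (concircular_smooth LP).
apply: (smoothV oB); last exact: g_smooth.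
by move=> x Bx; exact: (block0_neq0 r0 gP LP AP AD Bx i0).
Qed.

Lemma block_neq_g0 x i j : B x -> blk i != blk j -> g x i j = 0.
Proof. exact: (block_orthogonal Bp gP LP AP cP). Qed.

Lemma sep_g0 x i j : B x -> sep i j -> g x i j = 0.
Proof.
move=> Bx; case: (eqVneq (blk i) (blk j)) => [e|]; last by move=> ij _; exact: block_neq_g0.
rewrite /sep e eqxx => /andP[ij /eqP j0].
by have [] := block0_diagonal r0 gP LP AP AD Bx (etrans e j0) j0 ij.
Qed.

Lemma LamE x i j : B x -> L x i j = Lam i x * g x i j.
Proof.
move=> Bx; rewrite /Lam; case: (eqVneq (blk i) ord0) => i0; last first.
  exact: (block_row gP cP).
case: (eqVneq i j) => [<-|ij].
  by rewrite divfK // (block0_neq0 r0 gP LP AP AD Bx i0).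
case: (eqVneq (blk j) ord0) => j0.
  by have [-> -> _] := block0_diagonal r0 gP LP AP AD Bx i0 j0 ij; rewrite mulr0.
have bij : blk i != blk j by rewrite i0 eq_sym.
by rewrite (block_neq_g0 Bx bij) (block_orthogonal_L Bp gP LP AP cP Bx bij) mulr0.
Qed.

Lemma sep_Lam x i j : B x -> sep i j -> Lam i x != Lam j x.
Proof.
move=> Bx; wlog i0 : i j / (blk i == ord0) || (blk j != ord0) => [W ij|].
  case: (boolP ((blk i == ord0) || (blk j != ord0))) => [h|]; first exact: W.
  rewrite negb_or negbK => /andP[_ j0].
  by rewrite eq_sym; apply: W; [rewrite j0|rewrite sepC].
move=> ij; have [j0|j0] := eqVneq (blk j) ord0.
  rewrite j0 eqxx orbF in i0; rewrite /Lam i0 j0 eqxx.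
  by have [] := block0_diagonal r0 gP LP AP AD Bx (eqP i0) j0 (sep_neq ij).
have bij : blk i != blk j.
  by move: ij; rewrite /sep => /andP[_]; case/orP => // /eqP ->; rewrite eq_sym.
case: (eqVneq (blk i) ord0) => bi0; last first.
  rewrite /Lam (negbTE bi0) (negbTE j0); exact: (block_constant_neq Bp cP).
(* With equal eigenvalues [d_i] would be an eigenvector for [c (blk j)], hence tangent to the block
   of [j]. *)
apply/negP => /eqP e.
have := eigen_block gP cP j0 Bx (v := delta_mx 0 i).
rewrite -!rowE => h.
have /h/(_ i bij) : row i (L x) = c (blk j) *: row i (g x).
  apply/rowP => l; rewrite !mxE LamE // e.
  by rewrite /Lam (negbTE j0).
by rewrite delta_entry eqxx => /eqP; rewrite oner_eq0.
Qed.

Lemma sep_partial0 x l i j : B x -> sep i j -> partial l (fun y => g y i j) x = 0.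
Proof.
move=> Bx ij; have e : {in B, (fun y => g y i j) =1 (fun=> 0)}.
  by move=> y; rewrite inE => By; rewrite sep_g0.
by rewrite (@eq_partial_on R _ B _ _ l oB e x (mem_set Bx)) /partial derive_cst.
Qed.

(** Since [L_ij = Lam_i g_ij], metric compatibility reduces the covariant derivative of [L] to the
    left side. The relations between [Lam], [alpha] and [g] below are specializations of the
    indices. *)
Lemma concircular_master x i j l : B x ->
  partial l (Lam i) x * g x i j + (Lam i x - Lam j x) * gam g j l i x =
  2^-1 * (alpha x 0 i * g x j l + alpha x 0 j * g x i l).
Proof.
move=> Bx; rewrite -alphaP // /nabla.
have eL : {in B, (fun y => L y i j) =1 (fun y => Lam i y * g y i j)}.
  by move=> y; rewrite inE; exact: LamE.
rewrite (@eq_partial_on R _ B _ _ l oB eL x (mem_set Bx)).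
have -> : partial l (fun y => Lam i y * g y i j) x =
    Lam i x * partial l (fun y => g y i j) x + g x i j * partial l (Lam i) x.
  by rewrite /partial deriveM //; [exact: (smooth_derivable _ (Lam_smooth i) Bx)|
    exact: (smooth_derivable _ (g_smooth i j) Bx)].
rewrite (gam_compat oB gP l i j Bx) (christoffel_eigenrow gP l j Bx (fun m => LamE i m Bx)).
have -> : \sum_m christoffel g m l i x * L x m j = Lam j x * gam g j l i x.
  rewrite -(christoffel_eigenrow gP l i Bx (fun m => LamE j m Bx)).
  by apply: eq_bigr => m _; rewrite (concircular_sym LP).
by ring.
Qed.

Lemma g_diag_neq0 x i : B x -> blk i = ord0 -> g x i i != 0.
Proof. by move=> Bx; exact: (block0_neq0 r0 gP LP AP AD Bx). Qed.

Lemma Lam_block_cst i (x y : 'rV[R]_n) : blk i != ord0 -> Lam i x = Lam i y.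
Proof. by move=> i0; rewrite /Lam (negbTE i0). Qed.

Lemma partial_Lam_block x i l : blk i != ord0 -> partial l (Lam i) x = 0.
Proof. by move=> i0; apply: partial_upd_cst => t; exact: Lam_block_cst. Qed.

Lemma alpha_Lam x i : B x -> alpha x 0 i = partial i (Lam i) x.
Proof.
move=> Bx; have [i0|i0] := eqVneq (blk i) ord0; last first.
  by rewrite partial_Lam_block // (block_alpha0 oB gP LP cP alphaP Bx i0).
have := concircular_master i i i Bx; rewrite subrr mul0r addr0.
have -> : 2^-1 * (alpha x 0 i * g x i i + alpha x 0 i * g x i i) = alpha x 0 i * g x i i by field.
by move=> /(mulIf (g_diag_neq0 Bx i0)).
Qed.

Lemma partial_Lam0 x i l : B x -> l != i -> partial l (Lam i) x = 0.
Proof.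
move=> Bx li; have [i0|i0] := eqVneq (blk i) ord0; last exact: partial_Lam_block.
have gil : g x i l = 0 by apply: sep_g0 => //; rewrite sep_block0 // eq_sym.
have := concircular_master i i l Bx; rewrite subrr mul0r addr0 gil !mulr0 addr0 mulr0.
by move/eqP; rewrite mulf_eq0 (negbTE (g_diag_neq0 Bx i0)) orbF => /eqP.
Qed.

(** The master identity with the separated index [l] in the middle: [g_il] and [g_jl] vanish
    identically, so its Christoffel symbol is [- d_l g_ij / 2]. Here [i] and [j] may be distinct
    members of one block. *)
Lemma partial_sep x l i j : B x -> sep l i -> sep l j ->
  (Lam l x - Lam i x) * partial l (fun y => g y i j) x = partial l (Lam l) x * g x i j.
Proof.
move=> Bx li lj.
have := concircular_master i l j Bx.
rewrite -(alpha_Lam l Bx) /gam.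
have sil : sep i l by rewrite sepC.
have sjl : sep j l by rewrite sepC.
rewrite (sep_g0 Bx sil) (sep_g0 Bx lj) (sep_partial0 j Bx sil) (sep_partial0 i Bx sjl).
rewrite (partial_metric_sym oB gP l j i Bx).
set D := partial l _ x; set A := Lam i x; set C := Lam l x.
by move=> h; lra.
Qed.

Lemma sep_dlog x l i : B x -> sep l i ->
  partial l (fun y => g y i i) x = partial l (Lam l) x / (Lam l x - Lam i x) * g x i i.
Proof.
move=> Bx li; have d0 : Lam l x - Lam i x != 0 by rewrite subr_eq0 sep_Lam.
by rewrite mulrAC -(partial_sep Bx li li) mulrC mulKf.
Qed.

Lemma Lam_upd x l i t : B x -> `|p 0 l - t| < r -> l != i -> Lam i (upd x l t) = Lam i x.
Proof.
move=> Bx pt li; apply: (partial0_upd _ _ Bx pt) => y By.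
  exact: (smooth_derivable _ (Lam_smooth i) By).
exact: partial_Lam0.
Qed.

(* d_l (g_ij / (Lam_i - Lam_l)) = 0 *)
Lemma sep_quotient_upd x l i j t : B x -> `|p 0 l - t| < r -> sep l i -> sep l j ->
  g (upd x l t) i j / (Lam i (upd x l t) - Lam l (upd x l t)) =
  g x i j / (Lam i x - Lam l x).
Proof.
move=> Bx pt li lj.
have nz y : B y -> Lam i y - Lam l y != 0 by move=> By; rewrite subr_eq0 eq_sym sep_Lam.
have dif y : B y -> derivable (fun y => Lam i y - Lam l y) y (delta_mx 0 l).
  by move=> By; exact: (smooth_derivable _ (smoothB oB (Lam_smooth i) (Lam_smooth l)) By).
have dV y : B y -> derivable (fun y => (Lam i y - Lam l y)^-1) y (delta_mx 0 l).
  by move=> By; apply: derivableV; [exact: nz|exact: dif].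
have dg y : B y -> derivable (fun y => g y i j) y (delta_mx 0 l).
  by move=> By; exact: (smooth_derivable _ (g_smooth i j) By).
apply: (@partial0_upd R n (fun y => g y i j / (Lam i y - Lam l y)) p r x l t _ _ Bx pt) => y By.
  by apply: derivableM; [exact: dg|exact: dV].
rewrite /partial deriveM; [|exact: dg|exact: dV].
rewrite deriveV; [|exact: nz|exact: dif].
rewrite deriveB; last 2 first.
- exact: (smooth_derivable _ (Lam_smooth i) By).
- exact: (smooth_derivable _ (Lam_smooth l) By).
have := partial_Lam0 By (sep_neq li); rewrite /partial => ->.
have := partial_sep By li lj; rewrite /partial.
have := nz y By.
rewrite /GRing.scale /=.
set A := Lam i y; set C := Lam l y; set D := derive _ _ _; set E := derive _ _ _.
move=> h e.
have -> : g y i j * (- (A - C) ^- 2 * (0 - E)) + (A - C)^-1 * D =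
  ((E * g y i j) + (A - C) * D) / (A - C) ^+ 2 by field.
have -> : E * g y i j + (A - C) * D = 0 by rewrite -e; ring.
by rewrite mul0r.
Qed.

Definition sigma (i : 'I_n) (x : 'rV[R]_n) : R :=
  \prod_(l | (blk l == ord0) && (l != i)) (Lam i x - Lam l x).

Lemma sigma_neq0 i x : B x -> sigma i x != 0.
Proof.
move=> Bx; apply/prodf_neq0 => l /andP[/eqP l0 li].
by rewrite subr_eq0 eq_sym sep_Lam // sep_block0.
Qed.

Lemma sigma_smooth i : smooth_on B (sigma i).
Proof.
by apply: (@smooth_prod R n _ _ _ B (fun l x => Lam i x - Lam l x) oB) => l _;
  exact: (smoothB oB (Lam_smooth i) (Lam_smooth l)).
Qed.

(** If [l] is in block 0, then [Lam_i - Lam_l] is the only factor of [sigma_i] that feels [x_l], and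
    [sep_quotient_upd] compensates it. Otherwise [Lam_l] is constant and neither [sigma_i] nor
    [g_ij] changes. *)
Lemma quotient_sigma_upd x l i j t : B x -> `|p 0 l - t| < r -> sep l i -> sep l j ->
  g (upd x l t) i j / sigma i (upd x l t) = g x i j / sigma i x.
Proof.
move=> Bx pt li lj.
have Bu : B (upd x l t) by exact: ball_upd.
have q := sep_quotient_upd Bx pt li lj.
have eLi : Lam i (upd x l t) = Lam i x by exact: Lam_upd (sep_neq li).
have eL m : m != l -> Lam m (upd x l t) = Lam m x.
  by move=> ml; apply: Lam_upd => //; rewrite eq_sym.
have nz y : B y -> Lam i y - Lam l y != 0 by move=> By; rewrite subr_eq0 eq_sym sep_Lam.
have [l0|l0] := eqVneq (blk l) ord0.
  have Pl : (blk l == ord0) && (l != i) by rewrite l0 eqxx (sep_neq li).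
  rewrite /sigma !(bigD1 l Pl) /= !invfM !mulrA q; congr (_ / _).
  by apply: eq_bigr => m /andP[/andP[_ mi] ml]; rewrite eLi eL.
have -> : sigma i (upd x l t) = sigma i x.
  apply: eq_bigr => m /andP[/eqP m0 mi]; rewrite eLi eL //.
  by apply: contra_neq l0 => <-.
congr (_ / _); move: q; rewrite eLi (Lam_block_cst (upd x l t) x l0).
by move/(mulIf (invr_neq0 (nz x Bx))).
Qed.

Lemma quotient_sigma_eq i j x y : B x -> B y -> (i == j) || ~~ sep i j ->
  (forall l, ~~ sep l i -> x 0 l = y 0 l) ->
  g x i j / sigma i x = g y i j / sigma i y.
Proof.
move=> Bx By ij xy.
apply: (upd_invariant_eq [pred l | sep l i] (fun x => g x i j / sigma i x) p r) => //.
move=> l /= li z t Bz pt; apply: quotient_sigma_upd => //.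
case: (eqVneq i j) ij => [<- //|neq /= nij].
exact: sep_congr li.
Qed.

Lemma Lam_eq i x y : B x -> B y -> x 0 i = y 0 i -> Lam i x = Lam i y.
Proof.
move=> Bx By xy.
apply: (upd_invariant_eq [pred l | l != i] (Lam i) p r) => //.
  by move=> l /= li z t Bz pt; exact: Lam_upd.
by move=> l; rewrite inE negbK => /eqP ->.
Qed.

Lemma block_not_sep i j : blk i = blk j -> blk i != ord0 -> ~~ sep i j.
Proof. by move=> ij i0; rewrite /sep -ij eqxx (negbTE i0) andbF. Qed.

Lemma partial2_Lam x i j : B x -> i != j -> partial j (partial i (Lam i)) x = 0.
Proof.
move=> Bx ij; rewrite (partialC _ _ oB (Lam_smooth i) Bx).
have e : {in B, partial j (Lam i) =1 (fun=> 0)}.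
  by move=> y; rewrite inE => By; rewrite partial_Lam0 // eq_sym.
by rewrite (@eq_partial_on R _ B _ _ i oB e x (mem_set Bx)) /partial derive_cst.
Qed.

(** The logarithmic derivative [b] of [g_ii] along [x_l] is built from [Lam_l] and [Lam_i], hence
    independent of [x_j]. *)
Lemma sep_second_partial x i j l : B x -> sep l i -> j != i -> j != l ->
  g x i i * partial j (partial l (fun y => g y i i)) x =
  partial j (fun y => g y i i) x * partial l (fun y => g y i i) x.
Proof.
move=> Bx li ji jl.
have nz y : B y -> Lam l y - Lam i y != 0 by move=> By; rewrite subr_eq0 sep_Lam.
pose b y := partial l (Lam l) y / (Lam l y - Lam i y).
have sd : smooth_on B (fun y => Lam l y - Lam i y).
  exact: (smoothB oB (Lam_smooth l) (Lam_smooth i)).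
have sP : smooth_on B (partial l (Lam l)) by exact: (smooth_partial l (Lam_smooth l)).
have sV : smooth_on B (fun y => (Lam l y - Lam i y)^-1) by exact: (smoothV oB nz sd).
have sb : smooth_on B b by exact: (smoothM oB sP sV).
have e : {in B, partial l (fun y => g y i i) =1 (fun y => b y * g y i i)}.
  by move=> y; rewrite inE => By; exact: sep_dlog.
have db0 : partial j b x = 0.
  rewrite /partial deriveM; last 2 first.
  - exact: (smooth_derivable _ sP Bx).
  - exact: (smooth_derivable _ sV Bx).
  rewrite deriveV; [|exact: nz|exact: (smooth_derivable _ sd Bx)].
  rewrite deriveB; last 2 first.
  - exact: (smooth_derivable _ (Lam_smooth l) Bx).
  - exact: (smooth_derivable _ (Lam_smooth i) Bx).
  have lj : l != j by rewrite eq_sym.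
  have := partial2_Lam Bx lj; rewrite /partial => ->.
  have := partial_Lam0 Bx jl; rewrite /partial => ->.
  have := partial_Lam0 Bx ji; rewrite /partial => ->.
  by rewrite subrr !scaler0 addr0.
rewrite (@eq_partial_on R _ B _ _ j oB e x (mem_set Bx)).
rewrite (e x (mem_set Bx)) {1}/partial deriveM; last 2 first.
- exact: (smooth_derivable _ sb Bx).
- exact: (smooth_derivable _ (g_smooth i i) Bx).
move: db0; rewrite /partial => ->; rewrite scaler0 addr0 /GRing.scale /=.
by move: (derive _ _ _) => D; ring.
Qed.

Lemma dlog_sep x i j : B x -> g x i i != 0 -> sep j i ->
  dlog g x i j = partial j (Lam j) x / (Lam j x - Lam i x).
Proof. by move=> Bx gi ji; rewrite /dlog sep_dlog // mulfK. Qed.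

Lemma dlog_sep0 x i j : B x -> g x i i != 0 -> sep j i -> blk j != ord0 -> dlog g x i j = 0.
Proof. by move=> Bx gi ji j0; rewrite dlog_sep // partial_Lam_block // mul0r. Qed.

Lemma nsep_block i j : ~~ sep i j -> i != j -> blk i = blk j /\ blk i != ord0.
Proof. by rewrite /sep => + ij; rewrite ij negb_or negbK => /andP[/eqP ? ?]. Qed.

(** For eigenvalues a, b, d pairwise distinct this is the identity 1/((b-a)(d-a)) = 1/((b-a)(d-b)) +
    1/((d-a)(b-d)). If one pair shares its eigenvalue, that value is constant: it kills the
    separated derivatives along the pair, and the pair has equal logarithmic derivatives along the
    third coordinate. Two unseparated pairs exclude a separated third one. *)
Lemma dlog_relation x i j l : B x -> (forall i, g x i i != 0) ->
  i != j -> i != l -> j != l -> sep i j || sep i l || sep j l ->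
  dlog g x i j * dlog g x i l =
  dlog g x i j * dlog g x j l + dlog g x i l * dlog g x l j.
Proof.
move=> Bx gn ij il jl.
have eqL a b : blk a = blk b -> blk a != ord0 -> Lam a x = Lam b x.
  by move=> e a0; rewrite /Lam -e (negbTE a0).
case: (boolP (sep i j)) => sij; case: (boolP (sep i l)) => sil;
  case: (boolP (sep j l)) => sjl //= _.
- have dij := sep_Lam Bx sij; have dil := sep_Lam Bx sil; have djl := sep_Lam Bx sjl.
  rewrite !dlog_sep 1?sepC //; try by rewrite sepC.
  move: dij dil djl.
  move: (partial j _ x) (partial l _ x) (Lam i x) (Lam j x) (Lam l x) => P Q a b d ab ad bd.
  have h1 : b - a != 0 by rewrite subr_eq0 eq_sym.
  have h2 : d - a != 0 by rewrite subr_eq0 eq_sym.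
  have h3 : d - b != 0 by rewrite subr_eq0 eq_sym.
  have h4 : b - d != 0 by rewrite subr_eq0.
  by field; rewrite h1 h2 h3 h4.
- have [jl' j0] := nsep_block sjl jl.
  rewrite (@dlog_sep0 x i j) // 1?sepC // (@dlog_sep0 x i l) // 1?sepC // -?jl' //.
  by rewrite !mul0r addr0.
- have [il' i0] := nsep_block sil il.
  have l0 : blk l != ord0 by rewrite -il'.
  have slj : sep j l := sjl.
  rewrite (@dlog_sep0 x j l) //; last by rewrite sepC.
  rewrite mulr0 add0r mulrC; congr (_ * _).
  have sji : sep j i by rewrite sepC.
  by rewrite (dlog_sep Bx (gn i) sji) (dlog_sep Bx (gn l) sjl) (eqL i l).
- have sji : sep j i by rewrite sepC.
  by have := sep_congr sil il sji; rewrite (negbTE sjl).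
- have [ij' i0] := nsep_block sij ij.
  have j0 : blk j != ord0 by rewrite -ij'.
  rewrite (@dlog_sep0 x l j) // mulr0 addr0 !(@dlog_sep x _ l) //; try by rewrite sepC.
  by rewrite (eqL i j).
- have sli : sep l i by rewrite sepC.
  by have := sep_congr sij ij sli; rewrite sepC (negbTE sjl).
- have sji : ~~ sep j i by rewrite sepC.
  have nji : j != i by rewrite eq_sym.
  have slj : sep l j by rewrite sepC.
  by have := sep_congr sji nji slj; rewrite sepC (negbTE sil).
Qed.

(** * The Staeckel matrix of a product *)

Section ProductStaeckel.
Variables (rm : R) (rb : 'I_k.+1 -> R) (Sb : 'I_k.+1 -> 'I_n -> 'I_n -> R -> R)
  (eb : 'I_k.+1 -> 'I_n -> R).
Hypotheses (rm0 : 0 < rm) (rmr : rm <= r) (rmb : forall a, a != ord0 -> rm <= rb a).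
Hypothesis bsP : forall a, a != ord0 -> block_staeckel g p blk a (rb a) (Sb a) (eb a).

Let Bm : set 'rV[R]_n := ball p rm.
Let BmB x : Bm x -> B x. Proof. exact: le_ball. Qed.
Let lf a (x : 'rV[R]_n) : 'rV[R]_n := leaf p (leaf_point blk a x).

Let Blf a x : Bm x -> B (lf a x).
Proof. by move=> /BmB Bx; exact/ball_leaf/ball_leaf_point. Qed.

(** This is the warped product structure. On the leaf through [p] the coordinates of M_0 are those
    of [p], so [sigma_i] has there its value at [p]. *)
Lemma leaf_metric i j x : Bm x -> blk i = blk j -> blk i != ord0 ->
  g x i j / sigma i x = g (lf (blk i) x) i j / sigma i p.
Proof.
move=> Bx ij i0.
have -> : sigma i p = sigma i (lf (blk i) x).
  apply: eq_bigr => l /andP[/eqP l0 li]; rewrite (Lam_block_cst p (lf (blk i) x) i0); congr (_ - _).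
  apply: Lam_eq => //; first exact: Blf.
  by rewrite leaf_leaf_point l0 eq_sym (negbTE i0).
apply: quotient_sigma_eq => //; [exact: BmB|exact: Blf|by rewrite block_not_sep ?orbT|].
move=> l nli; rewrite leaf_leaf_point; case: (eqVneq l i) => [->|li]; first by rewrite eqxx.
by have [-> _] := nsep_block nli li; rewrite eqxx.
Qed.

Lemma product_diag x i j : Bm x -> i != j -> g x i j = 0.
Proof.
move=> Bx ij; have [sij|nij] := boolP (sep i j); first exact: (sep_g0 (BmB Bx)).
have [bij i0] := nsep_block nij ij.
have := leaf_metric Bx bij i0.
rewrite /lf (block_staeckel_diag (bsP i0)) //; last exact: (le_ball (rmb i0)).
move/eqP; rewrite mul0r mulf_eq0 invr_eq0 (negbTE (sigma_neq0 i (BmB Bx))) orbF.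
by move/eqP.
Qed.

Lemma product_neq0 x i : Bm x -> g x i i != 0.
Proof.
move=> Bx; apply: unitmx_row_neq0; first exact: (metric_unit gP (BmB Bx)).
by move=> j ji; apply: product_diag; rewrite // eq_sym.
Qed.

Lemma sigma_block i j x : blk i = blk j -> blk i != ord0 -> sigma i x = sigma j x.
Proof.
move=> ij i0; have Lij : Lam i x = Lam j x by rewrite /Lam -ij (negbTE i0).
rewrite /sigma Lij; apply: eq_bigl => l; case: (eqVneq (blk l) ord0) => //= l0.
have li : l != i by apply: contra_neq i0 => <-.
have lj : l != j by apply: contra_neq i0; rewrite ij => <-.
by rewrite li lj.
Qed.

(* The classical Staeckel matrix of the metric [\prod_l (lam_i - lam_l) dx_i^2]
   has the powers of [lam_i] as entries; here the powers are replaced by the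
   nodal polynomials at [p], for which it is diagonal at [p]. *)
Definition product_S (i j : 'I_n) (t : R) : R :=
  let q := upd p i t in
  if blk i == ord0 then
    g q i i / sigma i q *
    (if blk j == ord0 then \prod_(l | (blk l == ord0) && (l != j)) (Lam i q - Lam l p)
     else sigma j p * eb (blk j) j / (Lam i q - c (blk j)))
  else if blk i == blk j then Sb (blk i) i j t else 0.

(** In a column of a multidimensional block the terms of that block cancel against those of M_0. If
    M_0 is a point nothing cancels, but then [sigma] is an empty product and the constant of the
    factor survives. *)
Definition product_eps (j : 'I_n) : R :=
  if blk j == ord0 then 1 else
  if [exists l, blk l == ord0] then 0 else sigma j p * eb (blk j) j.

(** For [i] in block 0, [g_ii / sigma_i] depends on [x_i] alone, so its value on the coordinate line
    through [p] is its value at [x]; division by [g_ii] leaves [1 / sigma_i(x)]. *)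
Lemma product_S0 i j x : Bm x -> blk i = ord0 ->
  product_S i j (x 0 i) / g x i i =
  (if blk j == ord0 then \prod_(l | (blk l == ord0) && (l != j)) (Lam i x - Lam l p)
   else sigma j p * eb (blk j) j / (Lam i x - c (blk j))) / sigma i x.
Proof.
move=> Bx i0; rewrite /product_S i0 eqxx.
have px : `|p 0 i - x 0 i| < r by have /ball_rowP[_ h] := BmB Bx.
have Bq : B (upd p i (x 0 i)) by exact: ball_upd.
have -> : Lam i (upd p i (x 0 i)) = Lam i x.
  by apply: (Lam_eq Bq (BmB Bx)); rewrite updE eqxx.
have -> : g (upd p i (x 0 i)) i i / sigma i (upd p i (x 0 i)) = g x i i / sigma i x.
  apply: (quotient_sigma_eq Bq (BmB Bx)); rewrite ?eqxx // => l.
  case: (eqVneq l i) => [-> _|li]; first by rewrite updE eqxx.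
  by rewrite sepC sep_block0 // eq_sym.
move: (if _ then _ else _) => K.
have gx := product_neq0 i Bx; have sx := sigma_neq0 i (BmB Bx).
by field; rewrite gx sx.
Qed.

Lemma product_Sb i j x : Bm x -> blk i = blk j -> blk i != ord0 ->
  product_S i j (x 0 i) / g x i i =
  sigma j p / sigma j x * (Sb (blk j) i j (x 0 i) / g (lf (blk j) x) i i).
Proof.
move=> Bx ij i0; rewrite /product_S (negbTE i0) ij eqxx.
have := leaf_metric Bx (erefl (blk i)) i0; rewrite (sigma_block p ij i0) (sigma_block x ij i0) ij.
have gx := product_neq0 i Bx; have sx := sigma_neq0 j (BmB Bx).
have sp := sigma_neq0 j Bp.
move=> e; have -> : g (lf (blk j) x) i i = sigma j p * (g x i i / sigma j x).
  by rewrite e mulrC divfK.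
by field; rewrite gx sx sp.
Qed.

Let lam_inj x : B x -> forall i l, blk i == ord0 -> blk l == ord0 -> i != l -> Lam i x != Lam l x.
Proof. by move=> Bx i l /eqP i0 _ il; apply: sep_Lam => //; exact: sep_block0. Qed.

Lemma product_sum x j : Bm x -> \sum_i product_S i j (x 0 i) / g x i i = product_eps j.
Proof.
move=> Bx; rewrite (bigID (fun i => blk i == ord0)) /=.
pose A : pred 'I_n := fun i => blk i == ord0.
have inj := lam_inj (BmB Bx).
rewrite (eq_bigr (fun i => (if blk j == ord0 then
    \prod_(l | (blk l == ord0) && (l != j)) (Lam i x - Lam l p)
  else sigma j p * eb (blk j) j / (Lam i x - c (blk j))) / sigma i x)); last first.
  by move=> i /eqP i0; exact: product_S0.
rewrite /product_eps; have [j0|j0] := eqVneq (blk j) ord0.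
  rewrite [X in _ + X]big1 ?addr0 => [|i i0]; last first.
    by rewrite /product_S (negbTE i0) j0 (negbTE i0) mul0r.
  have Aj : A j by rewrite /A j0.
  (* The polynomial has its roots at the eigenvalues at [p], the interpolation its nodes at those at
     [x]; only the degree and the leading coefficient enter. *)
  rewrite -[RHS](lagrange_monic (A := A) inj (monic_nodal A (Lam ^~ p) j) (size_nodal (Lam ^~ p) Aj)).
  by apply: eq_bigr => i _; rewrite horner_nodal.
have -> : \sum_(i | blk i != ord0) product_S i j (x 0 i) / g x i i =
    sigma j p * eb (blk j) j / sigma j x.
  rewrite (bigID (fun i => blk i == blk j)) /= [X in _ + X]big1 ?addr0 => [|i /andP[i0 ij]]; last first.
    by rewrite /product_S (negbTE i0) (negbTE ij) mul0r.
  rewrite (eq_bigl (fun i => blk i == blk j)) => [|i]; last first.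
    by case: (eqVneq (blk i) (blk j)) => [->|]; rewrite ?andbF // j0.
  rewrite (eq_bigr (fun i => sigma j p / sigma j x * (Sb (blk j) i j (x 0 i) / g (lf (blk j) x) i i))).
    rewrite -mulr_sumr (block_staeckel_sum (bsP j0)) //; last exact: (le_ball (rmb j0)).
    by rewrite mulrAC.
  by move=> i /eqP ij; apply: product_Sb => //; rewrite ij.
(* As [j] is outside block 0, no factor is omitted, and [sigma_j] is the full product over the nodes
   required by [lagrange_inverse]. *)
have sj : sigma j x = \prod_(l | A l) (c (blk j) - Lam l x).
  rewrite /sigma /A; under eq_bigr do rewrite {1}/Lam (negbTE j0).
  apply: eq_bigl => l; case: (eqVneq (blk l) ord0) => //= l0.
  by apply: contra_neq j0 => <-.
case: ifPn => [/existsP[l /eqP l0]|/existsPn h].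
  have -> : \sum_(i | blk i == ord0) sigma j p * eb (blk j) j / (Lam i x - c (blk j)) / sigma i x =
     sigma j p * eb (blk j) j * - (sigma j x)^-1.
    rewrite sj -(lagrange_inverse (A := A) inj); first last.
    - move=> i /eqP i0; rewrite eq_sym.
      by have := @sep_Lam x i j (BmB Bx); rewrite {2}/Lam (negbTE j0); apply; apply: sep_block; rewrite i0 eq_sym.
    - by apply/card_gt0P; exists l; rewrite unfold_in l0.
    by rewrite mulr_sumr; apply: eq_bigr => i _; rewrite invfM mulrA.
  by rewrite mulrN addNr.
rewrite big1 ?add0r => [|i i0]; last by have := h i; rewrite i0.
by rewrite sj big1 ?divr1 // => i; rewrite /A (negbTE (h i)).
Qed.

Lemma smooth_coordinate_line (f : 'rV[R]_n -> R) i : smooth_on B f ->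
  smooth_on Bm (fun x : 'rV[R]_n => f (upd p i (x 0 i))).
Proof.
move=> sf; pose s (l : 'I_n) := if l == i then Some i else None.
have s_inj l1 l2 l : s l1 = Some l -> s l2 = Some l -> l1 = l2.
  by rewrite /s; do 2 case: eqP => // ->.
apply: (@eq_smooth _ _ _ (f \o subst s p) _ (ball_open p rm)).
  move=> x _ /=; congr f; apply/rowP => l; rewrite substE updE /s.
  by case: eqP => // ->.
apply: (smooth_subst s_inj (ball_open p rm)) sf => x Bx.
apply/ball_rowP; split=> // l; have /ball_rowP[_ h] := BmB Bx.
by rewrite substE /s; case: eqP => [->|_]; rewrite ?subrr ?normr0.
Qed.

Lemma product_smooth i j : smooth_on Bm (fun x : 'rV[R]_n => product_S i j (x 0 i)).
Proof.
have oBm : open Bm := ball_open p rm.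
have [i0|i0] := eqVneq (blk i) ord0; last first.
  have [ij|ij] := eqVneq (blk i) (blk j); last first.
    apply: (@eq_smooth _ _ _ (fun=> 0) _ oBm); last exact: smooth_cst.
    by move=> x _; rewrite /product_S (negbTE i0) (negbTE ij).
  apply: (@eq_smooth _ _ _ (fun x : 'rV[R]_n => Sb (blk i) i j (x 0 i)) _ oBm).
    by move=> x _; rewrite /product_S (negbTE i0) ij eqxx.
  apply: (@smooth_subset _ _ _ (ball p (rb (blk i)))); first exact: (le_ball (rmb i0)).
  exact: (block_staeckel_smooth (bsP i0) erefl (esym ij)).
pose f y := g y i i / sigma i y *
    (if blk j == ord0 then \prod_(l | (blk l == ord0) && (l != j)) (Lam i y - Lam l p)
     else sigma j p * eb (blk j) j / (Lam i y - c (blk j))).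
apply: (@eq_smooth _ _ _ (fun x : 'rV[R]_n => f (upd p i (x 0 i))) _ oBm).
  by move=> x _; rewrite /product_S i0 eqxx.
apply: smooth_coordinate_line; rewrite /f.
apply: (smoothM oB).
  apply: (smoothM oB); first exact: g_smooth.
  by apply: (smoothV oB); [move=> y By; exact: sigma_neq0|exact: sigma_smooth].
have [j0|j0] := eqVneq (blk j) ord0.
  apply: (@smooth_prod R n _ _ _ B (fun l y => Lam i y - Lam l p) oB) => l _.
  by apply: (smoothB oB); [exact: Lam_smooth|exact: smooth_cst].
apply: (smoothM oB); first exact: smooth_cst.
apply: (smoothV oB); last first.
  by apply: (smoothB oB); [exact: Lam_smooth|exact: smooth_cst].
move=> y By; rewrite subr_eq0.
by have := @sep_Lam y i j By; rewrite {2}/Lam (negbTE j0); apply; apply: sep_block; rewrite i0 eq_sym.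
Qed.

(** At [p] the columns of block 0 have one nonzero entry each, since a nodal polynomial vanishes at
    the other nodes. This kills [u] on block 0, after which the remaining columns decouple into the
    factors. *)
Lemma product_nonsing (u : 'I_n -> R) :
  (forall j, \sum_i u i * product_S i j (p 0 i) = 0) -> forall i, u i = 0.
Proof.
move=> h; have u0 j : blk j = ord0 -> u j = 0.
  move=> j0; have := h j; rewrite (bigD1 j) //= big1 ?addr0 => [|i ij]; last first.
    rewrite /product_S j0 eqxx; have [i0|i0] := eqVneq (blk i) ord0; last by rewrite mulr0.
    have Pi : (blk i == ord0) && (i != j) by rewrite i0 eqxx ij.
    by rewrite upd_id (bigD1 i Pi) /= subrr mul0r !mulr0.
  rewrite /product_S j0 eqxx upd_id -/(sigma j p) divfK ?sigma_neq0 //.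
  by move/eqP; rewrite mulf_eq0 (negbTE (product_neq0 j (ballxx p rm0))) orbF => /eqP.
move=> i; have [i0|i0] := eqVneq (blk i) ord0; first exact: u0.
apply: (block_staeckel_nonsing (bsP i0)) => // j ji.
rewrite -[RHS](h j) [RHS](bigID (fun i' => blk i' == blk i)) /=.
rewrite [X in _ = _ + X]big1 ?addr0 => [|l li]; last first.
  have [l0|l0] := eqVneq (blk l) ord0; first by rewrite u0 ?mul0r.
  by rewrite /product_S (negbTE l0) ji (negbTE li) mulr0.
by apply: eq_bigr => l /eqP li; rewrite /product_S li (negbTE i0) ji eqxx.
Qed.

Lemma product_staeckel : staeckel g p rm product_S product_eps.
Proof.
split=> //.
- by move=> x Bx i j; exact: product_diag.
- by move=> x Bx i; exact: product_neq0.
- exact: product_smooth.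
- by move=> x Bx j; exact: product_sum.
- exact: product_nonsing.
Qed.

End ProductStaeckel.

Lemma product_curvature : (forall i, g p i i != 0) ->
  (forall a, a != ord0 ->
     diagonal_curvature_at (@leaf_restr R n k blk a p g) (leaf_point blk a p)) ->
  diagonal_curvature_at g p.
Proof.
move=> gn IH i j l ij il jl.
have [s|] := boolP (sep i j || sep i l || sep j l); last first.
  rewrite !negb_or -andbA => /and3P[nij nil njl].
  have [bij i0] := nsep_block nij ij; have [bil _] := nsep_block nil il.
  have [i' ei] := @block_index_surj n k blk (blk i) i erefl.
  have [j' ej] := block_index_surj (esym bij).
  have [l' el] := block_index_surj (esym bil).
  have := @leaf_curvature _ n k g p blk (blk i) i' j' l' (IH _ i0); rewrite ei ej el; apply.
  - by apply: contra_neq ij => e; rewrite -ei -ej e.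
  - by apply: contra_neq il => e; rewrite -ei -el e.
  - by apply: contra_neq jl => e; rewrite -ej -el e.
split; last exact: (dlog_relation Bp gn).
have [sji|nji] := boolP (sep j i).
  by apply: (sep_second_partial Bp sji); rewrite eq_sym.
(* Were [l] not separated from [i] either, all three would share an eigenspace, against [s]. *)
have sli : sep l i.
  rewrite sepC; move: s; rewrite sepC (negbTE nji) /=; case/orP => // sjl.
  have ji : j != i by rewrite eq_sym.
  by rewrite sepC; apply: (sep_congr nji ji); rewrite sepC.
rewrite (partialC l j oB (g_smooth i i) Bp) mulrC [RHS]mulrC mulrC.
by apply: (sep_second_partial Bp sli); rewrite // eq_sym.
Qed.

End KEMStep.

(** * Induction on KEM coordinates *)

Section Restriction.
Variables (R : realType) (n k : nat) (U V : set 'rV[R]_n).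
Variables (g L : 'rV[R]_n -> 'M[R]_n) (blk : 'I_n -> 'I_k.+1).
Hypothesis VU : V `<=` U.

Lemma symmetric_tensor_subset : symmetric_tensor U g -> symmetric_tensor V g.
Proof.
case=> sg tg; split; last by move=> x /VU; exact: tg.
by move=> i j; exact: (smooth_subset U VU (sg i j)).
Qed.

Lemma pseudo_riemannian_subset : pseudo_riemannian U g -> pseudo_riemannian V g.
Proof.
case=> sg ug; split; first exact: symmetric_tensor_subset.
by move=> x /VU; exact: ug.
Qed.

Lemma associated_product_subset :
  associated_product U g L blk -> associated_product V g L blk.
Proof.
case=> h0 h; split=> [x /VU Ux|a a0]; first exact: h0.
have [ca [c hc]] := h a a0; split=> //; exists c => x /VU Ux; exact: hc.
Qed.

Lemma adapted_coordinates_subset p :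
  adapted_coordinates U g L blk p -> adapted_coordinates V g L blk p.
Proof. by move=> h y /VU; exact: h. Qed.

End Restriction.

Lemma orthogonal_concircular_subset (R : realType) (n : nat) (U V : set 'rV[R]_n)
    (g L : 'rV[R]_n -> 'M[R]_n) : V `<=` U ->
  orthogonal_concircular U g L -> orthogonal_concircular V g L.
Proof.
move=> VU [[sL [al [sal hal]]] dL]; split; last by move=> x /VU; exact: dL.
split; first exact: (symmetric_tensor_subset VU sL).
exists al; split=> [i|x /VU]; first exact: (smooth_subset U VU (sal i)).
exact: hal.
Qed.

(** Curvature at the centre alone is enough to induct on, because every leaf used passes through
    [p]. The radius is quantified after the derivation so that the hypothesis applies to leaves of
    whatever ball carries both the metric and [L]. *)
Lemma KEM_staeckel (R : realType) (n : nat) (g : 'rV[R]_n -> 'M[R]_n) (p : 'rV[R]_n) :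
  KEM_at g p -> forall r : R, 0 < r -> pseudo_riemannian (ball p r) g ->
  (exists r' S eps, staeckel g p r' S eps) /\ diagonal_curvature_at g p.
Proof.
elim=> {n g p} n g p r1 L k blk r10 LP1 _ AP1 AD1 _ IH r2 r20 gP2.
pose r := Num.min r1 r2.
have r0 : 0 < r by rewrite lt_min r10 r20.
have Br1 : ball p r `<=` ball p r1 by apply: le_ball; rewrite ge_min lexx.
have Br2 : ball p r `<=` ball p r2 by apply: le_ball; rewrite ge_min lexx orbT.
have gP := pseudo_riemannian_subset Br2 gP2.
have LP := orthogonal_concircular_subset Br1 LP1.
have AP := associated_product_subset Br1 AP1.
have AD := adapted_coordinates_subset Br1 AD1.
have Bp : ball p r p by exact: ballxx.
have [c cP] : exists c : 'I_k.+1 -> R, forall a, a != ord0 -> forall x : 'rV[R]_n, ball p r x ->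
    (eigenspace (endo (g x) (L x)) (c a) == block_space R blk a)%MS.
  suff /choice[c hc] : forall a : 'I_k.+1, exists c : R, a != ord0 ->
      forall x : 'rV[R]_n, ball p r x ->
      (eigenspace (endo (g x) (L x)) c == block_space R blk a)%MS by exists c.
  move=> a; have [a0|a0] := eqVneq a ord0; first by exists 0.
  by have [_ [c hc]] := AP.2 a a0; exists c => _ x /hc[].
have [_ [alpha [_ alphaP]]] := LP.1.
have cross x : ball p r x -> forall i j, blk i != blk j -> g x i j = 0.
  by move=> Bx i j; exact: (block_orthogonal Bp gP LP AP cP).
have IHa a (a0 : a != ord0) := IH a a0 r r0 (@leaf_restr_pseudo R n k blk a p r g gP cross).
have [d dP] : exists d : 'I_k.+1 -> R * ('I_n -> 'I_n -> R -> R) * ('I_n -> R),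
    forall a, a != ord0 -> block_staeckel g p blk a (d a).1.1 (d a).1.2 (d a).2.
  suff /choice[d hd] : forall a : 'I_k.+1,
      exists d : R * ('I_n -> 'I_n -> R -> R) * ('I_n -> R),
      a != ord0 -> block_staeckel g p blk a d.1.1 d.1.2 d.2 by exists d.
  move=> a; have [a0|a0] := eqVneq a ord0; first by exists (0, fun _ _ _ => 0, fun=> 0).
  have [[r' [S [eps /staeckel_block[S' [eps' h]]]]] _] := IHa a a0.
  by exists (r', S', eps').
pose rm := \big[Num.min/r]_(a | a != ord0) (d a).1.1.
have rm0 : 0 < rm.
  rewrite /rm; elim/big_ind: _ => // [x y x0 y0|a a0]; first by rewrite lt_min x0 y0.
  exact: (block_staeckel_gt0 (dP a a0)).
have rmr : rm <= r by exact: bigmin_le_id.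
have rmb a : a != ord0 -> rm <= (d a).1.1.
  by move=> a0; exact: (bigmin_le_cond _ (fun a => (d a).1.1) a0).
have SP := product_staeckel r0 gP LP AP AD cP alphaP rm0 rmr rmb dP.
split; first by exists rm; do 2!eexists; exact: SP.
apply: (product_curvature r0 gP LP AP AD cP alphaP).
  by move=> i; exact: (staeckel_neq0 SP (ballxx p rm0)).
by move=> a a0; have [] := IHa a a0.
Qed.

(** * Curvature of a diagonal metric *)

Section DiagonalMetric.
Variables (R : realType) (n : nat) (U : set 'rV[R]_n) (g : 'rV[R]_n -> 'M[R]_n).
Hypotheses (oU : open U) (gP : pseudo_riemannian U g).
Hypothesis dg : forall x, U x -> forall i j, i != j -> g x i j = 0.
Hypothesis dg0 : forall x, U x -> forall i, g x i i != 0.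

Lemma partial_offdiag x l i j : U x -> i != j -> partial l (fun y => g y i j) x = 0.
Proof.
move=> Ux ij; have e : {in U, (fun y => g y i j) =1 (fun=> 0)}.
  by move=> y; rewrite inE => Uy; exact: dg.
by rewrite (@eq_partial_on R _ U _ _ l oU e x (mem_set Ux)) /partial derive_cst.
Qed.

Lemma christoffel_diag x l i j : U x -> christoffel g l i j x =
  2^-1 * ((g x l l)^-1 * (partial i (fun y => g y j l) x + partial j (fun y => g y i l) x
                          - partial l (fun y => g y i j) x)).
Proof.
move=> Ux; rewrite /christoffel (bigD1 l) //= big1 ?addr0 => [|m ml].
  by rewrite (invmx_diag (dg Ux) (dg0 Ux)) !mxE eqxx mulr1n.
by rewrite (invmx_diag (dg Ux) (dg0 Ux)) !mxE eq_sym (negbTE ml) mulr0n mul0r.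
Qed.

Lemma christoffel_distinct x l i j : U x -> l != i -> l != j -> i != j ->
  christoffel g l i j x = 0.
Proof.
move=> Ux li lj ij; rewrite christoffel_diag // !partial_offdiag //; last 2 first.
- by rewrite eq_sym.
- by rewrite eq_sym.
by rewrite addr0 subrr !mulr0.
Qed.

Lemma christoffel_dlog x l i : U x -> christoffel g l i l x = 2^-1 * dlog g x l i.
Proof. by move=> Ux; rewrite christoffel_diag // addrK; congr (_ * _); rewrite mulrC. Qed.

Lemma christoffel_square x l i : U x -> l != i ->
  christoffel g l i i x = - (2^-1 * (dlog g x i l * g x i i / g x l l)).
Proof.
move=> Ux li; have il : i != l by rewrite eq_sym.
rewrite christoffel_diag // !(partial_offdiag _ Ux il) /dlog divfK ?dg0 // addr0 sub0r.
by rewrite mulrN mulrN; congr (- (_ * _)); rewrite mulrC.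
Qed.

Lemma partial_dlog x l i j : U x -> partial j (fun y => dlog g y l i) x =
  (g x l l * partial j (partial i (fun y => g y l l)) x -
   partial j (fun y => g y l l) x * partial i (fun y => g y l l) x) / g x l l ^+ 2.
Proof.
move=> Ux; have sg : smooth_on U (fun y => g y l l) by exact: (metric_smooth gP).
have sp : smooth_on U (partial i (fun y => g y l l)) by exact: (smooth_partial i sg).
have dgx := smooth_derivable j sg Ux; have dpx := smooth_derivable j sp Ux.
have nz := dg0 Ux l.
rewrite /dlog; move: (partial i _) sp dpx => P sp dpx.
have dV : derivable (fun y => (g y l l)^-1) x (delta_mx 0 j) by exact: (derivableV nz dgx).
rewrite /partial deriveM; [|exact: dpx|exact: dV].
rewrite deriveV; [|exact: nz|exact: dgx].
rewrite /GRing.scale /=.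
by move: (derive _ _ _) (derive _ _ _) (P x) (g x l l) nz => E D a b nz; field.
Qed.

Lemma riemann_diagonal p i j k : U p -> diagonal_curvature_at g p -> j != k ->
  riemann g i j i k p = 0.
Proof.
move=> Up dc jk; rewrite /riemann (bigD1 i) //= [X in _ + X]big1 ?addr0 => [|m mi]; last first.
  by rewrite dg ?mul0r // eq_sym.
have [<-|ik] := eqVneq i k; first by rewrite subrr big1 ?addr0 ?mulr0 // => q _; rewrite subrr.
rewrite (bigD1 i) //= (bigD1 k) /=; last by rewrite eq_sym.
have cC l a b : christoffel g l a b p = christoffel g l b a p := christoffelC oU gP l a b Up.
have half (a b : 'I_n) (x : 'rV[R]_n) : U x -> christoffel g a b a x = 2^-1 * dlog g x a b.
  exact: christoffel_dlog.
have phalf a b l : partial l (christoffel g a b a) p = 2^-1 * partial l (fun y => dlog g y a b) p.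
  have e : {in U, christoffel g a b a =1 (fun y => 2^-1 * dlog g y a b)}.
    by move=> y; rewrite inE; exact: half.
  rewrite (@eq_partial_on R _ U _ _ l oU e p (mem_set Up)) /partial.
  rewrite deriveZ //.
  have sg : smooth_on U (fun y => g y a a) by exact: (metric_smooth gP).
  have sp : smooth_on U (partial b (fun y => g y a a)) by exact: (smooth_partial b sg).
  apply: derivableM; first exact: (smooth_derivable l sp Up).
  apply: derivableV; [exact: dg0|exact: (smooth_derivable l sg Up)].
(* [R_iiik] is zero by antisymmetry; in coordinates this is the symmetry of second derivatives and a
   cancellation of Christoffel products. *)
have [ij|ij] := eqVneq i j.
  subst j.
  rewrite phalf phalf !partial_dlog // (partialC i k oU (metric_smooth gP i i) Up).
  rewrite big1 => [|q /andP[qi qk]]; last first.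
    rewrite (@christoffel_distinct p q k i) ?(@christoffel_distinct p i k q) // 1?eq_sym //.
    by rewrite mulr0 mul0r subrr.
  have ki : k != i by rewrite eq_sym.
  rewrite (cC i i k) (cC k k i) !half // !christoffel_square //.
  move: (dg0 Up i) (dg0 Up k) (dlog g p i i) (dlog g p i k) (dlog g p k i).
  move: (g p i i) (g p k k) (partial _ _ p) (partial _ _ p) (partial _ _ p).
  by move=> a b A B C a0 b0 d e f; field; rewrite a0 b0.
have kj : k != j by rewrite eq_sym.
have ki : k != i by rewrite eq_sym.
have ji : j != i by rewrite eq_sym.
have [X Y] := dc i j k ij ik jk.
rewrite (bigD1 j) /=; last by rewrite ji jk.
rewrite big1 ?addr0 => [|q /andP[/andP[qi qk] qj]]; last first.
  rewrite (@christoffel_distinct p q k j) ?(@christoffel_distinct p i k q) // 1?eq_sym //.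
  by rewrite mulr0 mul0r subrr.
have -> : partial i (christoffel g i k j) p = 0.
  have e : {in U, christoffel g i k j =1 (fun=> 0)}.
    by move=> y; rewrite inE => Uy; rewrite christoffel_distinct.
  by rewrite (@eq_partial_on R _ U _ _ i oU e p (mem_set Up)) /partial derive_cst.
have -> : partial k (christoffel g i i j) p = 0.
  have e : {in U, christoffel g i i j =1 christoffel g i j i}.
    by move=> y; rewrite inE; exact: (christoffelC oU gP).
  rewrite (@eq_partial_on R _ U _ _ k oU e p (mem_set Up)) phalf partial_dlog // X.
  by rewrite subrr mul0r mulr0.
rewrite (@christoffel_distinct p i k j) // (@christoffel_distinct p k i j) //.
rewrite (cC i i k) (cC i i j) (cC k k j) !half //.
move: Y; move: (dlog g p i j) (dlog g p i k) (dlog g p j k) (dlog g p k j).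
move: (dlog g p i i) (dlog g p j i) (christoffel _ _ _ _ _) => d e f a b a' b' Y.
(* The derivatives are gone, one of them by [X]. The products for [q = j], [q = k] and [q = i] give
   the three terms, which cancel by [Y]. *)
rewrite (_ : _ + _ = 4^-1 * (a * a' + b * b' - a * b)); last by field.
by rewrite Y subrr !mulr0.
Qed.

End DiagonalMetric.

Theorem proposition2p1 (R : realType) (n : nat) (U : set 'rV[R]_n)
    (g : 'rV[R]_n -> 'M[R]_n) :
  open U -> pseudo_riemannian U g -> KEM_coordinates U g ->
  orthogonal_coordinates U g /\ separable_coordinates U g /\
  diagonal_curvature U g.
Proof.
move=> oU gP kem.
have local p : U p -> exists r, [/\ 0 < r, pseudo_riemannian (ball p r) g,
    exists S eps, staeckel g p r S eps & diagonal_curvature_at g p].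
  move=> Up; have /nbhs_ballP[r1 /= r10 r1U] : nbhs p U by exact: open_nbhs_nbhs.
  have gP1 := pseudo_riemannian_subset r1U gP.
  have [[r2 [S [eps SP]]] dc] := KEM_staeckel (kem p Up) r10 gP1.
  pose r := Num.min r1 r2.
  have r0 : 0 < r by rewrite lt_min r10 (staeckel_gt0 SP).
  have Br1 : ball p r `<=` ball p r1 by apply: le_ball; rewrite ge_min lexx.
  have Br2 : ball p r `<=` ball p r2 by apply: le_ball; rewrite ge_min lexx orbT.
  exists r; split=> //; first exact: (pseudo_riemannian_subset Br1 gP1).
  by exists S, eps; exact: (staeckel_subset r0 Br2 SP).
split; last split=> [p Up|p Up i j k jk].
- move=> p Up; have [r [r0 gPr [S [eps SP]] _]] := local p Up.
  apply: (diagonal_orthogonal r0).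
  + by move=> i; exact: (metric_smooth gPr).
  + exact: (staeckel_diag SP).
  + exact: (staeckel_neq0 SP).
- have [r [r0 gPr [S [eps SP]] _]] := local p Up.
  have [r' [C [E [w h]]]] := staeckel_separable SP.
  by exists r', C, E, w.
- have [r [r0 gPr [S [eps SP]] dc]] := local p Up.
  exact: (@riemann_diagonal R n (ball p r) g (ball_open p r) gPr (staeckel_diag SP)
    (staeckel_neq0 SP) p i j k (ballxx p r0) dc jk).
Qed.
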